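(* Let $\Omega\subset\mathbb{R}^2$ be a bounded convex domain, and let $u$ be the unique minimizer of $$L[w;\Omega]=\int_\Omega\Bigl(\tfrac12|Dw-x|^2+w\Bigr)\,dx$$ over the class $\mathcal{K}(\Omega)$ of convex nonnegative functions $w:\overline\Omega\to\mathbb{R}$. Then $u\in C^1(\overline\Omega)$.
   Context: A domain is an open set. $\mathcal{K}(\Omega):=\{w:\overline\Omega\to\mathbb{R} : w \text{ convex and nonnegative}\}$. The functional $L[\cdot;\Omega]$ is strictly convex, so the minimizer is unique (as a function on $\Omega$; its values on $\partial\Omega$ are understood as those of its continuous extension from $\Omega$). $u\in C^1(\overline\Omega)$ means that $u$ is $C^1$ in $\Omega$ and $u,Du$ extend continuously to $\overline\Omega$. *)

(* Defs.v *)
From HB Require Import structures.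
From mathcomp Require Import all_boot all_order all_algebra.
From mathcomp Require Import all_classical all_reals all_analysis.
Import Order.TTheory GRing.Theory Num.Theory.
Import numFieldNormedType.Exports.

Set Implicit Arguments.
Unset Strict Implicit.
Unset Printing Implicit Defensive.

Local Open Scope classical_set_scope.
Local Open Scope ring_scope.

Section plane.
Context {R : realType}.
Implicit Types (Omega : set (R * R)) (w : R * R -> R).

Definition plane_measure :
    {measure set (measurableTypeR R * measurableTypeR R) -> \bar R} :=
  (@lebesgue_measure R \x @lebesgue_measure R)%E.

(* ['D_v w x] is a total operator with a fixed default value where the
   directional derivative does not exist.  A convex [w] is differentiable
   almost everywhere in an open convex set, so the default does not affect the
   integral below. *)
Definition grad w (x : R * R) : R * R := ('D_(1, 0) w x, 'D_(0, 1) w x).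

(* [R * R] carries the sup norm, so the Euclidean norm is written out. *)
Definition sqnorm (p : R * R) : R := p.1 ^+ 2 + p.2 ^+ 2.

(* Functions on the closure of [Omega] are represented by total functions, of
   which only the values on the closure are constrained. *)
Definition K_class Omega w : Prop :=
  @convex_function R (R * R)%type (closure Omega) w /\
  (forall x, closure Omega x -> 0 <= w x).

(* The integrand is nonnegative on [K_class Omega], so the extended-real
   integral is meaningful there without any integrability assumption. *)
Definition L_functional Omega w : \bar R :=
  (\int[plane_measure]_(x in Omega)
     (2^-1 * sqnorm (grad w x - x) + w x)%:E)%E.

Definition is_minimizer Omega u : Prop :=
  K_class Omega u /\
  (forall w, K_class Omega w -> (L_functional Omega u <= L_functional Omega w)%E).

End plane.

Definition extends_continuously {T U : topologicalType} (A : set T)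
    (f : T -> U) : Prop :=
  exists2 g : T -> U, {within closure A, continuous g} &
                      (forall x, A x -> g x = f x).

(* The values of [u] on the boundary play no role: they are understood as those
   of the continuous extension from the interior. *)
Definition C1_closure {R : realType} (Omega : set (R * R)) (u : R * R -> R)
    : Prop :=
  [/\ forall x, Omega x -> differentiable u x,
      forall x, Omega x -> {for x, continuous (grad u)},
      extends_continuously Omega u &
      extends_continuously Omega (grad u)].

(* Main.v *)
(** Up to the fixed term [|x|^2 / 2], the energy density of [w] at [x] is the
    cost [|Dw|^2 / 2 + (w - x . Dw)] of the tangent plane of [w] at [x]. The
    supremum of the tangent planes of [u] of nonpositive cost is therefore a
    better competitor than [u], so that [u] is the restriction of a Lipschitz
    convex function of the plane. The gradient is then controlled by raising and
    by lowering [u].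

    Raising. Let [phi] be the increment from [u] to [max(u, l)], where [l] has
    slope [k] and lies [h] above a supporting plane at [x0]. Contracting [Omega]
    towards a point [z] of its closure and changing variables gives
    [int Dphi . (z - x) <= 2 int phi], so that minimality yields
    [1/2 int |Dphi|^2 <= int Dphi . (k - x0) + 3 int phi]. If [{phi > 0}] is
    thin in some direction, then [int phi <= A h int |Dphi|], and the two bounds
    are incompatible when the flux of [k - x0] is small. This shows that
    subgradients are unique in [Omega], that the directional derivative of [u]
    at a boundary point is linear, with slope [p] say, and that every limit
    [tau] of [Du - p] at that point satisfies [tau . (p - x0) >= 0].

    Lowering. If some limit [tau] is not zero, take one which maximizes
    [|q|^2 / 2 + q . (p - x0)]. Points where [Du - p] is close to [tau] approach
    [x0] along a direction [n] orthogonal to [tau]. Remove the tangent planes of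
    large tilted cost, the tilt being [- K n . Du], in a small sector around
    this direction: the change is supported in the sector, translations by [- n]
    send the sector into [Omega] except near [x0], so that the tilt integrates
    to at most zero and the energy decreases. Hence [Du] has a limit at every
    point of the closure. *)

Require Import Defs.
From HB Require Import structures.
From mathcomp Require Import all_boot all_order all_algebra.
From mathcomp Require Import all_classical all_reals all_analysis.
From mathcomp Require Import measurable_realfun prodnormedzmodule ring lra.
Import Order.TTheory GRing.Theory Num.Theory.
Import numFieldNormedType.Exports.

Set Implicit Arguments.
Unset Strict Implicit.
Unset Printing Implicit Defensive.

Local Open Scope classical_set_scope.
Local Open Scope ring_scope.

(** * Measures and integrals in the plane *)

(** Nothing is known of the boundary beyond convexity, so no boundary integral and no Euler-Lagrange
    equality is available. Every flux estimate is one-sided: a nonnegative function is compared with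
    its composition with an affine map, and what leaves the domain is either nothing or negligible
    with respect to the displacement.

    Raising works because the energy is quadratic in [Dphi] whereas mass and flux are linear:
    Young's inequality combines the bounds into [1 <= 36 A^2 (B + 3 h)], where [A] measures
    thinness, [B] is the flux per unit area and the height [h] is free. For a kink of the
    directional derivative, seen through a window of size [e] with slope jump of order [dl], [A] is
    at most of order [1/dl] and [B] of order [dl^2 e], so a small [e] is absurd.

    In lowering, the maximality of [tau] alone does not confine the expensive tangent planes: slopes
    with a large component along [n] could cost as much. The tilt penalizes that component, with a
    strength [1/(32 a)] fixed by its value [a] at a reference point; monotonicity of the gradient
    then forces the expensive points into a core inside the sector. *)

Definition push_measure d d' (T1 : measurableType d) (T2 : measurableType d')
    (R : realFieldType) (m : {measure set T1 -> \bar R}) (f : T1 -> T2)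
    (mf : measurable_fun setT f) : {measure set T2 -> \bar R} :=
  measure_function_pushforward__canonical__measure_function_Measure m mf.

Section affine_change_of_variables.
Context {R : realType}.
Local Notation leb := (@lebesgue_measure R).
Local Notation mu := (@plane_measure R).
Local Notation R1 := (measurableTypeR R).
Local Notation R2 := (measurableTypeR R * measurableTypeR R)%type.

Lemma measurable_affine1 (a b : R) :
  measurable_fun [set: R1] (fun x : R1 => a * x + b : R1).
Proof.
exact: measurable_funD.
Qed.

(** Uniqueness of Lebesgue measure: the pushforward rescaled by [|a|] is correct on half-open
    intervals. For [a < 0] the preimage is half open on the other side, with the same length. *)
Lemma lebesgue_measure_affine (a b : R) (A : set R) : a != 0 -> measurable A ->
  leb ((fun x => a * x + b) @^-1` A) = (`|a|^-1%:E * leb A)%E.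
Proof.
move=> a0 mA.
have na0 : 0 < `|a| by rewrite normr_gt0.
pose T : R1 -> R1 := fun x => a * x + b.
pose mT : measurable_fun setT T := measurable_affine1 a b.
pose m1 := mscale (NngNum (normr_ge0 a)) (push_measure leb mT).
suff -> : leb A = (`|a|%:E * leb (T @^-1` A))%E.
  by rewrite muleA -EFinM mulVf ?gt_eqF// mul1e.
rewrite -[RHS]/(m1 A).
apply: lebesgue_measure_unique => // _ [[x y] _ <-] /=.
rewrite /m1 /= /mscale/= /pushforward.
have [ap|an|a00] := ltgtP 0 a; last by rewrite -a00 eqxx in a0.
- have -> : T @^-1` `]x, y]%classic = `](x - b) / a, (y - b) / a]%classic.
    apply/seteqP; split => z; rewrite /T /= !in_itv/= => /andP[h1 h2].
      by apply/andP; split; rewrite ?ltr_pdivrMr ?ler_pdivlMr//; lra.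
    by move: h1 h2; rewrite ltr_pdivrMr// ler_pdivlMr// => h1 h2; apply/andP; split; lra.
  rewrite !lebesgue_measure_itv/= !lte_fin ltr_pM2r ?invr_gt0// ltrD2r.
  case: ifP => _; last by rewrite mule0.
  by rewrite -!EFinB -EFinM gtr0_norm//; congr EFin; field.
- have -> : T @^-1` `]x, y]%classic = `[(y - b) / a, (x - b) / a[%classic.
    apply/seteqP; split => z; rewrite /T /= !in_itv/= => /andP[h1 h2].
      by apply/andP; split; rewrite ?ler_ndivrMr ?ltr_ndivlMr//; lra.
    by move: h1 h2; rewrite ler_ndivrMr// ltr_ndivlMr// => h1 h2; apply/andP; split; lra.
  rewrite !lebesgue_measure_itv/= !lte_fin ltr_nM2r ?invr_lt0// ltrD2r.
  case: ifP => _; last by rewrite mule0.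
  by rewrite -!EFinB -EFinM ltr0_norm//; congr EFin; field.
Qed.

(** For an affine bijection [k] is the inverse of the absolute value of the determinant, since
    preimages are measured. *)
Definition scales_measure (k : R) (T : R2 -> R2) :=
  measurable_fun setT T /\
  forall A, measurable A -> mu (T @^-1` A) = (k%:E * mu A)%E.

Lemma scales_measure_comp k1 k2 T1 T2 :
  scales_measure k1 T1 -> scales_measure k2 T2 ->
  scales_measure (k1 * k2) (T2 \o T1).
Proof.
move=> [m1 h1] [m2 h2]; split; first exact: measurableT_comp.
move=> A mA; rewrite comp_preimage h1; last first.
  by rewrite -[X in measurable X]setTI; exact: m2.
by rewrite h2// EFinM muleA.
Qed.

Lemma plane_measure_xsection (A : set R2) :
  mu A = (\int[leb]_x leb (xsection A x))%E.
Proof. by []. Qed.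

Lemma plane_measure_ysection (A : set R2) : measurable A ->
  mu A = (\int[leb]_y leb (ysection A y))%E.
Proof.
move=> mA.
rewrite -[RHS]/((leb \x^ leb)%E A).
apply: (product_measure_unique (m' := [the {measure set _ -> \bar R} of (leb \x^ leb)%E])) => //.
by move=> B C mB mC; rewrite /= product_measure2E.
Qed.

Lemma scales_measure_snd (c d f : R) : d != 0 ->
  scales_measure `|d|^-1 (fun x : R2 => (x.1, c * x.1 + d * x.2 + f)).
Proof.
move=> d0.
have mT : measurable_fun setT (fun x : R2 => (x.1, c * x.1 + d * x.2 + f) : R2).
  apply: measurable_fun_pair; first exact: measurable_fst.
  apply: measurable_funD => //.
  apply: measurable_funD; apply: measurableT_comp => //.
split => // A mA.
rewrite !plane_measure_xsection -ge0_integralZl//; last first.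
  exact: measurable_fun_xsection.
apply: eq_integral => x _.
rewrite -(lebesgue_measure_affine (c * (x : R) + f))//; last exact: measurable_xsection.
congr (leb _); apply/seteqP; split => y; rewrite /xsection/= !inE/=.
  by rewrite -addrA addrCA.
by rewrite -(addrA (c * x)) (addrCA (c * x)).
Qed.

Lemma scales_measure_fst (a b e : R) : a != 0 ->
  scales_measure `|a|^-1 (fun x : R2 => (a * x.1 + b * x.2 + e, x.2)).
Proof.
move=> a0.
have mT : measurable_fun setT (fun x : R2 => (a * x.1 + b * x.2 + e, x.2) : R2).
  apply: measurable_fun_pair; last exact: measurable_snd.
  apply: measurable_funD => //.
  apply: measurable_funD; apply: measurableT_comp => //.
split => // A mA.
have mTA : measurable ((fun x : R2 => (a * x.1 + b * x.2 + e, x.2)) @^-1` A).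
  by rewrite -[X in measurable X]setTI; exact: mT.
rewrite !plane_measure_ysection// -ge0_integralZl//; last first.
  exact: measurable_fun_ysection.
apply: eq_integral => y _.
rewrite -(lebesgue_measure_affine (b * (y : R) + e))//; last exact: measurable_ysection.
congr (leb _); apply/seteqP; split => x; rewrite /ysection/= !inE/=.
  by rewrite addrA.
by rewrite addrA.
Qed.

Definition affine_map (a b c d e f : R) (x : R2) : R2 :=
  (a * x.1 + b * x.2 + e, c * x.1 + d * x.2 + f).

(** Gaussian elimination with pivot [a]: each factor changes one coordinate only and is handled on
    sections. If [a = 0], the shear [(x, y - x)] comes first, so that [b] can serve as pivot. *)
Lemma scales_measure_affine (a b c d e f : R) : a * d - b * c != 0 ->
  scales_measure `|a * d - b * c|^-1 (affine_map a b c d e f).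
Proof.
move=> det0.
have [a0|a0] := eqVneq a 0; last first.
  rewrite (_ : affine_map _ _ _ _ _ _ =
    (fun x : R2 => (x.1, c / a * x.1 + (a * d - b * c) / a * x.2 + (f - c / a * e))) \o
    (fun x : R2 => (a * x.1 + b * x.2 + e, x.2))); last first.
    by apply/funext => -[x y]/=; congr pair; rewrite /=; field.
  rewrite (_ : `|_|^-1 = `|a|^-1 * `|(a * d - b * c) / a|^-1); last first.
    by rewrite -invfM -normrM mulrCA mulfV// mulr1.
  apply: scales_measure_comp; first exact: scales_measure_fst.
  by apply: scales_measure_snd; rewrite mulf_neq0// invr_eq0.
have b0 : b != 0 by apply: contra_neq det0 => ->; rewrite a0; ring.
have c0 : c != 0 by apply: contra_neq det0 => ->; rewrite a0; ring.
rewrite (_ : affine_map _ _ _ _ _ _ =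
   (fun x : R2 => (x.1, (c + d) / b * x.1 + (- c) * x.2 + (f - (c + d) / b * e))) \o
   (fun x : R2 => (b * x.1 + b * x.2 + e, x.2)) \o
   (fun x : R2 => (x.1, (-1) * x.1 + 1 * x.2 + 0))) ; last first.
  by apply/funext => -[x y]/=; rewrite /affine_map a0/=; congr pair; [ring|field].
rewrite (_ : `|_|^-1 = `|1|^-1 * (`|b|^-1 * `|-c|^-1)); last first.
  by rewrite a0 normr1 invr1 mul1r -invfM -normrM; congr (`| _ |^-1); ring.
apply: scales_measure_comp; first by apply: scales_measure_snd; exact: oner_neq0.
apply: scales_measure_comp; first exact: scales_measure_fst.
by apply: scales_measure_snd; rewrite oppr_eq0.
Qed.

Lemma ge0_integral_scales (k : R) (T : R2 -> R2) (g : R2 -> R) :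
  0 <= k -> scales_measure k T -> measurable_fun setT g -> (forall x, 0 <= g x) ->
  (\int[mu]_x (g (T x))%:E = k%:E * \int[mu]_x (g x)%:E)%E.
Proof.
move=> k0 [mT hT] mg g0.
have := @ge0_integral_pushforward _ _ R2 R2 R T mT mu setT (fun x => (g x)%:E).
rewrite preimage_setT => <-//; last 2 first.
- exact/measurable_EFinP.
- by move=> x _; rewrite lee_fin.
have := @ge0_integral_mscale _ R2 R mu setT measurableT (NngNum k0) (fun x => (g x)%:E).
move=> <-/=; last 2 first.
- exact/measurable_EFinP.
- by move=> x _; rewrite lee_fin.
by apply: eq_measure_integral => A mA _; exact: hT.
Qed.

End affine_change_of_variables.

(** * Neighbourhoods, convexity and measurability of sets of the plane *)

Section plane_sets.
Context {R : realType}.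
Local Notation mu := (@plane_measure R).
Local Notation R1 := (measurableTypeR R).
Local Notation R2 := (measurableTypeR R * measurableTypeR R)%type.
Implicit Types (A S : set (R * R)) (x y z v p : R * R).

Definition dot p x : R := p.1 * x.1 + p.2 * x.2.
Definition mv x (t : R) v : R * R := (x.1 + t * v.1, x.2 + t * v.2).
Definition cb (t : R) x y : R * R :=
  ((1 - t) * x.1 + t * y.1, (1 - t) * x.2 + t * y.2).
Definition vs x y : R * R := (x.1 - y.1, x.2 - y.2).
Definition near_pt x (r : R) y : Prop := `|y.1 - x.1| < r /\ `|y.2 - x.2| < r.

Definition cset A := forall x y (t : R), A x -> A y -> 0 <= t <= 1 -> A (cb t x y).
Definition cvx A (f : R * R -> R) := forall x y (t : R), A x -> A y -> 0 <= t <= 1 ->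
  f (cb t x y) <= (1 - t) * f x + t * f y.

Lemma near_pt_nbhs x (r : R) : 0 < r -> nbhs x (near_pt x r).
Proof.
move=> r0; apply/nbhs_ballP; exists r => //= y [] /=.
by rewrite /ball/= /near_pt (distrC x.1) (distrC x.2); split.
Qed.

Lemma nbhs_near_pt x (B : set (R * R)) : nbhs x B ->
  exists2 r : R, 0 < r & forall y, near_pt x r y -> B y.
Proof.
move=> /nbhs_ballP[r /= r0 h]; exists r => // y [h1 h2]; apply: h.
by split; rewrite /ball/= distrC.
Qed.

Lemma openP A : open A <->
  (forall x, A x -> exists2 r : R, 0 < r & forall y, near_pt x r y -> A y).
Proof.
split => [oA x Ax|h].
  by apply: nbhs_near_pt; exact: open_nbhs_nbhs.
rewrite openE => x /h[r r0 hr]; apply: filterS (near_pt_nbhs x r0) => y; exact: hr.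
Qed.

Lemma closureP A x : closure A x <->
  (forall r : R, 0 < r -> exists2 y, A y & near_pt x r y).
Proof.
split => [cA r r0|h B].
  by have [y [Ay By]] := cA _ (near_pt_nbhs x r0); exists y.
by move=> /nbhs_near_pt[r r0 hr]; have [y Ay hy] := h _ r0; exists y; split => //; exact: hr.
Qed.

Lemma near_pt_open x (r : R) : open (near_pt x r).
Proof.
apply/openP => y [h1 h2]; exists (Num.min (r - `|y.1 - x.1|) (r - `|y.2 - x.2|)).
  by rewrite lt_min !subr_gt0 h1.
move=> z [] /=; rewrite !lt_min => /andP[k1 k2] /andP[k3 k4]; split.
  by have := ler_distD y.1 z.1 x.1; lra.
by have := ler_distD y.2 z.2 x.2; lra.
Qed.

Definition box (a b c d : R) : set (R * R) :=
  [set x | [/\ a < x.1, x.1 < b, c < x.2 & x.2 < d]].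

Lemma boxE (a b c d : R) : box a b c d = (`]a, b[%classic `*` `]c, d[%classic).
Proof.
apply/seteqP; split => x /=; rewrite !in_itv/=.
  by move=> [-> -> -> ->].
by move=> [/andP[? ?] /andP[? ?]]; split.
Qed.

Lemma box_measurable (a b c d : R) : measurable (box a b c d : set R2).
Proof. by rewrite boxE; apply: measurableX; exact: measurable_itv. Qed.

Lemma box_measure (a b c d : R) : a <= b -> c <= d ->
  mu (box a b c d : set R2) = ((b - a) * (d - c))%:E.
Proof.
move=> ab cd; rewrite boxE.
apply: (etrans (@product_measure1E _ _ R1 R1 R lebesgue_measure lebesgue_measure
  `]a, b[%classic `]c, d[%classic (measurable_itv _) (measurable_itv _))).
rewrite [X in (X * _)%E](lebesgue_measure_itv `]a, b[).
rewrite [X in (_ * X)%E](lebesgue_measure_itv `]c, d[) /= !lte_fin.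
move: ab cd; rewrite !le_eqVlt => /predU1P[->|ab].
  by rewrite ltxx subrr mul0e mul0r.
move=> /predU1P[->|cd].
  by rewrite ltxx subrr mule0 mulr0.
by rewrite ab cd -!EFinB -EFinM.
Qed.

Lemma near_pt_box x (r : R) :
  near_pt x r = box (x.1 - r) (x.1 + r) (x.2 - r) (x.2 + r).
Proof.
apply/seteqP; split => y; rewrite /near_pt /box /= !ltr_distl.
  by move=> [/andP[? ?] /andP[? ?]]; split.
by move=> [? ? ? ?]; split; apply/andP; split.
Qed.

(** An open set is the union of the boxes with rational sides that it contains; [B] replaces the
    other boxes by the empty set so that the union runs over all quadruples of rationals. *)
Lemma open_plane_measurable A : open A -> measurable (A : set R2).
Proof.
move=> /openP oA.
pose B q1 q2 q3 q4 : set R2 :=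
  let b := box (ratr q1) (ratr q2) (ratr q3) (ratr q4) in
  if `[< b `<=` A >] then b else set0.
rewrite (_ : (A : set R2) = \bigcup_q1 \bigcup_q2 \bigcup_q3 \bigcup_q4 B q1 q2 q3 q4).
  do 4!(apply: bigcupT_measurable_rat => ?).
  by rewrite /B; case: asboolP => _ //; exact: box_measurable.
apply/seteqP; split => x.
  move=> /oA[r r0 hr].
  have /rat_in_itvoo[q1] : x.1 - r < x.1 by lra.
  have /rat_in_itvoo[q2] : x.1 < x.1 + r by lra.
  have /rat_in_itvoo[q3] : x.2 - r < x.2 by lra.
  have /rat_in_itvoo[q4] : x.2 < x.2 + r by lra.
  rewrite !in_itv/= => /andP[h7 h8] /andP[h5 h6] /andP[h3 h4] /andP[h1 h2].
  exists q1 => //; exists q2 => //; exists q3 => //; exists q4 => //.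
  rewrite /B asboolT; first by split.
  move=> y [k1 k2 k3 k4]; apply: hr; rewrite near_pt_box; split.
  - exact: lt_trans k1.
  - exact: lt_trans h4.
  - exact: lt_trans k3.
  - exact: lt_trans h8.
move=> [q1 _ [q2 _ [q3 _ [q4 _]]]]; rewrite /B; case: asboolP => // h; exact: h.
Qed.

Lemma open_measure_gt0 A : open A -> A !=set0 -> (0 < mu (A : set R2))%E.
Proof.
move=> oA [x Ax].
have [r r0 hr] := (openP A).1 oA _ Ax.
have : (0 < mu (near_pt x r : set R2))%E.
  by rewrite near_pt_box box_measure ?lte_fin; first nra; lra.
move/lt_le_trans; apply; apply: le_measure; rewrite ?inE//.
  by rewrite near_pt_box; exact: box_measurable.
exact: open_plane_measurable.
Qed.

Lemma bounded_setP A : bounded_set A ->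
  exists2 M : R, 0 < M & forall x, A x -> `|x.1| <= M /\ `|x.2| <= M.
Proof.
move=> /pinfty_ex_gt0[M M0 hM]; exists M => // x Ax.
have h : `|x| <= M by exact: hM.
by move: h; rewrite ProdNormedZmodule.prod_normE ge_max => /andP.
Qed.
End plane_sets.

(** * Integrals of bounded measurable functions *)

Section bounded_integrals.
Context {R : realType}.
Local Notation mu := (@plane_measure R).
Local Notation R2 := (measurableTypeR R * measurableTypeR R)%type.
Implicit Types (D A : set (R * R)) (g h : R * R -> R) (P Q : R * R -> Prop).

(** Negligibility, rather than null measure, spares any measurability requirement on [P]. *)
Definition ae_in D P := mu.-negligible ([set x | D x /\ ~ P x] : set R2).

Lemma ae_inT D P : (forall x, D x -> P x) -> ae_in D P.
Proof.
move=> h; apply: negligibleS (negligible_set0 _) => x [Dx]; apply; exact: h.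
Qed.

Lemma ae_inS D P Q : ae_in D P -> (forall x, D x -> P x -> Q x) -> ae_in D Q.
Proof.
move=> h k; apply: negligibleS h => x [Dx nQ]; split => // Px; apply: nQ; exact: k.
Qed.

Lemma ae_in2 D P Q S : ae_in D P -> ae_in D Q ->
  (forall x, D x -> P x -> Q x -> S x) -> ae_in D S.
Proof.
move=> hP hQ k; apply: negligibleS (negligibleU hP hQ) => x [Dx nS].
have [Px|nP] := pselect (P x); last by left.
by right; split => // Qx; apply: nS; exact: k.
Qed.

Lemma ae_in3 D P Q P' S : ae_in D P -> ae_in D Q -> ae_in D P' ->
  (forall x, D x -> P x -> Q x -> P' x -> S x) -> ae_in D S.
Proof.
move=> hP hQ hP' k.
apply: (@ae_in2 _ (fun x => P x /\ Q x) P') => //; last first.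
  by move=> x Dx [Px Qx]; exact: k.
exact: (ae_in2 hP hQ).
Qed.

(** Nonempty open sets have positive measure. Together with continuity, this turns almost-everywhere
    statements into statements at every point. *)
Lemma ae_in_dense D P : open D -> ae_in D P ->
  forall x r, closure D x -> 0 < r -> exists y, [/\ D y, P y & near_pt x r y].
Proof.
move=> oD aP x r cx r0; apply: contrapT => hn.
pose U := [set y | D y /\ near_pt x r y].
have oU : open U.
  by apply: openI => //; exact: near_pt_open.
have [y Dy xy] := (closureP D x).1 cx _ r0.
have := open_measure_gt0 oU (ex_intro U y (conj Dy xy)).
rewrite measure_negligible ?ltxx//; first exact: open_plane_measurable.
apply: negligibleS aP => z [Dz xz]; split => // Pz; apply: hn.
by exists z; split.
Qed.

(** On a domain of finite measure this class consists of integrable functions and is stable under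
    sums, products and maxima; all integrals of the variational arguments stay in it. *)
Definition bm D g := measurable_fun (D : set R2) (g : R2 -> R) /\
  exists M, forall x, D x -> `|g x| <= M.

Definition II D g : R := (\int[mu]_(x in (D : set R2)) (g : R2 -> R) x)%R.

Section on_a_set.
Variable D : set (R * R).
Hypothesis mD : measurable (D : set R2).
Hypothesis fD : (mu (D : set R2) < +oo)%E.

Lemma bm_integrable g : bm D g -> mu.-integrable (D : set R2) (EFin \o (g : R2 -> R)).
Proof.
move=> [mg [M hM]]; apply: measurable_bounded_integrable => //.
exists M; split; first exact: num_real.
by move=> N MN x Dx; apply: le_trans (ltW MN); exact: hM.
Qed.

Lemma bm_cst c : bm D (fun=> c).
Proof. by split => //; exists `|c|. Qed.

Lemma bm_norm g : bm D g -> bm D (fun x => `|g x|).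
Proof.
move=> [mg [M hM]]; split; first exact: measurableT_comp.
by exists M => x Dx; rewrite normr_id; exact: hM.
Qed.

Lemma bmD g h : bm D g -> bm D h -> bm D (fun x => g x + h x).
Proof.
move=> [mg [M hM]] [mh [N hN]]; split; first exact: measurable_funD.
by exists (M + N) => x Dx; apply: le_trans (ler_normD _ _) _; apply: lerD; [exact: hM|exact: hN].
Qed.

Lemma bmM g h : bm D g -> bm D h -> bm D (fun x => g x * h x).
Proof.
move=> [mg [M hM]] [mh [N hN]]; split; first exact: measurable_funM.
by exists (M * N) => x Dx; rewrite normrM; apply: ler_pM => //; [exact: hM|exact: hN].
Qed.

Lemma bmZ c g : bm D g -> bm D (fun x => c * g x).
Proof. by move=> h; apply: bmM => //; exact: bm_cst. Qed.

Lemma bmN g : bm D g -> bm D (fun x => - g x).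
Proof.
move=> h; have := bmZ (-1) h.
by rewrite (_ : (fun x => -1 * g x) = (fun x => - g x))//; apply/funext => x; rewrite mulN1r.
Qed.

Lemma bmB g h : bm D g -> bm D h -> bm D (fun x => g x - h x).
Proof. by move=> hg hh; apply: bmD => //; exact: bmN. Qed.

Lemma bm_indic A : measurable (A : set R2) -> bm D (fun x => \1_(A : set R2) x).
Proof.
move=> mA; split; first exact: measurable_indic.
by exists 1 => x _; rewrite indicE; case: (_ \in _); rewrite ?normr1 ?normr0.
Qed.

Lemma IID g h : bm D g -> bm D h -> II D (fun x => g x + h x) = II D g + II D h.
Proof. by move=> hg hh; apply: RintegralD => //; exact: bm_integrable. Qed.

Lemma IIB g h : bm D g -> bm D h -> II D (fun x => g x - h x) = II D g - II D h.
Proof. by move=> hg hh; apply: RintegralB => //; exact: bm_integrable. Qed.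

Lemma IIZ c g : bm D g -> II D (fun x => c * g x) = c * II D g.
Proof. by move=> hg; apply: RintegralZl => //; exact: bm_integrable. Qed.

Lemma II_eq_ae g h : bm D g -> bm D h -> ae_in D (fun x => g x = h x) -> II D g = II D h.
Proof.
move=> bg bh gh; congr fine; apply: ae_eq_integral => //.
- by apply/measurable_EFinP; case: bg.
- by apply/measurable_EFinP; case: bh.
by apply: negligibleS gh => x /= /not_implyP[Dx ne]; split => // e; apply: ne; rewrite e.
Qed.

Lemma bm_max g h : bm D g -> bm D h -> bm D (fun x => Num.max (g x) (h x)).
Proof.
move=> [mg [M hM]] [mh [N hN]]; split; first exact: measurable_maxr.
by exists (Num.max M N) => x Dx; rewrite maxEle le_max;
  case: ifP => _; rewrite ?(hM _ Dx) ?(hN _ Dx) ?orbT.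
Qed.

(** Almost everywhere [h] equals the maximum of [g] and [h], which dominates [g] everywhere. *)
Lemma II_le_ae g h : bm D g -> bm D h -> ae_in D (fun x => g x <= h x) -> II D g <= II D h.
Proof.
move=> bg bh gh; have bgh := bm_max bg bh.
have -> : II D h = II D (fun x => Num.max (g x) (h x)).
  by apply: II_eq_ae => //; apply: (ae_inS gh) => x _ /max_idPr.
by apply: le_Rintegral => //; [exact: bm_integrable..|move=> x _; rewrite le_max lexx].
Qed.

Lemma II_cst c : II D (fun=> c) = c * fine (mu (D : set R2)).
Proof. exact: Rintegral_cst. Qed.

Lemma II_indic A : measurable (A : set R2) ->
  II D (fun x => \1_(A : set R2) x) = fine (mu ((D `&` A) : set R2)).
Proof.
by move=> mA; congr fine; rewrite integral_indic// setIC.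
Qed.

Lemma II_eq0 g : bm D g -> (forall x, D x -> 0 <= g x) -> II D g <= 0 ->
  ae_in D (fun x => g x = 0).
Proof.
move=> bg g0 h.
have ig := bm_integrable bg.
have h0 : (\int[mu]_(x in (D : set R2)) `|(g x)%:E|)%E = 0%E.
  transitivity (\int[mu]_(x in (D : set R2)) (g x)%:E)%E.
    by apply: eq_integral => x; rewrite inE => Dx; rewrite gee0_abs// lee_fin; exact: g0.
  apply/eqP; rewrite eq_le integral_ge0 ?andbT; last first.
    by move=> x Dx; rewrite lee_fin; exact: g0.
  by rewrite -(fineK (integrable_fin_num mD ig)) lee_fin.
have /ae_eq_integral_abs : measurable_fun (D : set R2) (EFin \o (g : R2 -> R)).
  by apply/measurable_EFinP; case: bg.
move=> /(_ mu mD)[+ _] => /(_ h0) hae.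
apply: negligibleS hae => x [Dx ne] /= /(_ Dx) [] e; exact: ne.
Qed.

Lemma II_dct (g_ : nat -> R * R -> R) g M : (forall n, measurable_fun (D : set R2) (g_ n : R2 -> R)) ->
  (forall n x, D x -> `|g_ n x| <= M) -> bm D g ->
  ae_in D (fun x => g_ n x @[n --> \oo] --> g x) ->
  II D (g_ n) @[n --> \oo] --> II D g.
Proof.
move=> mg gM bg gg.
have [] := @dominated_convergence _ R2 R mu D mD (fun n x => (g_ n x)%:E)
  (fun x => (g x)%:E) (fun=> M%:E).
- by move=> n; apply/measurable_EFinP.
- by apply/measurable_EFinP; case: bg.
- apply: negligibleS gg => x /= /not_implyP[Dx ne]; split => // e; apply: ne.
  by apply: cvg_EFin => //; exact: nearW.
- by have := bm_integrable (bm_cst M).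
- by apply/aeW => x n Dx; rewrite /= lee_fin; exact: gM.
move=> _ _ h; apply: fine_cvg.
rewrite fineK; first exact: h.
by apply: integrable_fin_num => //; exact: bm_integrable.
Qed.

End on_a_set.
End bounded_integrals.

(** * Convex functions of two variables *)

Section convex_functions.
Context {R : realType}.
Implicit Types (A : set (R * R)) (f g : R * R -> R) (x y e v p : R * R).

Definition norm1 x : R := `|x.1| + `|x.2|.

(** Control along the two axes suffices. A point near [x] is the midpoint of two points of the axes
    through [x], which gives the upper bound; [x] is the midpoint of [y] and its reflection, which
    turns the upper bound at the reflection into the lower bound at [y]. *)
Lemma cvx_cross A f x p (e r : R) : cvx A f -> (forall y, near_pt x r y -> A y) ->
  (forall s, `|s| < r -> f (x.1 + s, x.2) - f x - p.1 * s <= e * `|s|) ->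
  (forall s, `|s| < r -> f (x.1, x.2 + s) - f x - p.2 * s <= e * `|s|) ->
  forall y, near_pt x (r / 2) y ->
    `|f y - f x - dot p (vs y x)| <= e * norm1 (vs y x).
Proof.
move=> cf hA h1 h2.
have ub s t : `|s| < r / 2 -> `|t| < r / 2 ->
    f (x.1 + s, x.2 + t) - f x - (p.1 * s + p.2 * t) <= e * (`|s| + `|t|).
  move=> hs ht.
  have r0 : 0 < r by have := normr_ge0 s; lra.
  have n2 z : `|2 * z| = 2 * `|z| by rewrite normrM ger0_norm.
  have s2 : `|2 * s| < r by rewrite n2; lra.
  have t2 : `|2 * t| < r by rewrite n2; lra.
  have a1 : A (x.1 + 2 * s, x.2).
    by apply: hA; split => /=; [rewrite addrC addKr | rewrite subrr normr0].
  have a2 : A (x.1, x.2 + 2 * t).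
    by apply: hA; split => /=; [rewrite subrr normr0 | rewrite addrC addKr].
  have a3 : 0 <= (2^-1 : R) <= 1 by apply/andP; split; lra.
  have := cf _ _ _ a1 a2 a3.
  rewrite (_ : cb _ _ _ = (x.1 + s, x.2 + t)); last by rewrite /cb/=; congr pair; field.
  have := h1 _ s2; have := h2 _ t2; rewrite !n2; lra.
move=> y [hy1 hy2].
have := ub (y.1 - x.1) (y.2 - x.2) hy1 hy2.
rewrite !subrKC -surjective_pairing => u1.
have := ub (- (y.1 - x.1)) (- (y.2 - x.2)); rewrite !normrN => /(_ hy1 hy2) u2.
have r0 : 0 < r by have := normr_ge0 (y.1 - x.1); lra.
have a1 : A y by apply: hA; split; lra.
have a2 : A (x.1 - (y.1 - x.1), x.2 - (y.2 - x.2)).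
  have k (a b : R) : a - (b - a) - a = - (b - a) by ring.
  by apply: hA; split; rewrite /= k normrN; lra.
have a3 : 0 <= (2^-1 : R) <= 1 by apply/andP; split; lra.
have := cf _ _ _ a1 a2 a3.
rewrite (_ : cb _ _ _ = x); last by rewrite [RHS]surjective_pairing /cb/=; congr pair; field.
rewrite ler_norml /norm1 /dot /vs /= => H; apply/andP; split; lra.
Qed.

(** The signs of [s] and [t] are free, so this also bounds forward difference quotients from below
    by backward ones. *)
Lemma slope_mono A f x e (s t : R) : cvx A f -> A x -> A (mv x s e) -> A (mv x t e) ->
  s != 0 -> t != 0 -> s < t ->
  (f (mv x s e) - f x) / s <= (f (mv x t e) - f x) / t.
Proof.
move=> cf Ax As At s0 t0 st.
have cbE (a b k : R) : cb k (mv x a e) (mv x b e) = mv x ((1 - k) * a + k * b) e.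
  by rewrite /cb /mv /=; congr pair; ring.
have mv0 : mv x 0 e = x by rewrite [RHS]surjective_pairing /mv; congr pair; ring.
have key (a b k : R) : A (mv x a e) -> A (mv x b e) -> 0 <= k <= 1 ->
    f (mv x ((1 - k) * a + k * b) e) <= (1 - k) * f (mv x a e) + k * f (mv x b e).
  by move=> Aa Ab k01; rewrite -cbE; exact: cf.
have [sp|sn|/eqP] := ltgtP s 0; last by rewrite (negPf s0).
  have [tp|tn|/eqP] := ltgtP t 0; last by rewrite (negPf t0).
    have := key 0 s (t / s); rewrite mv0 => /(_ Ax As).
    have -> : (1 - t / s) * 0 + t / s * s = t by field.
    have ts : 0 <= t / s <= 1.
      by apply/andP; split; [rewrite ler_ndivlMr//; lra | rewrite ler_ndivrMr//; lra].
    move=> /(_ ts) H.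
    rewrite -subr_ge0 (_ : _ - _ = (((1 - t / s) * f x + t / s * f (mv x s e)) - f (mv x t e)) / (- t)); last first.
      by field; rewrite ?s0 ?t0.
    by apply: divr_ge0; lra.
  have := key s t (- s / (t - s)) As At.
  have ts0 : t - s != 0 by lra.
  have -> : (1 - - s / (t - s)) * s + - s / (t - s) * t = 0 by field.
  have ts : 0 <= - s / (t - s) <= 1.
    by apply/andP; split; [apply: divr_ge0; lra | rewrite ler_pdivrMr; lra].
  rewrite mv0 => /(_ ts) H.
  rewrite -subr_ge0 (_ : _ - _ = ((1 - - s / (t - s)) * f (mv x s e) + - s / (t - s) * f (mv x t e) - f x) * ((t - s) / (t * - s))); last first.
    by field; rewrite ?s0 ?t0 ?ts0.
  apply: mulr_ge0; first lra.
  by apply: divr_ge0; [lra|apply: mulr_ge0; lra].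
have tp : 0 < t by lra.
have := key 0 t (s / t); rewrite mv0 => /(_ Ax At).
have -> : (1 - s / t) * 0 + s / t * t = s by field.
have ts : 0 <= s / t <= 1.
  by apply/andP; split; [apply: divr_ge0; lra | rewrite ler_pdivrMr; lra].
move=> /(_ ts) H.
rewrite -subr_ge0 (_ : _ - _ = (((1 - s / t) * f x + s / t * f (mv x t e)) - f (mv x s e)) / s); last first.
  by field; rewrite ?s0 ?t0.
by apply: divr_ge0; lra.
Qed.

End convex_functions.

Section convex_derivatives.
Context {R : realType}.
Local Notation R2 := (measurableTypeR R * measurableTypeR R)%type.
Implicit Types (A : set (R * R)) (f g : R * R -> R) (x y e v p : R * R).

Definition opv e : R * R := (- e.1, - e.2).

Lemma mv_opv x (t : R) e : mv x t (opv e) = mv x (- t) e.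
Proof. by rewrite /mv /=; congr pair; ring. Qed.

Lemma mv0 x e : mv x 0 e = x.
Proof. by rewrite [RHS]surjective_pairing /mv; congr pair; ring. Qed.

Lemma mv_mv x (s t : R) e : mv (mv x s e) t e = mv x (s + t) e.
Proof. by rewrite /mv /=; congr pair; ring. Qed.

Lemma open_mv A x e : open A -> A x ->
  exists2 r : R, 0 < r & forall s, `|s| <= r -> A (mv x s e).
Proof.
move=> oA Ax; have [r r0 hr] := (openP A).1 oA _ Ax.
have n1 := normr_ge0 e.1; have n2 := normr_ge0 e.2.
have n0 : 0 < norm1 e + 1 by rewrite /norm1; lra.
exists (r / 2 / (norm1 e + 1)); first by rewrite !divr_gt0.
move=> s hs; apply: hr.
have h1 : `|s| * (norm1 e + 1) <= r / 2 by rewrite -ler_pdivlMr.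
have := normr_ge0 s; rewrite /norm1 in h1 => s0.
by split; rewrite /mv /= addrC addKr normrM; nra.
Qed.

(** Difference quotients of a convex function increase with [t], so this infimum is the one-sided
    derivative along [e]. It exists at every point of an open set, which makes it a convenient
    gradient before differentiability is known. *)
Definition right_slope A f e x : R :=
  inf [set k | exists2 t, 0 < t /\ A (mv x t e) & k = (f (mv x t e) - f x) / t].

Section one_point.
Variables (A : set (R * R)) (f : R * R -> R).
Hypotheses (oA : open A) (cf : cvx A f).

Lemma right_slope_le e x t : A x -> 0 < t -> A (mv x t e) ->
  right_slope A f e x <= (f (mv x t e) - f x) / t.
Proof.
move=> Ax t0 At; apply: ge_inf; last by exists t.
have [r r0 hr] := open_mv e oA Ax.
exists ((f (mv x (- r) e) - f x) / (- r)) => _ [s [s0 As] ->].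
apply: (slope_mono cf) => //; try lra.
by apply: hr; rewrite normrN gtr0_norm.
Qed.

Lemma right_slope_near e x (k : R) : A x -> 0 < k ->
  exists2 t0 : R, 0 < t0 & forall t, 0 < t <= t0 -> A (mv x t e) /\
    (f (mv x t e) - f x) / t <= right_slope A f e x + k.
Proof.
move=> Ax k0.
have [r r0 hr] := open_mv e oA Ax.
have hi : has_inf [set k | exists2 t, 0 < t /\ A (mv x t e) & k = (f (mv x t e) - f x) / t].
  split.
    exists ((f (mv x r e) - f x) / r), r => //; split => //.
    by apply: hr; rewrite gtr0_norm.
  exists ((f (mv x (- r) e) - f x) / (- r)) => _ [s [s0 As] ->].
  apply: (slope_mono cf) => //; try lra.
  by apply: hr; rewrite normrN gtr0_norm.
have [_ [s [s0 As] ->] hs] := inf_adherent k0 hi.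
exists (Num.min r s); first by rewrite lt_min r0.
move=> t /andP[t0]; rewrite le_min => /andP[tr ts].
have At : A (mv x t e) by apply: hr; rewrite gtr0_norm.
split => //; apply: le_trans (ltW hs).
move: ts; rewrite le_eqVlt => /predU1P[->//|ts].
by apply: (slope_mono cf) => //; lra.
Qed.

Lemma right_slope_opp e x : A x -> - right_slope A f (opv e) x <= right_slope A f e x.
Proof.
move=> Ax; apply/ler_addgt0Pr => k k0.
have k2 : 0 < k / 2 by rewrite divr_gt0.
have [t t0 /(_ t)] := right_slope_near e Ax k2.
rewrite t0 lexx => /(_ isT)[At ht].
have [r r0 /(_ r)] := right_slope_near (opv e) Ax k2.
rewrite r0 lexx => /(_ isT)[]; rewrite mv_opv => Ar h.
have r1 : - r != 0 by rewrite oppr_eq0 gt_eqF.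
have t1 : t != 0 by rewrite gt_eqF.
have rt : - r < t by lra.
have := slope_mono cf Ax Ar At r1 t1 rt.
by rewrite invrN mulrN; lra.
Qed.

(* Distinct points of a line are separated by the rationals lying strictly
   between the left and right slopes. *)
Lemma right_slope_lt e x (h : R) : A x -> A (mv x h e) -> 0 < h ->
  right_slope A f e x <= - right_slope A f (opv e) (mv x h e).
Proof.
move=> Ax Ah h0; have h1 := right_slope_le Ax h0 Ah.
have Ax' : A (mv (mv x h e) h (opv e)) by rewrite mv_opv mv_mv subrr mv0.
have := right_slope_le Ah h0 Ax'.
rewrite mv_opv mv_mv subrr mv0 => h2.
by move: h1; rewrite -opprB mulNr; lra.
Qed.

Lemma right_slope_cvg e x : A x ->
  n.+1%:R * (f (mv x n.+1%:R^-1 e) - f x) @[n --> \oo] --> right_slope A f e x.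
Proof.
move=> Ax; apply/cvgrPdist_le => k k0.
have [t t0 ht] := right_slope_near e Ax k0.
near=> n.
have n0 : 0 < n.+1%:R^-1 :> R by rewrite invr_gt0.
have nt : n.+1%:R^-1 <= t.
  by apply: ltW; near: n; exact: (near_infty_natSinv_lt (PosNum t0)).
have [|At h] := ht n.+1%:R^-1; first by rewrite n0.
have h1 := right_slope_le Ax n0 At.
move: h h1; rewrite invrK mulrC => h h1; rewrite ler_norml; apply/andP; split; lra.
Unshelve. all: by end_near.
Qed.

Lemma measurable_mv (t : R) v : measurable_fun [set: R2] ((fun x => mv x t v) : R2 -> R2).
Proof. by apply: measurable_fun_pair; apply: measurable_funD. Qed.

Lemma measurable_right_slope e : measurable_fun [set: R2] (f : R2 -> R) ->
  measurable_fun (A : set R2) (right_slope A f e : R2 -> R).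
Proof.
move=> mf; apply: (@measurable_fun_cvg _ R2 R _
  (fun n (x : R2) => n.+1%:R * (f (mv x n.+1%:R^-1 e) - f x))); last first.
  by move=> x Ax; exact: right_slope_cvg.
move=> n; apply: measurable_funTS; apply: measurable_funM => //.
apply: measurable_funB => //; apply: measurableT_comp => //.
exact: measurable_mv.
Qed.

End one_point.
End convex_derivatives.

Section differentiability.
Context {R : realType}.
Local Notation mu := (@plane_measure R).
Local Notation leb := (@lebesgue_measure R).
Local Notation R2 := (measurableTypeR R * measurableTypeR R)%type.
Implicit Types (A B : set (R * R)) (f g : R * R -> R) (x y e v p : R * R).

Definition dif f x p := forall e : R, 0 < e ->
  exists2 r : R, 0 < r & forall y, near_pt x r y ->
    `|f y - f x - dot p (vs y x)| <= e * norm1 (vs y x).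

Lemma leb_subsingleton (C : set R) : (forall a b, C a -> C b -> a < b -> False) ->
  leb C = 0%E.
Proof.
move=> h; have [->|/set0P[a Ca]] := eqVneq C set0; first exact: measure0.
rewrite (_ : C = [set a]) ?lebesgue_measure_set1//.
apply/seteqP; split => [b Cb /=|b ->//].
by case: (ltgtP a b) => // ab; exfalso; [exact: h ab|exact: h ab].
Qed.

(** Every horizontal line meets [B] in at most one point, so all sections are null. *)
Lemma null_lines1 B : measurable (B : set R2) ->
  (forall x (h : R), B x -> B (mv x h (1, 0)) -> 0 < h -> False) -> mu (B : set R2) = 0%E.
Proof.
move=> mB h; rewrite plane_measure_ysection//; apply: integral0_eq => y _.
apply: leb_subsingleton => a b; rewrite /ysection /= !inE => Ba Bb ab.
apply: (h (a, y) (b - a)) => //; last by rewrite subr_gt0.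
by rewrite /mv /= mulr1 mulr0 addr0 subrKC.
Qed.

Lemma null_lines2 B : measurable (B : set R2) ->
  (forall x (h : R), B x -> B (mv x h (0, 1)) -> 0 < h -> False) -> mu (B : set R2) = 0%E.
Proof.
move=> mB h; rewrite plane_measure_xsection; apply: integral0_eq => y _.
apply: leb_subsingleton => a b; rewrite /xsection /= !inE => Ba Bb ab.
apply: (h (y, a) (b - a)) => //; last by rewrite subr_gt0.
by rewrite /mv /= mulr1 mulr0 addr0 subrKC.
Qed.

Lemma negligible_countable (T : countType) (N : T -> set (R * R)) :
  (forall q, mu.-negligible (N q : set R2)) ->
  mu.-negligible ([set x | exists q, N q x] : set R2).
Proof.
move=> hN; pose F n : set R2 := if unpickle n is Some q then N q else set0.
have FN n : mu.-negligible (F n).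
  by rewrite /F; case: unpickle => [q|]; [exact: hN|exact: negligible_set0].
apply: negligibleS (negligible_bigcup FN) => x [q Nq].
by exists (pickle q); rewrite // /F pickleK.
Qed.

Definition gr A f x : R * R := (right_slope A f (1, 0) x, right_slope A f (0, 1) x).
Arguments gr : simpl never.

Section ae.
Variables (A : set (R * R)) (f : R * R -> R).
Hypotheses (oA : open A) (cf : cvx A f).

(** A point where the left slope is smaller than the right one lies in [N q] for some rational [q]
    between the two. By [right_slope_lt], a line of direction [e] meets each [N q] at most once. *)
Lemma ae_slopes e : measurable_fun [set: R2] (f : R2 -> R) ->
  (forall B, measurable (B : set R2) ->
    (forall x h, B x -> B (mv x h e) -> 0 < h -> False) -> mu (B : set R2) = 0%E) ->
  ae_in A (fun x => right_slope A f e x + right_slope A f (opv e) x <= 0).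
Proof.
move=> mf hB.
pose N (q : rat) := [set x | A x /\ - right_slope A f (opv e) x < ratr q < right_slope A f e x].
have FN q : mu.-negligible (N q : set R2).
  have mN : measurable (N q : set R2).
    rewrite (_ : N q = (A `&` (right_slope A f e : R2 -> R) @^-1` `]ratr q, +oo[%classic) `&`
        (A `&` (right_slope A f (opv e) : R2 -> R) @^-1` `](- ratr q), +oo[%classic)); last first.
      apply/seteqP; split => x /=; rewrite !in_itv/= !andbT.
        by move=> [Ax /andP[h1 h2]]; split; split => //; lra.
      by move=> [[Ax h1] [_ h2]]; split => //; apply/andP; split => //; lra.
    have mA := open_plane_measurable oA.
    apply: measurableI; apply: measurable_right_slope => //; exact: measurable_itv.
  apply/negligibleP => //; apply: hB => // x h [Ax /andP[h1 h2]] [Ah /andP[h3 h4]] h0.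
  have := right_slope_lt oA cf Ax Ah h0; lra.
apply: negligibleS (negligible_countable FN) => x [Ax /negP]; rewrite -ltNge => h.
have /rat_in_itvoo[q] : - right_slope A f (opv e) x < right_slope A f e x by lra.
by rewrite in_itv/= => hq; exists q.
Qed.

(** For a convex function, derivatives along the two axes give differentiability, by [cvx_cross]. *)
Lemma dif_of_slopes x : A x ->
  right_slope A f (1, 0) x + right_slope A f (opv (1, 0)) x <= 0 ->
  right_slope A f (0, 1) x + right_slope A f (opv (0, 1)) x <= 0 ->
  dif f x (gr A f x).
Proof.
move=> Ax h1 h2 k k0.
have one e : right_slope A f e x + right_slope A f (opv e) x <= 0 ->
    exists2 r : R, 0 < r & forall s, `|s| < r ->
      f (mv x s e) - f x - right_slope A f e x * s <= k * `|s|.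
  move=> he; have [t t0 ht] := right_slope_near oA cf e Ax k0.
  have [t' t'0 ht'] := right_slope_near oA cf (opv e) Ax k0.
  exists (Num.min t t'); first by rewrite lt_min t0.
  move=> s; rewrite lt_min => /andP[st st'].
  have [s0|s0|->] := ltgtP s 0; last by rewrite mv0 subrr mulr0 subrr normr0 mulr0.
    have sn : 0 < - s by lra.
    rewrite ltr0_norm// in st st' *.
    have [|As] := ht' (- s); first by rewrite sn ltW.
    by rewrite mv_opv opprK ler_pdivrMr//; nra.
  rewrite gtr0_norm// in st st' *.
  have [|As] := ht s; first by rewrite s0 ltW.
  by rewrite ler_pdivrMr//; nra.
have [r1 r10 hr1] := one _ h1; have [r2 r20 hr2] := one _ h2.
have [r0 r00 hr0] := (openP A).1 oA _ Ax.
pose r := Num.min r0 (Num.min r1 r2).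
have rr : 0 < r by rewrite !lt_min r00 r10.
exists (r / 2); first by rewrite divr_gt0.
apply: (cvx_cross cf).
- by move=> y [y1 y2]; apply: hr0; split; [move: y1|move: y2]; rewrite lt_min => /andP[].
- move=> s; rewrite /r !lt_min => /and3P[_ s1 _].
  by have := hr1 _ s1; rewrite /mv /= mulr1 mulr0 addr0.
- move=> s; rewrite /r !lt_min => /and3P[_ _ s1].
  by have := hr2 _ s1; rewrite /mv /= mulr1 mulr0 addr0.
Qed.

Lemma ae_dif : measurable_fun [set: R2] (f : R2 -> R) ->
  ae_in A (fun x => dif f x (gr A f x)).
Proof.
move=> mf; apply: (ae_in2 (ae_slopes mf null_lines1) (ae_slopes mf null_lines2)).
by move=> x Ax h1 h2; exact: dif_of_slopes.
Qed.

(** [cvx_cross] with slope zero: along the axes [f] grows at most at the rate [C], the largest of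
    the four difference quotients at distance [r0 / 2]. *)
Lemma cvx_continuous x : A x -> forall k : R, 0 < k ->
  exists2 r : R, 0 < r & forall y, near_pt x r y -> A y /\ `|f y - f x| <= k.
Proof.
move=> Ax k k0.
have [r0 r00 hr0] := (openP A).1 oA _ Ax.
pose M e := (f (mv x (r0 / 2) e) - f x) / (r0 / 2).
pose C := Num.max (Num.max (M (1, 0)) (M (opv (1, 0)))) (Num.max (M (0, 1)) (M (opv (0, 1)))).
have Aball e s : `|e.1| <= 1 -> `|e.2| <= 1 -> `|s| <= r0 / 2 -> A (mv x s e).
  move=> e1 e2 hs; apply: hr0; have := normr_ge0 s => s0.
  by split; rewrite /mv /= addrC addKr normrM; have := normr_ge0 e.1; have := normr_ge0 e.2; nra.
have one e s : `|e.1| <= 1 -> `|e.2| <= 1 -> M e <= C -> M (opv e) <= C ->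
    `|s| < r0 / 2 -> f (mv x s e) - f x <= C * `|s|.
  move=> e1 e2 MC MC' hs.
  have r2 : 0 < r0 / 2 by rewrite divr_gt0.
  have Ar e' : `|e'.1| <= 1 -> `|e'.2| <= 1 -> A (mv x (r0 / 2) e').
    by move=> ? ?; apply: Aball => //; rewrite gtr0_norm.
  have [s0|s0|->] := ltgtP s 0; last by rewrite mv0 subrr normr0 mulr0.
    rewrite ltr0_norm// in hs *.
    have sn : 0 < - s by lra.
    have As : A (mv x (- s) (opv e)).
      by rewrite mv_opv opprK; apply: Aball => //; rewrite ltr0_norm// ltW.
    rewrite -ler_pdivrMr//; apply: le_trans MC'.
    rewrite /M -{1}(opprK s) -mv_opv; apply: (slope_mono cf) => //.
    - by apply: Ar; rewrite normrN.
    - by rewrite gt_eqF.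
    - by rewrite gt_eqF.
  rewrite gtr0_norm// in hs *.
  rewrite -ler_pdivrMr//; apply: le_trans MC.
  apply: (slope_mono cf) => //.
  - by apply: Aball => //; rewrite gtr0_norm// ltW.
  - exact: Ar.
  - by rewrite gt_eqF.
  - by rewrite gt_eqF.
have Cr : 0 <= `|C| by [].
have n10 : `|1 : R| = 1 by rewrite normr1.
have n00 : `|0 : R| <= 1 by rewrite normr0.
have h : forall y, near_pt x (r0 / 2 / 2) y ->
    `|f y - f x - dot (0, 0) (vs y x)| <= `|C| * norm1 (vs y x).
  apply: (cvx_cross cf).
  - by move=> y [y1 y2]; apply: hr0; split; lra.
  - move=> s hs; rewrite /= mul0r subr0.
    have := one (1, 0) s; rewrite /mv /= mulr1 mulr0 addr0 n10 lexx => /(_ isT n00).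
    rewrite /C !le_max !lexx/= ?orbT => /(_ isT isT hs) /le_trans; apply.
    by apply: ler_wpM2r => //; exact: ler_norm.
  - move=> s hs; rewrite /= mul0r subr0.
    have := one (0, 1) s; rewrite /mv /= mulr1 mulr0 addr0 n10 lexx => /(_ n00 isT).
    rewrite /C !le_max !lexx/= ?orbT => /(_ isT isT hs) /le_trans; apply.
    by apply: ler_wpM2r => //; exact: ler_norm.
pose d := Num.min (r0 / 2 / 2) (k / 2 / (`|C| + 1)).
have C1 : 0 < `|C| + 1 by lra.
exists d; first by rewrite lt_min !divr_gt0.
move=> y [y1 y2].
have [y3 y4] : `|y.1 - x.1| < r0 / 2 / 2 /\ `|y.1 - x.1| < k / 2 / (`|C| + 1).
  by move: y1; rewrite lt_min => /andP[].
have [y5 y6] : `|y.2 - x.2| < r0 / 2 / 2 /\ `|y.2 - x.2| < k / 2 / (`|C| + 1).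
  by move: y2; rewrite lt_min => /andP[].
split; first by apply: hr0; split; lra.
have := h y (conj y3 y5); rewrite /dot/= !mul0r addr0 subr0 => /le_trans; apply.
move: y4 y6; rewrite !ltr_pdivlMr// /norm1 /vs /=.
by have := normr_ge0 (y.1 - x.1); have := normr_ge0 (y.2 - x.2); nra.
Qed.

End ae.

Lemma dif_dir f x p v (t_ : nat -> R) : dif f x p -> (forall n, 0 < t_ n) ->
  t_ n @[n --> \oo] --> 0 ->
  (f (mv x (t_ n) v) - f x) / t_ n @[n --> \oo] --> dot p v.
Proof.
move=> df t0 tc; apply/cvgrPdist_le => k k0.
have nv : 0 < norm1 v + 1 by rewrite /norm1; have := normr_ge0 v.1; have := normr_ge0 v.2; lra.
have [r r0 hr] := df (k / (norm1 v + 1)) (divr_gt0 k0 nv).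
move/cvgrPdist_lt : tc => /(_ _ (divr_gt0 r0 nv)) tc.
apply: (filterS _ tc) => n /=; rewrite sub0r normrN gtr0_norm// => tn.
have tn' : t_ n * (norm1 v + 1) < r by rewrite -ltr_pdivlMr.
have := t0 n => tp.
have := hr (mv x (t_ n) v).
have n1 := normr_ge0 v.1; have n2 := normr_ge0 v.2.
rewrite /near_pt /norm1 /vs /dot /mv /= !(addrC _ (t_ n * _)) !addrK !normrM (gtr0_norm tp).
rewrite /norm1 in tn' *.
have H1 : t_ n * `|v.1| < r by nra.
have H2 : t_ n * `|v.2| < r by nra.
move=> /(_ (conj H1 H2)) H.
rewrite distrC -(ler_pM2r tp) -[X in _ * X <= _](gtr0_norm tp) -normrM mulrBl mulfVK ?gt_eqF//.
rewrite (_ : (_ + _) * t_ n = p.1 * (t_ n * v.1) + p.2 * (t_ n * v.2)); last by ring.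
apply: le_trans H _.
rewrite -mulrDr mulrCA [leRHS]mulrC ler_pM2l// -mulrA -[leRHS]mulr1 ler_pM2l//.
by rewrite mulrC ler_pdivrMr//; lra.
Qed.

Lemma le_lim_nat (a b : nat -> R) (k l : R) : a n @[n --> \oo] --> k ->
  b n @[n --> \oo] --> l -> (forall n, a n <= b n) -> k <= l.
Proof. by move=> ak bl ab; apply: (ler_cvg_to ak bl); exact: nearW. Qed.

Lemma cvg_harm (t : R) : t / n.+1%:R @[n --> \oo] --> 0.
Proof.
by rewrite -[X in _ --> X](mulr0 t); apply: cvgMl_tmp; exact: cvg_harmonic.
Qed.

Lemma dif_dir_harm f x p v (t : R) : 0 < t -> dif f x p ->
  (f (mv x (t / n.+1%:R) v) - f x) / (t / n.+1%:R) @[n --> \oo] --> dot p v.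
Proof.
by move=> t0 df; apply: dif_dir => // [n|]; [rewrite divr_gt0|exact: cvg_harm].
Qed.

(** Directional derivatives are compared in opposite directions. This identifies gradients of maxima
    and suprema at contact points. *)
Lemma dif_touch f g x p q (r : R) : dif f x p -> dif g x q -> 0 < r ->
  (forall y, near_pt x r y -> f y <= g y) -> f x = g x -> p = q.
Proof.
move=> df dg r0 fg e.
have h v : dot p v <= dot q v.
  have xx : near_pt x r x by split; rewrite subrr normr0.
  have [t t0 ht] := open_mv v (near_pt_open (x:=x) (r:=r)) xx.
  apply: (le_lim_nat (dif_dir_harm (v:=v) t0 df) (dif_dir_harm (v:=v) t0 dg)).
  move=> n; rewrite ler_pM2r ?invr_gt0 ?divr_gt0// e lerD2r; apply: fg; apply: ht.
  rewrite ger0_norm; last by rewrite divr_ge0// ltW.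
  by rewrite ler_pdivrMr// ler_peMr ?ler1n// ltW.
have := h (1, 0); have := h (-1, 0); have := h (0, 1); have := h (0, -1).
rewrite /dot /= => *; rewrite [LHS]surjective_pairing [RHS]surjective_pairing.
by congr pair; lra.
Qed.

Lemma dif_subgradient A f x p y : cvx A f -> A x -> A y -> dif f x p ->
  f x + dot p (vs y x) <= f y.
Proof.
move=> cf Ax Ay df; rewrite -lerBrDl.
apply: (le_lim_nat (dif_dir_harm (v:=vs y x) ltr01 df) (cvg_cst (f y - f x))).
move=> n; set t := 1 / _.
have t0 : 0 < t by rewrite divr_gt0.
have t1 : t <= 1 by rewrite ler_pdivrMr// mul1r ler1n.
rewrite ler_pdivrMr//.
have := cf x y t Ax Ay _; rewrite t1 ltW// => /(_ isT).
rewrite (_ : cb t x y = mv x t (vs y x)); last by rewrite /cb /mv /vs /=; congr pair; ring.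
nra.
Qed.

Lemma dif_derive f x p v : dif f x p -> 'D_v f x = dot p v.
Proof.
move=> df; apply: cvg_lim => //; apply/cvgrPdist_le => k k0.
have nv : 0 < norm1 v + 1 by rewrite /norm1; have := normr_ge0 v.1; have := normr_ge0 v.2; lra.
have [r r0 hr] := df (k / (norm1 v + 1)) (divr_gt0 k0 nv).
have rv : 0 < r / (norm1 v + 1) by rewrite divr_gt0.
near=> h.
have h0 : h != 0 by near: h; exact: nbhs_dnbhs_neq.
have hn : `|h| < r / (norm1 v + 1).
  by near: h; apply: dnbhs0_lt.
have hp : 0 < `|h| by rewrite normr_gt0.
have tn' : `|h| * (norm1 v + 1) < r by rewrite -ltr_pdivlMr.
have n1 := normr_ge0 v.1; have n2 := normr_ge0 v.2.
have := hr (mv x h v).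
rewrite /near_pt /norm1 /vs /dot /mv /= !(addrC _ (h * _)) !addrK !normrM.
rewrite /norm1 in tn' *.
have H1 : `|h| * `|v.1| < r by nra.
have H2 : `|h| * `|v.2| < r by nra.
move=> /(_ (conj H1 H2)) H.
rewrite distrC -(ler_pM2r hp) -normrM.
rewrite [X in `|X|](_ : _ = f (h * v.1 + x.1, h * v.2 + x.2) - f x -
   (p.1 * (h * v.1) + p.2 * (h * v.2))); last first.
  rewrite /= mulrBl [X in X - _]mulrC mulVKf//; congr (_ - _); ring.
apply: le_trans H _.
rewrite -mulrDr mulrCA [leRHS]mulrC ler_pM2l// -mulrA -[leRHS]mulr1 ler_pM2l//.
by rewrite mulrC ler_pdivrMr//; lra.
Unshelve. all: by end_near.
Qed.

End differentiability.

(** * Lipschitz convex functions and suprema of affine functions *)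

Section planes.
Context {R : realType}.
Local Notation R2 := (measurableTypeR R * measurableTypeR R)%type.
Implicit Types (A D : set (R * R)) (f g w : R * R -> R) (x y e v p : R * R)
  (a b : R * R * R) (F : set (R * R * R)).

Lemma ae_in_sub A D (P : R * R -> Prop) : A `<=` D -> ae_in D P -> ae_in A P.
Proof. by move=> AD; apply: negligibleS => x [Ax nP]; split => //; exact: AD. Qed.

(** With the norm [norm1], the constant [M] corresponds to the bound [M] on each component of the
    slopes, as in [tilt_le M]. *)
Definition lip (M : R) f := forall x y, f x - f y <= M * norm1 (vs x y).

Definition lipc (M : R) f := [/\ 0 <= M, cvx setT f & lip M f].

Lemma norm1_ge0 x : 0 <= norm1 x.
Proof. exact: addr_ge0. Qed.

Lemma norm1_vsC x y : norm1 (vs x y) = norm1 (vs y x).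
Proof. by rewrite /norm1 /vs /= distrC (distrC x.2). Qed.

Lemma lip_abs M f x y : lip M f -> `|f x - f y| <= M * norm1 (vs x y).
Proof.
by move=> lf; rewrite ler_norml; have := lf y x; rewrite (norm1_vsC y) => h;
  apply/andP; split; [lra|exact: lf].
Qed.

Lemma lip_open M f (c : R) : lip M f -> open [set x | c < f x].
Proof.
move=> lf; apply/openP => x /= cx.
have M1 : 0 < `|M| + 1 by have := normr_ge0 M; lra.
exists ((f x - c) / 2 / (`|M| + 1)); first by rewrite !divr_gt0// subr_gt0.
move=> y [] /=; rewrite !ltr_pdivlMr// => h1 h2.
have := lf x y; rewrite norm1_vsC /norm1 /vs /=.
have := ler_norm M; have := normr_ge0 (y.1 - x.1); have := normr_ge0 (y.2 - x.2).
nra.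
Qed.

Lemma lip_measurable M f : lip M f -> measurable_fun [set: R2] (f : R2 -> R).
Proof.
move=> lf; apply: (measurability _ (RGenOInfty.measurableE R)) => /= _ [_ [c ->] <-].
rewrite setTI (_ : _ @^-1` _ = ([set x | c < f x] : set R2)).
  by apply: open_plane_measurable; exact: lip_open lf.
by apply/seteqP; split => x /=; rewrite in_itv/= andbT.
Qed.

(** A version of the gradient that is defined, bounded and measurable on the whole plane, and equal
    to the derivative almost everywhere. *)
Definition gd f := gr setT f.
Arguments gd : simpl never.

Lemma lipc_right_slope M f e x : lipc M f -> `|right_slope setT f e x| <= M * norm1 e.
Proof.
move=> [M0 cf lf].
have q t : 0 < t -> `|(f (mv x t e) - f x) / t| <= M * norm1 e.
  move=> t0; rewrite normrM normfV (gtr0_norm t0) ler_pdivrMr//.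
  apply: le_trans (lip_abs _ _ lf) _; rewrite /norm1 /vs /mv /= !(addrC _ (t * _)) !addrK.
  by rewrite !normrM (gtr0_norm t0) -mulrDr mulrCA mulrC.
rewrite ler_norml; apply/andP; split.
  apply/ler_addgt0Pl => k k0.
  have [t t0 /(_ t)] := right_slope_near openT cf e (I : setT x) k0.
  rewrite t0 lexx => /(_ isT)[_ h].
  by have := q _ t0; rewrite ler_norml => /andP[h1 h2]; lra.
apply: le_trans (right_slope_le openT cf (I : setT x) ltr01 (I : setT (mv x 1 e))) _.
exact: le_trans (ler_norm _) (q _ ltr01).
Qed.

Lemma lipc_gd M f x : lipc M f -> `|(gd f x).1| <= M /\ `|(gd f x).2| <= M.
Proof.
move=> lf; split.
  by have := lipc_right_slope (1, 0) x lf; rewrite /norm1/= normr1 normr0 addr0 mulr1.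
by have := lipc_right_slope (0, 1) x lf; rewrite /norm1/= normr1 normr0 add0r mulr1.
Qed.

Lemma lipc_measurable_gd M f : lipc M f ->
  measurable_fun [set: R2] ((fun x => (gd f x).1) : R2 -> R) /\
  measurable_fun [set: R2] ((fun x => (gd f x).2) : R2 -> R).
Proof.
move=> [_ cf lf]; have mf := lip_measurable lf.
by split; exact: (measurable_right_slope openT cf).
Qed.

Lemma lipc_ae_dif M f D : lipc M f -> ae_in D (fun x => dif f x (gd f x)).
Proof.
move=> [_ cf lf]; apply: (@ae_in_sub _ setT) => //.
by apply: ae_dif => //; [exact: openT|exact: lip_measurable lf].
Qed.

Lemma lipcS M N f : M <= N -> lipc M f -> lipc N f.
Proof.
move=> MN [M0 cf lf]; split => //; first lra.
by move=> x y; apply: le_trans (lf x y) _; apply: ler_wpM2r => //; exact: norm1_ge0.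
Qed.

Lemma lipc_max M f g : lipc M f -> lipc M g -> lipc M (fun x => Num.max (f x) (g x)).
Proof.
move=> [M0 cf lf] [_ cg lg]; split => //.
  move=> x y t _ _ t01; rewrite ge_max.
  have := cf x y t I I t01; have := cg x y t I I t01.
  case/andP: t01 => t0 t1.
  have h1 : f x <= Num.max (f x) (g x) by rewrite le_max lexx.
  have h2 : f y <= Num.max (f y) (g y) by rewrite le_max lexx.
  have h3 : g x <= Num.max (f x) (g x) by rewrite le_max lexx orbT.
  have h4 : g y <= Num.max (f y) (g y) by rewrite le_max lexx orbT.
  by move=> k1 k2; apply/andP; split; nra.
move=> x y; rewrite lerBlDr ge_max.
have h2 : f y <= Num.max (f y) (g y) by rewrite le_max lexx.
have h4 : g y <= Num.max (f y) (g y) by rewrite le_max lexx orbT.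
by have := lf x y; have := lg x y => k1 k2; apply/andP; split; lra.
Qed.

Definition pl a x := dot a.1 x + a.2.

Definition tilt_le (M : R) a := `|a.1.1| <= M /\ `|a.1.2| <= M.

Lemma pl_cb a x y t : pl a (cb t x y) = (1 - t) * pl a x + t * pl a y.
Proof. by rewrite /pl /cb /dot /=; ring. Qed.

Lemma pl_vs a x y : pl a y = pl a x + dot a.1 (vs y x).
Proof. by rewrite /pl /vs /dot /=; ring. Qed.

Lemma dot_le (M : R) v x : `|v.1| <= M -> `|v.2| <= M -> dot v x <= M * norm1 x.
Proof.
move=> h1 h2; apply: le_trans (ler_norm _) _; apply: le_trans (ler_normD _ _) _.
by rewrite !normrM mulrDr lerD// ler_wpM2r.
Qed.

Lemma pl_lipc M a : tilt_le M a -> lipc M (pl a).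
Proof.
move=> [h1 h2]; split; first exact: le_trans h1.
  by move=> x y t _ _ _; rewrite pl_cb.
move=> x y; rewrite (pl_vs a y x) addrC addKr; exact: dot_le.
Qed.

Definition sup_pl F x := sup [set pl a x | a in F].

Section family.
Variables (F : set (R * R * R)) (M : R).
Hypotheses (F0 : F !=set0) (FM : forall a, F a -> tilt_le M a)
  (Fb : exists x B, forall a, F a -> pl a x <= B).

Lemma sup_pl_has x : has_sup [set pl a x | a in F].
Proof.
split; first by have [a Fa] := F0; exists (pl a x), a.
have [y [B hB]] := Fb; exists (B + M * norm1 (vs x y)) => _ [a Fa <-].
have [_ _ /(_ x y)] := pl_lipc (FM Fa); have := hB _ Fa; lra.
Qed.

Lemma sup_pl_ub a x : F a -> pl a x <= sup_pl F x.
Proof. by move=> Fa; apply: sup_upper_bound; [exact: sup_pl_has|exists a]. Qed.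

Lemma sup_pl_le x c : (forall a, F a -> pl a x <= c) -> sup_pl F x <= c.
Proof.
move=> h; apply: ge_sup; first by have [] := sup_pl_has x.
by move=> _ [a Fa <-]; exact: h.
Qed.

Lemma sup_pl_near x (k : R) : 0 < k -> exists2 a, F a & sup_pl F x - k < pl a x.
Proof.
by move=> k0; have [_ [a Fa <-] h] := sup_adherent k0 (sup_pl_has x); exists a.
Qed.

Lemma sup_pl_lipc : lipc M (sup_pl F).
Proof.
split.
- by have [a /FM[h _]] := F0; exact: le_trans h.
- move=> x y t _ _ /andP[t0 t1]; apply: sup_pl_le => a Fa.
  by rewrite pl_cb lerD// ler_wpM2l ?subr_ge0//; exact: sup_pl_ub.
- move=> x y; rewrite lerBlDr; apply: sup_pl_le => a Fa.
  have [_ _ /(_ x y)] := pl_lipc (FM Fa); have := sup_pl_ub y Fa; lra.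
Qed.

End family.

(** A plane that stays below [w] and nearly touches it at [x] is tested at distance [h] along the
    axes, where [w] is close to its own tangent plane. *)
Lemma slope_limit w x p (r k : R) : dif w x p -> 0 < r -> 0 < k ->
  exists2 e : R, 0 < e & forall a, (forall y, near_pt x r y -> pl a y <= w y) ->
    w x - e <= pl a x -> `|p.1 - a.1.1| <= k /\ `|p.2 - a.1.2| <= k.
Proof.
move=> dw r0 k0; have k2 : 0 < k / 2 by rewrite divr_gt0.
have [r' r'0 hr'] := dw _ k2.
have [h [h0 hr hrr']] : exists h : R, [/\ 0 < h, h < r & h < r'].
  have hrr : 0 < Num.min r r' by rewrite lt_min r0.
  exists (Num.min r r' / 2).
  have : Num.min r r' / 2 < Num.min r r' by lra.
  by rewrite lt_min divr_gt0// => /andP[].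
exists (k / 2 * h); first exact: mulr_gt0.
move=> a ha hx.
have key v : `|v.1| <= 1 -> `|v.2| <= 1 -> norm1 v = 1 -> dot a.1 v <= dot p v + k.
  move=> v1 v2 vv.
  have bnd (z s : R) : h < s -> `|z| <= 1 -> `|h * z| < s.
    by move=> hs z1; rewrite normrM (gtr0_norm h0); have := normr_ge0 z; nra.
  have k1 : near_pt x r (mv x h v) by split; rewrite /mv /= addrC addKr; exact: bnd.
  have k3 : near_pt x r' (mv x h v) by split; rewrite /mv /= addrC addKr; exact: bnd.
  have := ha _ k1; have := hr' _ k3; rewrite (pl_vs a x).
  rewrite (_ : vs (mv x h v) x = (h * v.1, h * v.2)); last first.
    by rewrite /vs /mv /=; congr pair; ring.
  rewrite /norm1 /dot /= !normrM (gtr0_norm h0) -mulrDr.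
  rewrite -[`|v.1| + `|v.2|]/(norm1 v) vv mulr1 => H1 H2.
  move: H1; rewrite ler_norml => /andP[_ H1].
  by rewrite -(ler_pM2l h0); lra.
have := key (1, 0); have := key (-1, 0); have := key (0, 1); have := key (0, -1).
rewrite /norm1 /dot /= !normrN !normr1 !normr0 !addr0 !add0r lexx ler01.
move=> /(_ isT isT erefl) h1 /(_ isT isT erefl) h2 /(_ isT isT erefl) h3 /(_ isT isT erefl) h4.
by rewrite !ler_norml; split; apply/andP; split; lra.
Qed.

(* [pl_cost (0, 0) 0] is the integrand of the functional minus [|x|^2 / 2], a
   function of the tangent plane alone. *)
Definition pl_cost p (c : R) a := 2^-1 * sqnorm a.1 + a.2 + dot p a.1 + c.

(** A bound on the costs of the planes of a family passes to the tangent plane of their supremum: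
    planes that nearly touch have nearly the slope [p], and the cost is continuous in the plane. *)
Lemma pl_cost_limit w x p v (r c th : R) : dif w x p -> 0 < r ->
  (forall e : R, 0 < e -> exists a, [/\ forall y, near_pt x r y -> pl a y <= w y,
     w x - e <= pl a x & pl_cost v c a <= th]) ->
  pl_cost v c (p, w x - dot p x) <= th.
Proof.
move=> dw r0 h; apply/ler_addgt0Pr => k k0.
pose K := `|p.1 + v.1 - x.1| + `|p.2 + v.2 - x.2| + 1.
have n1 := normr_ge0 (p.1 + v.1 - x.1); have n2 := normr_ge0 (p.2 + v.2 - x.2).
have K0 : 0 < K by rewrite /K; lra.
have kK : 0 < k / 2 / K by rewrite !divr_gt0.
have [e e0 he] := slope_limit dw r0 kK.
have [|a [h1 h2 h3]] := h (Num.min e (k / 2)); first by rewrite lt_min e0 divr_gt0.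
have m1 : Num.min e (k / 2) <= e by rewrite ge_min lexx.
have m2 : Num.min e (k / 2) <= k / 2 by rewrite ge_min lexx orbT.
have h4 : w x - e <= pl a x by lra.
have h5 : w x - k / 2 <= pl a x by lra.
have [k1 k2] := he _ h1 h4.
apply: le_trans (_ : pl_cost v c a + k <= _); last by rewrite lerD2r.
rewrite -lerBlDl.
(* The quadratic remainders are negative and dropped; the linear terms are small because [K] bounds
   the sum of their coefficients. *)
rewrite [leLHS](_ : _ = (p.1 - a.1.1) * (p.1 + v.1 - x.1) - 2^-1 * (p.1 - a.1.1) ^+ 2 +
  ((p.2 - a.1.2) * (p.2 + v.2 - x.2) - 2^-1 * (p.2 - a.1.2) ^+ 2) + (w x - pl a x)); last first.
  by rewrite /pl_cost /sqnorm /pl /dot /=; field.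
have b1 : (p.1 - a.1.1) * (p.1 + v.1 - x.1) <= k / 2 / K * `|p.1 + v.1 - x.1|.
  by apply: le_trans (ler_norm _) _; rewrite normrM ler_wpM2r.
have b2 : (p.2 - a.1.2) * (p.2 + v.2 - x.2) <= k / 2 / K * `|p.2 + v.2 - x.2|.
  by apply: le_trans (ler_norm _) _; rewrite normrM ler_wpM2r.
have kKE : k / 2 / K * K = k / 2 by rewrite mulfVK// gt_eqF.
have := sqr_ge0 (p.1 - a.1.1); have := sqr_ge0 (p.2 - a.1.2).
move: kKE; rewrite {2}/K !mulrDr; lra.
Qed.

End planes.

(** * Reduction to a Lipschitz minimizer *)

Section functional.
Context {R : realType}.
Local Notation R2 := (measurableTypeR R * measurableTypeR R)%type.
Implicit Types (A D : set (R * R)) (f g w u : R * R -> R) (x y e v p : R * R)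
  (a b : R * R * R) (F : set (R * R * R)).

(** [conv t] puts the weight [t] on the first point and [cb t] on the second, whence [1 - t]. *)
Lemma convE x y (t : {i01 R}) :
  (conv t (x : convex_lmodType (R * R)%type) y : R * R) = cb (1 - t%:num) x y.
Proof. by rewrite /cb [LHS]surjective_pairing; congr pair; rewrite /= subKr. Qed.

Lemma convex_set_cset A : @convex_set R (R * R)%type A -> cset A.
Proof.
move=> cA x y t Ax Ay /andP[t0 t1].
have s0 : 0 <= 1 - t by lra.
have s1 : 1 - t <= 1 by lra.
have := cA x y (Itv01 s0 s1); rewrite !inE convE /= subKr; exact.
Qed.

Lemma convex_function_cvx A f : @convex_function R (R * R)%type A f -> cvx A f.
Proof.
move=> cf x y t Ax Ay /andP[t0 t1].
have s0 : 0 <= 1 - t by lra.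
have s1 : 1 - t <= 1 by lra.
have := cf (Itv01 s0 s1) x y; rewrite !inE convE /= subKr => /(_ Ax Ay).
move=> /le_trans; apply; rewrite convRE /=.
by rewrite /unstable.onem subKr.
Qed.

Lemma cvx_convex_function A f : cvx A f -> @convex_function R (R * R)%type A f.
Proof.
move=> cf t x y; rewrite !inE convE => Ax Ay.
have := cf x y (1 - t%:num) Ax Ay; rewrite subKr convRE; apply.
by rewrite subr_ge0 le1 gerBl ge0.
Qed.

Lemma cvxS A D f : A `<=` D -> cvx D f -> cvx A f.
Proof. by move=> AD cf x y t /AD Dx /AD Dy; exact: cf. Qed.

Section partials.
Variables (A : set (R * R)) (f : R * R -> R).
Hypotheses (oA : open A) (cf : cvx A f).

Lemma derive_right_slope e x : A x ->
  right_slope A f e x + right_slope A f (opv e) x <= 0 ->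
  'D_e f x = right_slope A f e x.
Proof.
move=> Ax h.
apply: cvg_lim => //; apply/cvgrPdist_le => k k0.
have [t t0 ht] := right_slope_near oA cf e Ax k0.
have [t' t'0 ht'] := right_slope_near oA cf (opv e) Ax k0.
have rr := right_slope_opp oA cf e Ax.
near=> s.
have s0 : s != 0 by near: s; exact: nbhs_dnbhs_neq.
have st : `|s| < t by near: s; apply: dnbhs0_lt.
have st' : `|s| < t' by near: s; apply: dnbhs0_lt.
have E : s *: e + x = mv x s e by rewrite /mv [LHS]surjective_pairing; congr pair; rewrite /= addrC.
rewrite /= E.
rewrite -[X in `|_ - X|]/(s^-1 * (f (mv x s e) - f x)).
rewrite distrC ler_norml; have [sp|sn] := ltP 0 s.
  rewrite gtr0_norm// in st.
  have [|As h1] := ht s; first by rewrite sp ltW.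
  have := right_slope_le oA cf Ax sp As.
  by rewrite mulrC => h2; apply/andP; split; lra.
have sn' : s < 0 by rewrite lt_neqAle s0.
rewrite ltr0_norm// in st'.
have sp : 0 < - s by lra.
have [|As h1] := ht' (- s); first by rewrite sp ltW.
have h2 := right_slope_le oA cf Ax sp As.
move: h1 h2; rewrite mv_opv opprK invrN mulrN => h1 h2.
by rewrite mulrC; apply/andP; split; lra.
Unshelve. all: by end_near.
Qed.

(** With [derive_right_slope] this gives the value of ['D_e f] at every point of [A], the default
    included; [measurable_derive] needs both cases. *)
Lemma derive_no_slope e x : A x ->
  0 < right_slope A f e x + right_slope A f (opv e) x -> 'D_e f x = point.
Proof.
move=> Ax h; apply: dvgP => cv.
set l := lim _ in cv.
have key k : 0 < k -> right_slope A f e x <= l + k /\ right_slope A f (opv e) x <= - l + k.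
  move=> k0; move/cvgrPdist_le : cv => /(_ _ k0) /nbhs_ballP[d /= d0 hd].
  have hq s : s != 0 -> `|s| < d -> `|l - s^-1 * (f (mv x s e) - f x)| <= k.
    move=> s0 sd; have := hd s; rewrite /ball/= sub0r normrN => /(_ sd s0).
    rewrite [X in f X](_ : _ = mv x s e)//.
    by rewrite /mv [LHS]surjective_pairing; congr pair; rewrite /= addrC.
  have [r r0 hr] := open_mv e oA Ax.
  pose s := Num.min (d / 2) r.
  have s0 : 0 < s by rewrite lt_min r0 divr_gt0.
  have sd : s < d by rewrite gt_min; apply/orP; left; lra.
  have sr : s <= r by rewrite ge_min lexx orbT.
  have As : A (mv x s e) by apply: hr; rewrite gtr0_norm.
  have As' : A (mv x s (opv e)) by rewrite mv_opv; apply: hr; rewrite normrN gtr0_norm.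
  have h1 := right_slope_le oA cf Ax s0 As.
  have h2 := right_slope_le oA cf Ax s0 As'.
  have := hq s; rewrite gt_eqF// gtr0_norm// => /(_ isT sd).
  have := hq (- s); rewrite oppr_eq0 gt_eqF// normrN gtr0_norm// => /(_ isT sd).
  rewrite mv_opv in h2.
  rewrite invrN mulNr ![s^-1 * _]mulrC !ler_norml => /andP[k1 k2] /andP[k3 k4].
  by split; lra.
have h3 : right_slope A f e x <= l by apply/ler_addgt0Pr => k /key[].
have h4 : right_slope A f (opv e) x <= - l by apply/ler_addgt0Pr => k /key[].
lra.
Qed.

Lemma measurable_derive e : measurable_fun [set: R2] (f : R2 -> R) ->
  measurable_fun (A : set R2) ((fun x => 'D_e f x) : R2 -> R).
Proof.
move=> mf.
have mA := open_plane_measurable oA.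
have mr e' := measurable_right_slope oA cf e' mf.
pose s (x : R2) : R := right_slope A f e x + right_slope A f (opv e) x.
have ms : measurable_fun (A : set R2) s by apply: measurable_funD.
pose S : set R2 := A `&` s @^-1` `]-oo, 0].
have mS : measurable S by apply: ms.
have mh : measurable_fun (A : set R2) (fun x : R2 =>
    right_slope A f e x * \1_S x + (point : R) * (1 - \1_S x)).
  have mi : measurable_fun (A : set R2) (fun x : R2 => \1_S x : R) by exact: (@measurable_indic _ R2 R _ S mS).
  apply: measurable_funD.
    by apply: measurable_funM => //; exact: (mr e).
  by apply: measurable_funM => //; apply: measurable_funB.
apply: eq_measurable_fun mh => x /set_mem Ax; rewrite indicE.
have [sx|sx] := leP (s x) 0.
  by rewrite mem_set ?mulr1 ?subrr ?mulr0 ?addr0 ?derive_right_slope//; split => //=; rewrite in_itv.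
rewrite memNset ?mulr0 ?subr0 ?mulr1 ?add0r ?derive_no_slope//.
by move=> [_] /=; rewrite in_itv/= leNgt sx.
Qed.

Lemma ae_grad : measurable_fun [set: R2] (f : R2 -> R) ->
  ae_in A (fun x => grad f x = gr A f x).
Proof.
move=> mf; apply: (ae_inS (ae_dif oA cf mf)) => x Ax df.
by rewrite /grad !(dif_derive _ df) /dot /gr /=; congr pair; ring.
Qed.

End partials.
End functional.

Section lipschitz_reduction.
Context {R : realType}.
Local Notation mu := (@plane_measure R).
Local Notation R2 := (measurableTypeR R * measurableTypeR R)%type.
Implicit Types (A D : set (R * R)) (f g w u : R * R -> R) (x y e v p q : R * R)
  (a b : R * R * R) (F : set (R * R * R)).

Definition cost q x (c : R) : R := 2^-1 * sqnorm (vs q x) + c.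

Lemma costE q x c : cost q x c = pl_cost (0, 0) 0 (q, c - dot q x) + 2^-1 * sqnorm x.
Proof. by rewrite /cost /pl_cost /sqnorm /dot /vs /=; field. Qed.

Lemma L_functionalE D w : L_functional D w =
  (\int[mu]_(x in (D : set R2)) (cost (grad w x) x (w x))%:E)%E.
Proof. by []. Qed.

Lemma measurable_cost D (q1 q2 c : R * R -> R) :
  measurable_fun (D : set R2) (q1 : R2 -> R) -> measurable_fun (D : set R2) (q2 : R2 -> R) ->
  measurable_fun (D : set R2) (c : R2 -> R) ->
  measurable_fun (D : set R2) ((fun x => cost (q1 x, q2 x) x (c x)) : R2 -> R).
Proof.
move=> m1 m2 mc; rewrite /cost /sqnorm /vs /=.
apply: measurable_funD => //; apply: measurable_funM => //.
apply: measurable_funD; apply: measurable_funX; apply: measurable_funB => //.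
  by apply: measurable_funTS; exact: measurable_fst.
by apply: measurable_funTS; exact: measurable_snd.
Qed.

Section domain.
Variable D : set (R * R).
Hypotheses (oD : open D) (cD : cset D) (bD : bounded_set D).

Let mD : measurable (D : set R2).
Proof. exact: open_plane_measurable. Qed.

Lemma bounded_measure : (mu (D : set R2) < +oo)%E.
Proof.
have [M M0 hM] := bounded_setP bD.
apply: le_lt_trans (_ : mu (box (- (M + 1)) (M + 1) (- (M + 1)) (M + 1) : set R2) < +oo)%E.
  apply: le_measure; rewrite ?inE//; first exact: box_measurable.
  by move=> x /hM[]; rewrite !ler_norml => /andP[h1 h2] /andP[h3 h4]; split; lra.
by rewrite box_measure ?ltry//; lra.
Qed.

Let fD := bounded_measure.

Lemma bm_fst : bm D (fun x => x.1).
Proof.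
have [M M0 hM] := bounded_setP bD; split; first by apply: measurable_funTS; exact: measurable_fst.
by exists M => x /hM[].
Qed.

Lemma bm_snd : bm D (fun x => x.2).
Proof.
have [M M0 hM] := bounded_setP bD; split; first by apply: measurable_funTS; exact: measurable_snd.
by exists M => x /hM[].
Qed.

Lemma lip_bm M f : lip M f -> bm D f.
Proof.
move=> lf; split; first by apply: measurable_funTS; exact: lip_measurable lf.
have [B B0 hB] := bounded_setP bD.
exists (`|f (0, 0)| + `|M| * (2 * B)) => x /hB[x1 x2].
rewrite -(subrK (f (0, 0)) (f x)) addrC (le_trans (ler_normD _ _))// lerD2l.
apply: le_trans (lip_abs _ _ lf) _; rewrite /norm1 /vs /= !subr0.
apply: le_trans (_ : `|M| * (`|x.1| + `|x.2|) <= _).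
  by apply: ler_wpM2r; [exact: addr_ge0|exact: ler_norm].
by apply: ler_wpM2l => //; lra.
Qed.

Lemma lipc_bm M f : lipc M f -> bm D f.
Proof. by move=> [_ _]; exact: lip_bm. Qed.

Lemma gd_bm M f : lipc M f -> bm D (fun x => (gd f x).1) /\ bm D (fun x => (gd f x).2).
Proof.
move=> lf; have [m1 m2] := lipc_measurable_gd lf.
split; split; try exact: measurable_funTS; exists M => x _; have [] := lipc_gd x lf => //.
Qed.

Definition fcost w x : R := cost (gd w x) x (w x).

Lemma bm_fcost M w : lipc M w -> bm D (fcost w).
Proof.
move=> lw; have [b1 b2] := gd_bm lw; have b3 := lipc_bm lw.
have bB1 := bmB b1 bm_fst; have bB2 := bmB b2 bm_snd.
have := bmD (bmZ 2^-1 (bmD (bmM bB1 bB1) (bmM bB2 bB2))) b3.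
rewrite (_ : (fun x => _) = fcost w)//.
Qed.

Lemma cost_ge0 q x (c : R) : 0 <= c -> 0 <= cost q x c.
Proof. by move=> c0; rewrite addr_ge0// mulr_ge0 ?invr_ge0// addr_ge0 ?sqr_ge0. Qed.

Lemma measurable_grad_cost A f : open A -> cvx A f -> D `<=` A ->
  measurable_fun [set: R2] (f : R2 -> R) ->
  measurable_fun (D : set R2) ((fun x => cost (grad f x) x (f x)) : R2 -> R).
Proof.
move=> oA cf DA mf; apply: measurable_cost.
- apply: (measurable_funS (open_plane_measurable oA) DA).
  exact: (measurable_derive oA cf).
- apply: (measurable_funS (open_plane_measurable oA) DA).
  exact: (measurable_derive oA cf).
- exact: measurable_funTS.
Qed.

Lemma L_functional_lipc M w : lipc M w -> (forall x, D x -> 0 <= w x) ->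
  L_functional D w = (II D (fcost w))%:E.
Proof.
move=> lw w0; have [_ cw lipw] := lw; have mw := lip_measurable lipw.
have iw : mu.-integrable (D : set R2) (EFin \o (fcost w : R2 -> R)).
  exact: (bm_integrable mD fD (bm_fcost lw)).
rewrite /II /Rintegral fineK; last by apply: integrable_fin_num.
apply: ae_eq_integral => //.
- by apply/measurable_EFinP; exact: (measurable_grad_cost openT cw).
- by apply/measurable_EFinP; have [] := bm_fcost lw.
apply: negligibleS (ae_in_sub (D := setT) (A := D) (fun _ _ => I) (ae_grad openT cw mw)).
move=> x /= /not_implyP[Dx ne]; split => // e; apply: ne.
by rewrite /fcost /gd -e.
Qed.

End domain.
End lipschitz_reduction.

Section reduction.
Context {R : realType}.
Local Notation mu := (@plane_measure R).
Local Notation R2 := (measurableTypeR R * measurableTypeR R)%type.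
Implicit Types (A D : set (R * R)) (f g w u : R * R -> R) (x y e v p q : R * R)
  (a b : R * R * R) (F : set (R * R * R)).

Lemma lip_K_class D M w : lipc M w -> (forall x, D x -> 0 <= w x) -> K_class D w.
Proof.
move=> [M0 cw lw] w0; split; first by apply: cvx_convex_function; exact: cvxS cw.
move=> x cx; rewrite leNgt; apply/negP => wx.
have oN : open [set y | - 0 < - w y].
  apply: (@lip_open _ M) => y z; rewrite opprK addrC norm1_vsC; exact: lw.
have xN : [set y | - 0 < - w y] x by rewrite /= oppr0 oppr_gt0.
have [r r0 hr] := (openP _).1 oN _ xN.
have [y Dy xy] := (closureP D x).1 cx _ r0.
by have := hr _ xy; rewrite /= oppr0 oppr_gt0 ltNge w0.
Qed.

Lemma dif_near f g x p (r : R) : 0 < r -> (forall y, near_pt x r y -> f y = g y) ->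
  dif f x p -> dif g x p.
Proof.
move=> r0 fg df k k0; have [s s0 hs] := df k k0.
exists (Num.min r s); first by rewrite lt_min r0.
move=> y [] /=; rewrite !lt_min => /andP[y1 y2] /andP[y3 y4].
rewrite -!fg//; first exact: hs.
by split; rewrite subrr normr0.
Qed.

Lemma grad_near f g x (r : R) : 0 < r -> (forall y, near_pt x r y -> f y = g y) ->
  grad f x = grad g x.
Proof.
move=> r0 fg.
have nfg : \forall y \near x, f y = g y.
  by apply: filterS (near_pt_nbhs x r0) => y; exact: fg.
by rewrite /grad; congr pair; apply: near_eq_derive.
Qed.

(** The cost bound reads [|q|^2 <= 2 B (|q.1| + |q.2|)] at most, that is, the squares of [|q.1| - B]
    and [|q.2| - B] add up to at most [2 B^2]. A component above [3 B] is impossible. *)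
Lemma pl_cost_tilt (B c : R) q x : 0 < B -> `|x.1| <= B -> `|x.2| <= B -> 0 <= c ->
  pl_cost (0, 0) 0 (q, c - dot q x) <= 0 -> tilt_le (3 * B) (q, c - dot q x).
Proof.
move=> B0 x1 x2 c0; rewrite /pl_cost /sqnorm /dot /tilt_le /= => hq.
have e1 : q.1 * x.1 <= `|q.1| * B.
  by apply: le_trans (ler_norm _) _; rewrite normrM ler_wpM2l.
have e2 : q.2 * x.2 <= `|q.2| * B.
  by apply: le_trans (ler_norm _) _; rewrite normrM ler_wpM2l.
have s1 : q.1 ^+ 2 = `|q.1| ^+ 2 by rewrite real_normK// num_real.
have s2 : q.2 ^+ 2 = `|q.2| ^+ 2 by rewrite real_normK// num_real.
have n1 := normr_ge0 q.1; have n2 := normr_ge0 q.2.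
rewrite s1 s2 in hq.
have {}hq : `|q.1| ^+ 2 + `|q.2| ^+ 2 <= 2 * B * (`|q.1| + `|q.2|) by lra.
have t1 := sqr_ge0 (`|q.1| - B); have t2 := sqr_ge0 (`|q.2| - B).
have B2 : 0 < B * B by exact: mulr_gt0.
split; rewrite leNgt; apply/negP => h.
  have t3 : 0 < (`|q.1| - 3 * B) * (`|q.1| + B) by apply: mulr_gt0; lra.
  lra.
have t3 : 0 < (`|q.2| - 3 * B) * (`|q.2| + B) by apply: mulr_gt0; lra.
lra.
Qed.

Section domain.
Variables (D : set (R * R)) (u : R * R -> R).
Hypotheses (oD : open D) (cD : cset D) (bD : bounded_set D).
Hypotheses (cu : cvx D u) (u0 : forall x, D x -> 0 <= u x).
Hypothesis mu_ : forall w M, lipc M w -> (forall x, D x -> 0 <= w x) ->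
  (L_functional D u <= L_functional D w)%E.

Let mD : measurable (D : set R2).
Proof. exact: open_plane_measurable. Qed.

Let fD := bounded_measure oD bD.

(** Outside the closure [u] is arbitrary; extending it by zero from [D] gives a function measurable
    on the plane, with the same gradient in [D]. *)
Let v := (u : R2 -> R) \_ D.

Let vE x : D x -> v x = u x.
Proof. by move=> Dx; rewrite /v patchE mem_set. Qed.

Let cv : cvx D v.
Proof.
by move=> x y t Dx Dy t01; rewrite !vE//; [exact: cu|exact: cD].
Qed.

Let mv_ : measurable_fun [set: R2] (v : R2 -> R).
Proof.
apply: (measurability _ (RGenOInfty.measurableE R)) => /= _ [_ [c ->] <-].
rewrite setTI.
have -> : v @^-1` `]c, +oo[%classic = ([set x | D x /\ c < u x] : set R2) `|`
    (if c < 0 then ~` (D : set R2) else set0).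
  apply/seteqP; split => x /=; rewrite in_itv/= andbT /v patchE.
    case: (pselect (D x)) => Dx; first by rewrite mem_set//; left.
    by rewrite memNset// => c0; right; rewrite c0.
  case; first by move=> [Dx cx]; rewrite mem_set.
  by case: ifP => // c0 nDx; rewrite memNset.
apply: measurableU; last by case: ifP => // _; exact: measurableC.
apply: open_plane_measurable; apply/openP => x [Dx cx].
have k0 : 0 < (u x - c) / 2 by rewrite divr_gt0// subr_gt0.
have [r r0 hr] := cvx_continuous oD cu Dx k0.
exists r => // y /hr[Dy]; rewrite ler_norml => /andP[h _]; split => //.
lra.
Qed.

Let L_functional_v : L_functional D u =
  (\int[mu]_(x in (D : set R2)) (cost (grad v x) x (v x))%:E)%E.
Proof.
apply: eq_integral => x /set_mem Dx; congr (_%:E).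
have [r r0 hr] := (openP D).1 oD _ Dx.
by rewrite vE// (grad_near r0 (f := u) (g := v))// => y /hr Dy; rewrite vE.
Qed.

(** The bound [3 * B] makes the supremum Lipschitz. By [pl_cost_tilt] it excludes no tangent plane
    of [u] of nonpositive cost when [B] bounds the coordinates of the points of [D]. *)
Let F B : set (R * R * R) := [set a | [/\ tilt_le (3 * B) a, pl_cost (0, 0) 0 a <= 0 &
  forall x, D x -> pl a x <= u x]].

Let F_zero B : 0 < B -> F B ((0, 0), 0).
Proof.
move=> B0; split.
- by split; rewrite /= normr0; lra.
- by rewrite /pl_cost /sqnorm /dot /=; lra.
- by move=> x /u0; rewrite /pl /dot /= !mul0r !addr0.
Qed.

(* Removing the tangent planes of positive cost yields a competitor, which is
   strictly better wherever it differs from [u]; hence no such plane exists. *)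
Lemma lipschitz_minimizer : exists M w, [/\ lipc M w, forall x, 0 <= w x,
  forall x, D x -> w x = u x &
  forall w' N, lipc N w' -> (forall x, D x -> 0 <= w' x) ->
    II D (fcost w) <= II D (fcost w')].
Proof.
have [B B0 hB] := bounded_setP bD.
have F0 : F B !=set0 by exists ((0, 0), 0); exact: F_zero.
have FM a : F B a -> tilt_le (3 * B) a by case.
have Fb : exists x c, forall a, F B a -> pl a x <= c.
  exists (0, 0), 0 => a [_]; rewrite /pl_cost /pl /sqnorm /dot /=.
  by have := sqr_ge0 a.1.1; have := sqr_ge0 a.1.2; lra.
pose w := sup_pl (F B).
have lw : lipc (3 * B) w := sup_pl_lipc F0 FM Fb.
have w0 x : 0 <= w x.
  have := sup_pl_ub F0 FM Fb x (F_zero B0).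
  by rewrite {1}/pl /dot /= !mul0r !addr0.
have wu x : D x -> w x <= u x.
  by move=> Dx; apply: (sup_pl_le F0 FM Fb) => a [_ _ h]; exact: h.
have key : ae_in D (fun x => cost (grad w x) x (w x) <= cost (grad v x) x (v x) /\
    (cost (grad w x) x (w x) = cost (grad v x) x (v x) -> w x = v x)).
  have [_ cw lipw] := lw.
  have h1 := ae_in2 (ae_dif oD cv mv_) (ae_grad oD cv mv_) (fun x _ h k => conj h k).
  have h2 := ae_in_sub (D := setT) (A := D) (fun _ _ => I)
     (ae_in2 (ae_dif openT cw (lip_measurable lipw))
     (ae_grad openT cw (lip_measurable lipw)) (fun x _ h k => conj h k)).
  apply: (ae_in2 h1 h2) => x Dx [dv ->] [dw ->].
  set q := gr D v x in dv *; set p := gr setT w x in dw *.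
  have [r r0 hr] := (openP D).1 oD _ Dx.
  have [wx|wx] := eqVneq (w x) (v x).
    have -> : p = q.
      by apply: (dif_touch dw dv r0) => // y /hr Dy; rewrite vE//; exact: wu.
    by rewrite wx.
  have {}wx : w x < v x by rewrite lt_neqAle wx vE// wu.
  (* Otherwise this tangent plane would belong to [F B] and [w] would reach [u] at [x]. *)
  have hq : 0 < pl_cost (0, 0) 0 (q, v x - dot q x).
    rewrite ltNge; apply/negP => hq.
    have sub y : D y -> pl (q, v x - dot q x) y <= u y.
      move=> Dy; have := dif_subgradient cv Dx Dy dv.
      by rewrite (vE Dy) /pl /dot /vs /=; lra.
    suff : F B (q, v x - dot q x).
      move=> /(sup_pl_ub F0 FM Fb x); rewrite -/w /pl /= addrC subrK leNgt.
      by rewrite wx.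
    split => //; have [x1 x2] := hB _ Dx.
    by apply: (pl_cost_tilt B0 x1 x2 _ hq); rewrite vE// u0.
  have hp : pl_cost (0, 0) 0 (p, w x - dot p x) <= 0.
    apply: (pl_cost_limit dw r0) => k k0.
    have [a Fa ha] := sup_pl_near F0 FM Fb x k0.
    exists a; split; last by case: Fa.
      by move=> y _; exact: (sup_pl_ub F0 FM Fb).
    exact: ltW.
  rewrite !costE; split => [|e]; first lra.
  by exfalso; lra.
have cw : forall x, D x -> 0 <= w x by move=> x _.
pose Iu x := cost (grad v x) x (v x); pose Iw x := cost (grad w x) x (w x).
have [_ cvw lipw] := lw.
have mIu : measurable_fun (D : set R2) (EFin \o (Iu : R2 -> R)).
  by apply/measurable_EFinP; exact: (measurable_grad_cost oD cv (fun _ h => h) mv_).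
have mIw : measurable_fun (D : set R2) (EFin \o (Iw : R2 -> R)).
  by apply/measurable_EFinP; exact: (measurable_grad_cost openT cvw (fun _ _ => I) (lip_measurable lipw)).
have Iu0 x : D x -> (0 <= (Iu x)%:E)%E.
  by move=> Dx; rewrite lee_fin; apply: cost_ge0; rewrite vE ?u0.
have Iw0 x : D x -> (0 <= (Iw x)%:E)%E.
  by move=> Dx; rewrite lee_fin; apply: cost_ge0.
have Lw := L_functional_lipc oD bD lw cw.
have Luw := mu_ lw cw.
have Lwu : (L_functional D w <= L_functional D u)%E.
  rewrite L_functional_v; apply: ae_ge0_le_integral => //.
  by apply: negligibleS key => x /= /not_implyP[Dx ne]; split => // -[le _]; apply: ne; rewrite lee_fin.
(* The common value is finite because [w] is Lipschitz. Both densities are then integrable, and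
   their nonnegative difference has integral zero. *)
have Leq : L_functional D u = L_functional D w by apply/le_anti/andP; split.
have iw : mu.-integrable (D : set R2) (EFin \o (Iw : R2 -> R)).
  apply/integrableP; split => //.
  apply: le_lt_trans (_ : L_functional D w < +oo)%E; last by rewrite Lw ltry.
  rewrite L_functionalE le_eqVlt; apply/orP; left; apply/eqP.
  by apply: eq_integral => x /set_mem Dx; rewrite gee0_abs//; exact: Iw0.
have iu : mu.-integrable (D : set R2) (EFin \o (Iu : R2 -> R)).
  apply/integrableP; split => //.
  apply: le_lt_trans (_ : L_functional D u < +oo)%E; last by rewrite Leq Lw ltry.
  rewrite L_functional_v le_eqVlt; apply/orP; left; apply/eqP.
  by apply: eq_integral => x /set_mem Dx; rewrite gee0_abs//; exact: Iu0.
have ae0 : ae_in D (fun x => Iu x - Iw x = 0).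
  have iB : (\int[mu]_(x in (D : set R2)) ((Iu x)%:E - (Iw x)%:E))%E = 0%E.
    rewrite integralB//.
    rewrite -[X in (X - _)%E]L_functional_v -[X in (_ - X)%E]/(L_functional D w) Leq Lw.
    by rewrite subee.
  have mB : measurable_fun (D : set R2) (fun x : R2 => ((Iu x)%:E - (Iw x)%:E)%E).
    exact: emeasurable_funB.
  have := ae_eq_integral_abs mu mD mB => -[+ _].
  have -> : (\int[mu]_(x in (D : set R2)) `|(Iu x)%:E - (Iw x)%:E|)%E = 0%E.
    rewrite -[RHS]iB; apply: ae_eq_integral => //; first exact: measurableT_comp.
    apply: negligibleS key => x /= /not_implyP[Dx ne]; split => // -[le _]; apply: ne.
    by rewrite /= ger0_norm// subr_ge0.
  move=> /(_ erefl) h; apply: negligibleS h => x [Dx ne] /= /(_ Dx) [] e; exact: ne.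
have ae1 : ae_in D (fun x => w x = v x).
  by apply: (ae_in2 key ae0) => x Dx [_ h] e; apply: h; apply/eqP; rewrite eq_sym -subr_eq0 e.
have wE x : D x -> w x = u x.
  move=> Dx; apply/eqP; rewrite eq_le wu//= leNgt; apply/negP => wx.
  have k0 : 0 < (u x - w x) / 4 by rewrite divr_gt0// subr_gt0.
  have [r1 r10 hr1] := cvx_continuous oD cu Dx k0.
  have [r2 r20 hr2] := cvx_continuous openT cvw (I : setT x) k0.
  have rr : 0 < Num.min r1 r2 by rewrite lt_min r10.
  have [y [Dy wvy []]] := ae_in_dense oD ae1 (subset_closure Dx) rr.
  rewrite !lt_min => /andP[y1 y2] /andP[y3 y4].
  have [_] := hr1 y (conj y1 y3); have [_] := hr2 y (conj y2 y4).
  by rewrite !ler_norml wvy vE// => /andP[? ?] /andP[? ?]; lra.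
exists (3 * B), w; split => // w' N lw' w'0.
by rewrite -lee_fin -(L_functional_lipc oD bD lw cw) -(L_functional_lipc oD bD lw' w'0) -Leq; exact: mu_ lw' w'0.
Qed.

End domain.
End reduction.

(** * Fluxes of dilations and translations *)

Section flux.
Context {R : realType}.
Local Notation mu := (@plane_measure R).
Local Notation R2 := (measurableTypeR R * measurableTypeR R)%type.
Implicit Types (A D : set (R * R)) (f g w u : R * R -> R) (x y e v p q : R * R).

(** The velocity of the contraction towards [c] for [l = 1], and of the translation by [c] for
    [l = 0]. *)
Definition field (l : R) c x : R * R := (c.1 - l * x.1, c.2 - l * x.2).

Section domain.
Variable D : set (R * R).
Hypotheses (oD : open D) (bD : bounded_set D).

Let mD : measurable (D : set R2).
Proof. exact: open_plane_measurable. Qed.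

Let fD := bounded_measure oD bD.

Lemma EFin_II g : bm D g -> (II D g)%:E = (\int[mu]_(x in (D : set R2)) (g x)%:E)%E.
Proof.
move=> bg; rewrite /II /Rintegral fineK//.
by apply: integrable_fin_num => //; exact: bm_integrable.
Qed.

Lemma II_scales (k : R) (T : R2 -> R2) (g : R * R -> R) : 0 <= k -> scales_measure k T ->
  measurable_fun [set: R2] (g : R2 -> R) -> bm D g -> (forall x, D x -> 0 <= g x) ->
  II D (fun x => \1_(T @^-1` (D : set R2)) x * g (T x)) <= k * II D g.
Proof.
move=> k0 sT mg bg g0; have [mT _] := sT.
pose h : R2 -> R := (g : R2 -> R) \_ (D : set R2).
have hE x : h x = \1_(D : set R2) x * g x.
  by rewrite /h patchE indicE; case: ifP => _; rewrite ?mul1r ?mul0r.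
have h0 x : 0 <= h x.
  by rewrite /h patchE; case: ifPn => // /set_mem; exact: g0.
have mh : measurable_fun [set: R2] h.
  rewrite (_ : h = (fun x => \1_(D : set R2) x * g x)); last by apply/funext.
  by apply: measurable_funM => //; exact: measurable_indic.
have mTD : measurable (T @^-1` (D : set R2)) by rewrite -[X in measurable X]setTI; exact: mT.
have hT x : h (T x) = \1_(T @^-1` (D : set R2)) x * g (T x).
  by rewrite hE; congr (_ * _); rewrite !indicE.
have [M hM] := bg.2.
have bhT : bm D (fun x => \1_(T @^-1` (D : set R2)) x * g (T x)).
  split.
    rewrite (_ : (fun x => _) = h \o T); last by apply/funext => x; rewrite -hT.
    by apply: measurable_funTS; exact: measurableT_comp.
  exists `|M| => x Dx; rewrite indicE; have [TD|TD] := pselect (D (T x)); last first.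
    by rewrite memNset// mul0r normr0.
  by rewrite mem_set// mul1r; apply: le_trans (ler_norm M); exact: hM.
rewrite -lee_fin EFinM !EFin_II//.
have le1 : (\int[mu]_(x in (D : set R2)) (\1_(T @^-1` (D : set R2)) x * g (T x))%:E <=
    \int[mu]_x (h (T x))%:E)%E.
  have -> : (\int[mu]_(x in (D : set R2)) (\1_(T @^-1` (D : set R2)) x * g (T x))%:E =
     \int[mu]_(x in (D : set R2)) (h (T x))%:E)%E.
    by apply: eq_integral => x _; rewrite hT.
  apply: ge0_subset_integral => //; last by move=> x _; rewrite lee_fin.
  by apply/measurable_EFinP; exact: measurableT_comp.
apply: le_trans le1 _.
rewrite (ge0_integral_scales k0 sT mh h0) (_ : (\int[mu]_x (h x)%:E = \int[mu]_(x in (D : set R2)) (g x)%:E)%E)//.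
rewrite [RHS]integral_mkcond; apply: eq_integral => x _.
by rewrite /h restrict_EFin.
Qed.

Lemma field_scales (l : R) c (t : R) : t * l < 1 ->
  scales_measure ((1 - t * l) ^- 2) (fun x => mv x t (field l c x)).
Proof.
move=> tl; have d0 : 0 < 1 - t * l by rewrite subr_gt0.
rewrite (_ : (fun x => _) = affine_map (1 - t * l) 0 0 (1 - t * l) (t * c.1) (t * c.2)); last first.
  by apply/funext => x; rewrite /mv /field /affine_map /=; congr pair; ring.
rewrite (_ : _ ^- 2 = `|(1 - t * l) * (1 - t * l) - 0 * 0|^-1); last first.
  by rewrite mul0r subr0 -expr2 ger0_norm// exprn_ge0// ltW.
by apply: scales_measure_affine; rewrite mul0r subr0 -expr2 expf_neq0// gt_eqF.
Qed.

(** Change of variables, differentiated at time zero. Over the points that remain in [D], the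
    displaced [psi] integrates to at most [(1 - t l)^-2] times the integral of [psi], whence the
    term [2 l]; the mass on points that leave [D] contributes [B]. Dominated convergence identifies
    the left side. *)
Lemma flux (psi G : R * R -> R) (l B t0 K : R) c : 0 <= l -> 0 < t0 ->
  measurable_fun [set: R2] (psi : R2 -> R) -> bm D psi ->
  (forall x, D x -> 0 <= psi x) -> bm D G ->
  (forall x t, D x -> 0 < t <= t0 -> D (mv x t (field l c x)) ->
    `|psi (mv x t (field l c x)) - psi x| <= K * t) ->
  ae_in D (fun x => forall s, 0 < s ->
    (psi (mv x (s / n.+1%:R) (field l c x)) - psi x) / (s / n.+1%:R) @[n --> \oo] --> G x) ->
  (forall t, 0 < t <= t0 ->
    II D (fun x => \1_((fun x => mv x t (field l c x)) @^-1` (~` D) : set R2) x * psi x) <= t * B) ->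
  II D G <= 2 * l * II D psi + B.
Proof.
move=> l0 t00 mpsi bpsi psi0 bG hK hlim hexit.
(* This keeps [t_ n * l] below [1/2], where the Jacobian factor has the quadratic bound [h3]. *)
pose s := Num.min t0 (2^-1 / (l + 1)).
have l1 : 0 < l + 1 by lra.
have s0 : 0 < s by rewrite lt_min t00 divr_gt0// invr_gt0.
have [st0 sl] : s <= t0 /\ s * (l + 1) <= 2^-1.
  by split; [rewrite ge_min lexx|rewrite -ler_pdivlMr// ge_min lexx orbT].
pose t_ n : R := s / n.+1%:R.
have t_0 n : 0 < t_ n by rewrite divr_gt0.
have t_s n : t_ n <= s by rewrite ler_pdivrMr// ler_peMr ?ler1n// ltW.
have tt0 n : 0 < t_ n <= t0 by rewrite t_0/=; exact: le_trans (t_s n) st0.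
pose T n (x : R2) : R2 := mv x (t_ n) (field l c x).
have z2 n : t_ n * l <= 2^-1.
  by have := t_0 n; have := t_s n; nra.
have sT n : scales_measure ((1 - t_ n * l) ^- 2) (T n).
  by apply: field_scales; have := z2 n; lra.
have mT n : measurable_fun setT (T n) by have [] := sT n.
have mTD n (A : set R2) : measurable A -> measurable (T n @^-1` A).
  by move=> mA; rewrite -[X in measurable X]setTI; exact: mT.
pose E n x : R := \1_(T n @^-1` (D : set R2)) x.
pose a n x : R := (E n x * psi (T n x) - E n x * psi x) / t_ n.
have [M hM] := bpsi.2.
have bEpsiT n : bm D (fun x => E n x * psi (T n x)).
  split.
    apply: measurable_funTS; apply: measurable_funM.
      by apply: measurable_indic; exact: mTD.
    exact: measurableT_comp.
  exists `|M| => x Dx; rewrite /E indicE; have [TD|TD] := pselect (D (T n x)); last first.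
    by rewrite memNset// mul0r normr0.
  by rewrite mem_set// mul1r; apply: le_trans (ler_norm M); exact: hM.
have bE n : bm D (E n) by apply: bm_indic => //; exact: mTD.
have bEpsi n : bm D (fun x => E n x * psi x) by exact: bmM.
have aE n : II D (a n) = (II D (fun x => E n x * psi (T n x)) - II D (fun x => E n x * psi x)) / t_ n.
  rewrite -IIB// mulrC -IIZ//; last exact: bmB.
  by congr II; apply/funext => x; rewrite /a mulrC.
have ub n : II D (a n) <= 2 * l * II D psi + B + 12 * l ^+ 2 * II D psi * t_ n.
  rewrite aE ler_pdivrMr//.
  have z0 : 0 <= t_ n * l by rewrite mulr_ge0// ltW.
  have I0 : 0 <= II D psi by exact: Rintegral_ge0.
  have h1 : II D (fun x => E n x * psi (T n x)) <= (1 - t_ n * l) ^- 2 * II D psi.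
    by apply: II_scales => //; rewrite invr_ge0 exprn_ge0//; have := z2 n; lra.
  have h2 : II D psi - II D (fun x => E n x * psi x) <= t_ n * B.
    apply: le_trans (hexit _ (tt0 n)); rewrite -IIB// le_eqVlt; apply/orP; left; apply/eqP.
    congr II; apply/funext => x.
    rewrite /E preimage_setC !indicE in_setC; case: (x \in _) => /=; ring.
  have h3 : (1 - t_ n * l) ^- 2 <= 1 + 2 * (t_ n * l) + 12 * (t_ n * l) ^+ 2.
    move: z0 (z2 n); move: (t_ n * l) => z z0 zz2.
    have d0 : 0 < (1 - z) ^+ 2 by rewrite exprn_gt0//; lra.
    rewrite -[leLHS]mul1r ler_pdivrMr//.
    rewrite -subr_ge0 (_ : _ - _ = z ^+ 2 * (1 + (1 - 2 * z) * (8 - 6 * z))); last by ring.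
    by rewrite mulr_ge0 ?sqr_ge0// addr_ge0// mulr_ge0//; lra.
  have h4 := ler_wpM2r I0 h3.
  have -> : (2 * l * II D psi + B + 12 * l ^+ 2 * II D psi * t_ n) * t_ n =
     (1 + 2 * (t_ n * l) + 12 * (t_ n * l) ^+ 2) * II D psi - II D psi + t_ n * B by ring.
  lra.
have cvga : II D (a n) @[n --> \oo] --> II D G.
  apply: (@II_dct _ _ mD fD a G `|K|) => //.
  - move=> n; apply: measurable_funM => //; apply: measurable_funB.
      by have [] := bEpsiT n.
    by have [] := bEpsi n.
  - move=> n x Dx; rewrite /a /E indicE; have [TD|TD] := pselect (D (T n x)); last first.
      by rewrite memNset// !mul0r subrr mul0r normr0.
    rewrite mem_set// !mul1r normrM normfV (gtr0_norm (t_0 n)) ler_pdivrMr//.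
    apply: le_trans (hK _ _ Dx (tt0 n) TD) _.
    by apply: ler_wpM2r; [exact: ltW|exact: ler_norm].
  - apply: (ae_inS hlim) => x Dx /(_ _ s0) h.
    have [r r0 hr] := open_mv (field l c x) oD Dx.
    apply: cvg_trans h; apply: near_eq_cvg.
    near=> n.
    have tr : t_ n < r.
      by near: n; move/cvgrPdist_lt : (cvg_harm s) => /(_ _ r0); apply: filterS => n; rewrite sub0r normrN gtr0_norm// t_0.
    rewrite /a /E indicE mem_set ?mul1r//.
    by apply: hr; rewrite gtr0_norm// ltW.
apply: (le_lim_nat cvga) ub.
rewrite -[X in _ --> X]addr0; apply: cvgD; first exact: cvg_cst.
rewrite -[X in _ --> X](mulr0 (12 * l ^+ 2 * II D psi)); apply: cvgMl_tmp.
exact: cvg_harm.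
Unshelve. all: by end_near.
Qed.

End domain.
End flux.

Section regular_functions.
Context {R : realType}.
Local Notation R2 := (measurableTypeR R * measurableTypeR R)%type.
Implicit Types (A D : set (R * R)) (f g w u : R * R -> R) (x y z e v p q : R * R)
  (df dg : R * R -> R * R).

Lemma closure_cb D x z (t : R) : open D -> cset D -> D x -> closure D z ->
  0 <= t < 1 -> D (cb t x z).
Proof.
move=> oD cD Dx cz /andP[t0 t1].
have [r r0 hr] := (openP D).1 oD _ Dx.
have t1' : 0 < 1 - t by lra.
have [y Dy [zy1 zy2]] := (closureP D z).1 cz _ (mulr_gt0 r0 t1').
(* A small shift of [x] compensates for replacing [z] by a nearby point [y] of [D]. *)
pose x' : R * R := (x.1 + t / (1 - t) * (z.1 - y.1), x.2 + t / (1 - t) * (z.2 - y.2)).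
have -> : cb t x z = cb t x' y.
  by rewrite /cb /=; congr pair; field; rewrite gt_eqF.
apply: cD => //; last by rewrite t0 ltW.
have bnd (a : R) : `|a| < r * (1 - t) -> `|t / (1 - t) * a| < r.
  move=> h; rewrite normrM ger0_norm ?divr_ge0 ?(ltW t1')//.
  rewrite mulrAC ltr_pdivrMr//; have := normr_ge0 a; nra.
by apply: hr; split; rewrite /= addrC addKr; apply: bnd; rewrite distrC.
Qed.

Lemma cb_field x z (t : R) : mv x t (field 1 z x) = cb t x z.
Proof. by rewrite /mv /cb /field /=; congr pair; ring. Qed.

(** Directional derivatives along the sequences used in [flux]; differences and products then reduce
    to limits of sequences. *)
Definition has_dir f df x := forall v (s : R), 0 < s ->
  (f (mv x (s / n.+1%:R) v) - f x) / (s / n.+1%:R) @[n --> \oo] --> dot (df x) v.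

Definition reg D f df := [/\ measurable_fun [set: R2] (f : R2 -> R), bm D f,
  bm D (fun x => (df x).1) /\ bm D (fun x => (df x).2),
  exists K, forall x y, D x -> D y -> `|f x - f y| <= K * norm1 (vs x y) &
  ae_in D (has_dir f df)].

Section on_domain.
Variable D : set (R * R).
Hypotheses (oD : open D) (cD : cset D) (bD : bounded_set D).

Let mD : measurable (D : set R2).
Proof. exact: open_plane_measurable. Qed.

Let fD := bounded_measure oD bD.

Lemma dif_has_dir f df x : dif f x (df x) -> has_dir f df x.
Proof. by move=> h v s s0; exact: dif_dir_harm. Qed.

Lemma lipc_reg M f : lipc M f -> reg D f (gd f).
Proof.
move=> lf; have [_ _ lip_f] := lf; split.
- exact: lip_measurable lip_f.
- exact: lipc_bm lf.
- exact: gd_bm lf.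
- by exists M => x y _ _; exact: lip_abs.
- by apply: (ae_inS (lipc_ae_dif D lf)) => x _; exact: dif_has_dir.
Qed.

Lemma regB f df g dg : reg D f df -> reg D g dg ->
  reg D (fun x => f x - g x) (fun x => vs (df x) (dg x)).
Proof.
move=> [mf bf [bf1 bf2] [K hK] af] [mg bg [bg1 bg2] [L hL] ag]; split.
- exact: measurable_funB.
- exact: bmB.
- by split; apply: bmB.
- exists (K + L) => x y Dx Dy.
  rewrite (_ : _ - _ = (f x - f y) - (g x - g y)); last by ring.
  by apply: le_trans (ler_normB _ _) _; rewrite mulrDl lerD// ?hK ?hL.
- apply: (ae_in2 af ag) => x Dx hf hg v s s0.
  rewrite (_ : dot _ v = dot (df x) v - dot (dg x) v); last by rewrite /dot /vs /=; ring.
  rewrite (_ : (fun n => _) = (fun n => (f (mv x (s / n.+1%:R) v) - f x) / (s / n.+1%:R) -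
     (g (mv x (s / n.+1%:R) v) - g x) / (s / n.+1%:R))); last first.
    by apply/funext => n; rewrite -mulrBl; congr (_ * _); ring.
  by apply: cvgB; [exact: hf|exact: hg].
Qed.

Lemma has_dir_continuous f df x v (s : R) : 0 < s -> has_dir f df x ->
  f (mv x (s / n.+1%:R) v) @[n --> \oo] --> f x.
Proof.
move=> s0 h.
have := cvgD (cvgM (h v _ s0) (cvg_harm s)) (cvg_cst (f x)).
rewrite mulr0 add0r => H.
suff -> : (fun n => f (mv x (s / n.+1%:R) v)) = (fun n =>
    (f (mv x (s / n.+1%:R) v) - f x) / (s / n.+1%:R) * (s / n.+1%:R) + f x) by exact: H.
by apply/funext => n; rewrite mulfVK ?subrK// mulf_neq0 ?gt_eqF ?invr_gt0.
Qed.

Lemma regM f df g dg : reg D f df -> reg D g dg ->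
  reg D (fun x => f x * g x)
    (fun x => (f x * (dg x).1 + g x * (df x).1, f x * (dg x).2 + g x * (df x).2)).
Proof.
move=> [mf bf [bf1 bf2] [K hK] af] [mg bg [bg1 bg2] [L hL] ag]; split.
- exact: measurable_funM.
- exact: bmM.
- by split; apply: bmD; apply: bmM.
- have [_ [M hM]] := bf; have [_ [N hN]] := bg.
  exists (`|M| * L + `|N| * K) => x y Dx Dy.
  rewrite (_ : _ - _ = f x * (g x - g y) + g y * (f x - f y)); last by ring.
  apply: le_trans (ler_normD _ _) _; rewrite !normrM mulrDl -!mulrA.
  apply: lerD; apply: ler_pM => //; rewrite ?hK ?hL//.
    by apply: le_trans (hM _ Dx) (ler_norm _).
  by apply: le_trans (hN _ Dy) (ler_norm _).
- apply: (ae_in2 af ag) => x Dx hf hg v s s0.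
  rewrite (_ : dot _ v = f x * dot (dg x) v + g x * dot (df x) v); last first.
    by rewrite /dot /=; ring.
  rewrite (_ : (fun n => _) = (fun n =>
     f (mv x (s / n.+1%:R) v) * ((g (mv x (s / n.+1%:R) v) - g x) / (s / n.+1%:R)) +
     g x * ((f (mv x (s / n.+1%:R) v) - f x) / (s / n.+1%:R)))); last first.
    by apply/funext => n; rewrite !mulrA -mulrDl; congr (_ * _); ring.
  apply: cvgD.
    by apply: cvgM; [exact: has_dir_continuous hf|exact: hg].
  by apply: cvgM; [exact: cvg_cst|exact: hf].
Qed.

Lemma bm_field (l : R) c : bm D (fun x => (field l c x).1) /\ bm D (fun x => (field l c x).2).
Proof.
split; apply: bmB => //; (try exact: bm_cst); apply: bmZ => //.
  exact: bm_fst.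
exact: bm_snd.
Qed.

Lemma bm_dot df dg : bm D (fun x => (df x).1) -> bm D (fun x => (df x).2) ->
  bm D (fun x => (dg x).1) -> bm D (fun x => (dg x).2) ->
  bm D (fun x => dot (df x) (dg x)).
Proof. by move=> *; apply: bmD; apply: bmM. Qed.

Lemma flux_reg (psi : R * R -> R) dpsi (l B t0 : R) c : 0 <= l -> 0 < t0 ->
  reg D psi dpsi -> (forall x, D x -> 0 <= psi x) ->
  (forall t, 0 < t <= t0 ->
    II D (fun x => \1_((fun x => mv x t (field l c x)) @^-1` (~` D) : set R2) x * psi x) <= t * B) ->
  II D (fun x => dot (dpsi x) (field l c x)) <= 2 * l * II D psi + B.
Proof.
move=> l0 t00 [mf bf [bf1 bf2] [K hK] af] psi0 he.
have [bv1 bv2] := bm_field l c.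
have [_ [N1 hN1]] := bv1; have [_ [N2 hN2]] := bv2.
apply: (flux oD bD (K := `|K| * (N1 + N2)) l0 t00 mf bf psi0 _ _ _ he).
- exact: bm_dot.
- move=> x t Dx /andP[tp _] DT.
  apply: le_trans (hK _ _ DT Dx) _; rewrite -mulrA.
  apply: le_trans (ler_wpM2r (norm1_ge0 _) (ler_norm K)) _; apply: ler_wpM2l => //.
  rewrite /norm1 /vs /mv /= !(addrC _ (t * _)) !addrK !normrM (gtr0_norm tp) -mulrDr mulrC.
  by rewrite ler_wpM2r ?(ltW tp)//; apply: lerD; [exact: hN1|exact: hN2].
- by apply: (ae_inS af) => x Dx h s s0; exact: h.
Qed.

(** Contracting a convex open set towards a point of its closure keeps it inside itself, so nothing
    exits. The factor 2 is the dimension. *)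
Lemma star_flux (psi : R * R -> R) dpsi z : closure D z ->
  reg D psi dpsi -> (forall x, D x -> 0 <= psi x) ->
  II D (fun x => dot (dpsi x) (vs z x)) <= 2 * II D psi.
Proof.
move=> cz rpsi psi0.
have h2 : 0 < 2^-1 :> R by rewrite invr_gt0.
have := flux_reg (B := 0) (c := z) ler01 h2 rpsi psi0.
rewrite mulr1 addr0 (_ : (fun x => dot (dpsi x) (field 1 z x)) =
  (fun x => dot (dpsi x) (vs z x))); last first.
  by apply/funext => x; rewrite /field /vs !mul1r.
apply => t /andP[t0 t1]; rewrite mulr0.
apply: le_trans (_ : II D (fun=> 0) <= 0); last by rewrite (II_cst mD) mul0r.
rewrite le_eqVlt; apply/orP; left; apply/eqP; apply: eq_Rintegral => x /set_mem Dx.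
rewrite indicE memNset ?mul0r//= => nD; apply: nD; rewrite cb_field.
by apply: closure_cb => //; apply/andP; split; lra.
Qed.

End on_domain.
End regular_functions.

(** * Raising the minimizer by a plane *)

Section raising.
Context {R : realType}.
Local Notation R2 := (measurableTypeR R * measurableTypeR R)%type.
Implicit Types (A : set (R * R)) (f g w : R * R -> R) (x y z e v p q : R * R).

Definition minimizes (D : set (R * R)) u := forall w N, lipc N w ->
  (forall x, D x -> 0 <= w x) -> II D (fcost u) <= II D (fcost w).

Lemma le_max_l (a b : R) : a <= Num.max a b.
Proof. by rewrite le_max lexx. Qed.

Lemma le_max_r (a b : R) : b <= Num.max a b.
Proof. by rewrite le_max lexx orbT. Qed.

Lemma pl_dif (a : R * R * R) x : dif (pl a) x a.1.
Proof.
move=> k k0; exists 1 => // y _.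
rewrite (_ : _ - _ - _ = 0); last by rewrite (pl_vs a x y); ring.
by rewrite normr0 mulr_ge0 ?norm1_ge0// ltW.
Qed.

Lemma ae_gd_plane M f (b : R * R * R) (A : set (R * R)) : lipc M f -> (forall y, pl b y <= f y) ->
  ae_in A (fun x => pl b x = f x -> gd f x = b.1).
Proof.
move=> lf bf; apply: (ae_inS (lipc_ae_dif A lf)) => x _ df e.
by apply/esym; apply: (dif_touch (pl_dif b x) df ltr01).
Qed.

Variables (D : set (R * R)) (u : R * R -> R) (M : R) (x0 k : R * R) (hgt : R).
Hypotheses (oD : open D) (cD : cset D) (bD : bounded_set D).
Hypotheses (lu : lipc M u) (u0 : forall x, 0 <= u x) (mu_ : minimizes D u).
Hypotheses (cx0 : closure D x0) (hgt0 : 0 < hgt)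
  (below : forall x, D x -> u x0 + dot k (vs x x0) <= u x).

Let mD : measurable (D : set R2).
Proof. exact: open_plane_measurable. Qed.

Let fD := bounded_measure oD bD.

Definition raise_pl : R * R * R := (k, u x0 + hgt - dot k x0).
Local Notation a := raise_pl.

Definition raise_top x := Num.max (u x) (pl a x).
Local Notation w := raise_top.

Definition raise x := w x - u x.
Local Notation phi := raise.

Definition draise x := vs (gd w x) (gd u x).
Arguments draise : simpl never.
Local Notation dphi := draise.

Lemma raise_plE x : pl a x = u x0 + dot k (vs x x0) + hgt.
Proof. by rewrite /pl /raise_pl /dot /vs /=; ring. Qed.

Lemma lipc_raise_top : exists N, lipc N w.
Proof.
exists (Num.max M (Num.max `|k.1| `|k.2|)); apply: lipc_max.
  by apply: lipcS lu; rewrite le_max lexx.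
by apply: pl_lipc; split; rewrite !le_max lexx ?orbT.
Qed.

Lemma raise_ge0 x : 0 <= phi x.
Proof. by rewrite subr_ge0 le_max lexx. Qed.

Lemma raise_ge x : pl a x - u x <= phi x.
Proof. by rewrite lerD2r le_max lexx orbT. Qed.

Lemma raise_le x : D x -> phi x <= hgt.
Proof.
move=> Dx; rewrite lerBlDl ge_max raise_plE; have := below Dx.
by have t0 := hgt0; move=> h; apply/andP; split; lra.
Qed.

Lemma raise_gt0 x : 0 < phi x -> w x = pl a x /\ phi x = pl a x - u x.
Proof.
rewrite /raise /raise_top; case: (leP (u x) (pl a x)) => // _.
by rewrite subrr ltxx.
Qed.

Lemma raise_reg : reg D phi dphi.
Proof.
by have [N lw] := lipc_raise_top; apply: regB => //; [exact: lipc_reg lw|exact: lipc_reg lu].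
Qed.

Lemma bm_raise : bm D phi. Proof. by have [] := raise_reg. Qed.

Lemma bm_draise : bm D (fun x => (dphi x).1) /\ bm D (fun x => (dphi x).2).
Proof. by have [] := raise_reg. Qed.

(** Where [phi] is positive it equals the concave function [pl a - u], which lies below its tangent;
    elsewhere [u] touches the maximum from below and the gradients agree. *)
Lemma raise_dichotomy : ae_in D (fun x =>
  (phi x = 0 /\ dphi x = (0, 0)) \/
  [/\ 0 < phi x, gd w x = k &
      forall y, pl a y - u y <= phi x + dot (dphi x) (vs y x)]).
Proof.
have [N lw] := lipc_raise_top.
apply: (ae_in3 (lipc_ae_dif D lw) (lipc_ae_dif D lu)
  (ae_gd_plane D (b := a) lw _)) => [y|x Dx dw du ga].
  by rewrite le_max lexx orbT.
have := raise_ge0 x; rewrite le_eqVlt => /predU1P[/esym p0|p0].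
  left; split => //; rewrite /draise.
  have wu : w x = u x by apply/eqP; rewrite -subr_eq0 -/(phi x) p0.
  have -> : gd w x = gd u x.
    apply/esym; apply: (dif_touch du dw ltr01) => // y _.
    by rewrite le_max lexx.
  by rewrite /vs !subrr.
right; have [wa pa] := raise_gt0 p0; rewrite /draise ga//; split => // y.
have [_ cu _] := lu.
have := dif_subgradient cu (I : setT x) (I : setT y) du.
by rewrite pa (pl_vs a x y) /dot /vs /=; lra.
Qed.

Definition sraise := II D (fun x => \1_([set x | 0 < phi x] : set R2) x).
Local Notation s := sraise.

Lemma raise_continuous y : 0 < phi y -> exists2 r : R, 0 < r & forall x, near_pt y r x -> 0 < phi x.
Proof.
move=> p0; have [N [_ _ lw]] := lipc_raise_top; have [_ _ lipu] := lu.
suff oU : open [set x | 0 < phi x] by exact: (openP _).1 oU _ p0.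
apply: (@lip_open _ (N + M)) => x z.
rewrite (_ : _ - _ = (w x - w z) + (u z - u x)); last by rewrite /raise; ring.
by rewrite mulrDl lerD// norm1_vsC; exact: lipu.
Qed.

Lemma measurable_raise_set : measurable ([set x | 0 < phi x] : set R2).
Proof.
apply: open_plane_measurable; apply/openP => x; exact: raise_continuous.
Qed.

Lemma bm_raise_indic : bm D (fun x => \1_([set x | 0 < phi x] : set R2) x).
Proof. by apply: bm_indic => //; exact: measurable_raise_set. Qed.

Lemma raise_x0 : phi x0 = hgt.
Proof.
have e : pl a x0 - u x0 = hgt by rewrite raise_plE /dot /vs !subrr !mulr0; ring.
have p0 : 0 < phi x0 by apply: lt_le_trans (raise_ge x0); rewrite e.
by have [_ ->] := raise_gt0 p0.
Qed.

Lemma indic_raise x : \1_([set x | 0 < phi x] : set R2) x = (if 0 < phi x then 1 else 0) :> R.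
Proof. by rewrite indicE; case: ifP => h; [rewrite mem_set|rewrite memNset//= h]. Qed.

Lemma sraise_gt0 : 0 < s.
Proof.
rewrite /sraise (II_indic mD); last exact: measurable_raise_set.
rewrite fine_gt0//; apply/andP; split; last first.
  apply: le_lt_trans fD; apply: le_measure; rewrite ?inE//.
  by apply: measurableI => //; exact: measurable_raise_set.
have p0 : 0 < phi x0 by rewrite raise_x0.
have [r r0 hr] := raise_continuous p0.
have [y Dy xy] := (closureP D x0).1 cx0 _ r0.
apply: open_measure_gt0; last by exists y; split => //; exact: hr.
by apply: openI => //; apply/openP => x; exact: raise_continuous.
Qed.

Lemma bm_dotr c : bm D (fun x => dot (dphi x) c).
Proof. by have [b1 b2] := bm_draise; apply: bm_dot => //; apply: bm_cst. Qed.

Lemma bm_dotv y : bm D (fun x => dot (dphi x) (vs y x)).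
Proof.
have [b1 b2] := bm_draise; apply: bm_dot => //; apply: bmB => //; try exact: bm_cst.
  exact: bm_fst.
exact: bm_snd.
Qed.

(** The volume of a cone of height [hgt] is a third of height times base. Concavity gives
    [hgt <= phi + Dphi . (x0 - x)] on the base, and [star_flux] bounds the second term by twice the
    mass. *)
Lemma raise_mass : hgt * s <= 3 * II D phi.
Proof.
have sf := star_flux oD cD bD cx0 raise_reg (fun x _ => raise_ge0 x).
rewrite -(IIZ mD fD _ bm_raise_indic).
apply: le_trans (_ : II D (fun x => phi x + dot (dphi x) (vs x0 x)) <= _).
  apply: II_le_ae => //; [exact: bmZ bm_raise_indic|exact: bmD bm_raise (bm_dotv _)|].
  apply: (ae_inS raise_dichotomy) => x Dx; rewrite indic_raise.
  move=> [[-> ->]|[-> _ /(_ x0)]].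
    by rewrite ltxx /dot /= !mul0r mulr0 !addr0.
  by rewrite mulr1 raise_plE /dot /vs !subrr !mulr0; lra.
rewrite IID//; [lra|exact: bm_raise|exact: bm_dotv].
Qed.

Lemma raise_le_mass : II D phi <= hgt * s.
Proof.
rewrite -(IIZ mD fD _ bm_raise_indic).
apply: II_le_ae => //; [exact: bm_raise|exact: bmZ bm_raise_indic|].
apply: ae_inT => x Dx; rewrite indic_raise; case: ltP => h.
  by rewrite mulr1; exact: raise_le.
by rewrite mulr0.
Qed.

Definition energy := II D (fun x => sqnorm (dphi x)).

Lemma bm_sqnorm : bm D (fun x => sqnorm (dphi x)).
Proof.
have [b1 b2] := bm_draise; have := bmD (bmM b1 b1) (bmM b2 b2).
by rewrite (_ : (fun x => _) = (fun x => sqnorm (dphi x)))//.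
Qed.

(** Where [phi] is positive, the slope of the competitor is [k] and the density changes by
    [Dphi . (k - x) - |Dphi|^2 / 2 + phi]. Splitting [k - x] at [x0] leaves a flux towards [x0], at
    most twice the mass. *)
Lemma raise_energy : 2^-1 * energy <= II D (fun x => dot (dphi x) (vs k x0)) + 3 * II D phi.
Proof.
have sf := star_flux oD cD bD cx0 raise_reg (fun x _ => raise_ge0 x).
have [N lw] := lipc_raise_top.
have w0 x : D x -> 0 <= w x by move=> _; rewrite le_max u0.
have := mu_ lw w0.
have bu : bm D (fcost u) := bm_fcost bD lu.
have bw : bm D (fcost w) := bm_fcost bD lw.
have b1 := bm_dotr (vs k x0); have b2 := bm_dotv x0; have b3 := bmZ 2^-1 bm_sqnorm.
have b12 := bmD b1 b2.
rewrite -subr_ge0 -IIB//.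
have -> : II D (fun x => fcost w x - fcost u x) =
    II D (fun x => (dot (dphi x) (vs k x0) + dot (dphi x) (vs x0 x)) - 2^-1 * sqnorm (dphi x) + phi x).
  apply: II_eq_ae => //.
  - exact: bmB.
  - by apply: bmD bm_raise; apply: bmB.
  apply: (ae_inS raise_dichotomy) => x Dx.
  move=> [[p0 d0]|[_ E _]].
    have wu : w x = u x by apply/eqP; rewrite -subr_eq0 -/(phi x) p0.
    have gg : gd w x = gd u x.
      move: d0; rewrite /draise /vs; move: (gd w x) (gd u x) => [g1 g2] [g3 g4] /= [].
      by move=> /eqP; rewrite subr_eq0 => /eqP -> /eqP; rewrite subr_eq0 => /eqP ->.
    by rewrite /fcost d0 p0 wu gg subrr /dot /sqnorm /=; ring.
  rewrite /fcost /draise /raise E; move: (gd u x) (w x) (u x) => g c d.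
  by rewrite /cost /sqnorm /dot /vs /=; field.
rewrite (IID mD fD) //; [|by apply: bmB|exact: bm_raise].
rewrite (IIB mD fD)// (IID mD fD)// (IIZ mD fD); last exact: bm_sqnorm.
by rewrite /energy; lra.
Qed.

(** Since [phi] is concave on its support and maximal at [x0], [Dphi . (x0 - x)] is nonnegative
    there. Hence [z - x0] may be replaced by [z - x], and [star_flux] applies at [z]. *)
Lemma flux_pos z (b : R) : closure D z -> 0 <= b ->
  II D (fun x => dot (dphi x) (b * (z.1 - x0.1), b * (z.2 - x0.2))) <= 2 * b * II D phi.
Proof.
move=> cz b0.
have sf := star_flux oD cD bD cz raise_reg (fun x _ => raise_ge0 x).
apply: le_trans (_ : II D (fun x => b * dot (dphi x) (vs z x)) <= _); last first.
  by rewrite (IIZ mD fD)//; [nra|exact: bm_dotv].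
apply: II_le_ae => //; [exact: bm_dotr|exact: bmZ (bm_dotv _)|].
apply: (ae_inS raise_dichotomy) => x Dx [[_ ->]|[_ _ /(_ x0)]].
  by rewrite /dot /= !mul0r !addr0 mulr0.
rewrite raise_plE => h.
have := raise_le Dx => h2.
have h3 : 0 <= dot (dphi x) (vs x0 x).
  by move: h; rewrite /dot /vs !subrr !mulr0 /=; lra.
rewrite -subr_ge0 (_ : _ - _ = b * dot (dphi x) (vs x0 x)); first exact: mulr_ge0.
by rewrite /dot /vs /=; ring.
Qed.

(** The direction away from [z] is also controlled if [u] is within [c] of the supporting plane at
    [z]: concavity then gives [Dphi . (z - x) + c >= 0], and [star_flux] applies at [x0]. *)
Lemma flux_neg z (b c : R) : closure D z -> 0 <= b -> u z - (u x0 + dot k (vs z x0)) <= c ->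
  II D (fun x => dot (dphi x) (b * (x0.1 - z.1), b * (x0.2 - z.2))) <=
    b * (2 * II D phi + c * s).
Proof.
move=> cz b0 hc.
have sf := star_flux oD cD bD cx0 raise_reg (fun x _ => raise_ge0 x).
apply: le_trans (_ : II D (fun x => b * (dot (dphi x) (vs x0 x) +
    c * \1_([set x | 0 < phi x] : set R2) x)) <= _); last first.
  rewrite (IIZ mD fD); last exact: bmD (bm_dotv _) (bmZ _ bm_raise_indic).
  rewrite (IID mD fD); [|exact: bm_dotv|exact: bmZ bm_raise_indic].
  rewrite (IIZ mD fD); last exact: bm_raise_indic.
  by apply: ler_wpM2l => //; rewrite lerD2r.
apply: II_le_ae => //; [exact: bm_dotr| |].
  by apply: bmZ; exact: bmD (bm_dotv _) (bmZ _ bm_raise_indic).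
apply: (ae_inS raise_dichotomy) => x Dx; rewrite indic_raise => -[[-> ->]|[-> _ /(_ z)]].
  by rewrite ltxx /dot /= !mul0r !addr0 !mulr0 addr0 mulr0.
rewrite raise_plE mulr1 => h.
have := raise_le Dx => h2.
have h3 : 0 <= dot (dphi x) (vs z x) + c by lra.
rewrite -subr_ge0 (_ : _ - _ = b * (dot (dphi x) (vs z x) + c)); first exact: mulr_ge0.
by rewrite /dot /vs /=; ring.
Qed.

Definition slope_mass := II D (fun x => norm1 (dphi x)).

Lemma bm_norm1 : bm D (fun x => norm1 (dphi x)).
Proof. by have [b1 b2] := bm_draise; apply: bmD; apply: bm_norm. Qed.

Lemma bm_pos_part (b : R * R * R) : bm D (fun x => \1_([set x | 0 < pl b x] : set R2) x * phi x).
Proof.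
apply: bmM; last exact: bm_raise.
apply: bm_indic => //; apply: open_plane_measurable.
have [_ _ lb] := @pl_lipc R (Num.max `|b.1.1| `|b.1.2|) b
  (conj (le_max_l _ _) (le_max_r _ _)).
exact: lip_open lb.
Qed.

(** [star_flux] for the product of [phi] with the positive part of [pl b]. From the strip to [z] the
    weight grows by at least [pl b z - eta], while on the strip it is at most [eta]; the other
    [2 * eta] come from the right side of [star_flux]. *)
Lemma raise_thin (b : R * R * R) z (eta C : R) : 0 <= eta ->
  (forall x, D x -> 0 < phi x -> `|pl b x| <= eta) -> closure D z ->
  (forall x, D x -> `|z.1 - x.1| <= C /\ `|z.2 - x.2| <= C) ->
  (pl b z - 3 * eta) * II D (fun x => \1_([set x | 0 < pl b x] : set R2) x * phi x)
    <= eta * C * slope_mass.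
Proof.
move=> eta0 hb cz hC.
pose zero : R * R * R := ((0, 0), 0).
have zeroE x : pl zero x = 0 by rewrite /pl /dot /= !mul0r !addr0.
pose dp x := Num.max (pl b x) (pl zero x).
pose N := Num.max `|b.1.1| `|b.1.2|.
have ldp : lipc N dp.
  apply: lipc_max; apply: pl_lipc; split; rewrite /N !le_max ?lexx ?orbT//= normr0.
    by rewrite normr_ge0.
  by rewrite normr_ge0.
have ga := ae_gd_plane (b := b) D ldp (fun y => le_max_l _ _).
have g0 := ae_gd_plane (b := zero) D ldp (fun y => le_max_r _ _).
have rpsi := regM (lipc_reg bD ldp) raise_reg.
have psi0 x : D x -> 0 <= dp x * phi x.
  by move=> _; rewrite mulr_ge0 ?raise_ge0// /dp zeroE le_max lexx orbT.
have := star_flux oD cD bD cz rpsi psi0.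
have bpsi : bm D (fun x => dp x * phi x) by have [] := rpsi.
set G := (fun x => dot _ (vs z x)) => sf.
have bG : bm D G.
  have [_ _ [b1 b2] _ _] := rpsi; apply: bm_dot => //; apply: bmB => //; try exact: bm_cst.
    exact: bm_fst.
  exact: bm_snd.
rewrite -subr_ge0 in sf; rewrite -subr_ge0; apply: le_trans sf _.
rewrite -(IIZ mD fD _ bm_norm1) -(IIZ mD fD _ (bm_pos_part b)) -(IIZ mD fD _ bpsi).
rewrite -!(IIB mD fD); [|exact: bmZ bm_norm1|exact: bmZ (bm_pos_part b)|exact: bmZ bpsi|exact: bG].
apply: II_le_ae => //; try by apply: bmB => //; apply: bmZ.
  by apply: bmB; apply: bmZ; [exact: bm_norm1|exact: bm_pos_part].
apply: (ae_in3 raise_dichotomy ga g0) => x Dx hd hb' h0'.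
rewrite /G; set g := gd dp x.
have [C1 C2] := hC _ Dx.
rewrite (_ : dot _ _ = dp x * dot (dphi x) (vs z x) + phi x * dot g (vs z x)); last first.
  by rewrite /dot /vs /=; ring.
case: hd => [[p0 d0]|[p0 _ _]].
  by rewrite p0 d0 /dot /norm1 /= normr0; lra.
have dC : - (C * norm1 (dphi x)) <= dot (dphi x) (vs z x).
  rewrite lerNl -[- _]/(- (_ + _)) opprD -!mulrN /norm1 mulrDr.
  apply: lerD; apply: le_trans (ler_norm _) _; rewrite normrM normrN mulrC ler_wpM2r//.
have n0 := norm1_ge0 (dphi x).
have C0 : 0 <= C by apply: le_trans C1.
have := hb _ Dx p0; rewrite ler_norml => /andP[_ dx].
rewrite indicE; have [bx|bx] := ltP 0 (pl b x).
  rewrite mem_set// mul1r.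
  have dE : dp x = pl b x by rewrite /dp zeroE; apply/max_idPl; exact: ltW.
  rewrite /g hb' ?dE// -(_ : pl b z - pl b x = dot b.1 (vs z x)); last by rewrite (pl_vs b x z); ring.
  have CN : 0 <= C * norm1 (dphi x) by exact: mulr_ge0.
  have e1 : pl b x * (C * norm1 (dphi x)) <= eta * (C * norm1 (dphi x)) by exact: ler_wpM2r.
  have e2 : pl b x * phi x <= eta * phi x by apply: ler_wpM2r => //; exact: ltW.
  have e3 := ler_wpM2l (ltW bx) dC.
  lra.
have dE : dp x = 0 by rewrite /dp zeroE; apply/max_idPr.
rewrite memNset /= ?ltNge ?bx// /g h0' ?dE ?zeroE//.
have := mulr_ge0 eta0 (mulr_ge0 C0 n0).
by rewrite /dot /=; lra.
Qed.

Definition opp_pl (b : R * R * R) : R * R * R := (opv b.1, - b.2).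

Lemma opp_plE b x : pl (opp_pl b) x = - pl b x.
Proof. by rewrite /pl /opp_pl /opv /dot /=; ring. Qed.

(** On the line [pl b = 0] the maximum of [pl b] and its opposite would have two different
    gradients, whereas it is differentiable almost everywhere. *)
Lemma ae_plane_neq0 (b : R * R * R) : b.1 != (0, 0) -> ae_in D (fun x => pl b x != 0).
Proof.
move=> b0; pose N := Num.max `|b.1.1| `|b.1.2|.
pose m x := Num.max (pl b x) (pl (opp_pl b) x).
have lm : lipc N m.
  by apply: lipc_max; apply: pl_lipc; split; rewrite /N /= ?normrN ?le_max_l ?le_max_r.
have g1 := ae_gd_plane (b := b) D lm (fun y => le_max_l _ _).
have g2 := ae_gd_plane (b := opp_pl b) D lm (fun y => le_max_r _ _).
apply: (ae_in2 g1 g2) => x Dx h1 h2; apply/eqP => bx.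
have mx : m x = 0 by rewrite /m opp_plE bx oppr0 maxxx.
move: h1 h2; rewrite mx opp_plE bx oppr0 => /(_ erefl) -> /(_ erefl) e.
case/eqP : b0; case: b e {lm g1 g2 bx mx m N} => -[b1 b2] b3 [e1 e2] /=.
by congr pair; lra.
Qed.

(** The two halves of the strip are treated by [raise_thin] with [b] and its opposite. *)
Lemma raise_thin2 (b : R * R * R) z z' (eta C d : R) : 0 <= eta -> b.1 != (0, 0) ->
  (forall x, D x -> 0 < phi x -> `|pl b x| <= eta) -> closure D z -> closure D z' ->
  (forall x y, D x -> closure D y -> `|y.1 - x.1| <= C /\ `|y.2 - x.2| <= C) ->
  d <= pl b z -> pl b z' <= - d ->
  (d - 3 * eta) * II D phi <= 2 * (eta * C) * slope_mass.
Proof.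
move=> eta0 b0 hb cz cz' hC dz dz'.
have h1 := raise_thin eta0 hb cz (fun x Dx => hC x z Dx cz).
have := @raise_thin (opp_pl b) z' eta C eta0 _ cz' (fun x Dx => hC x z' Dx cz').
have hb' x : D x -> 0 < phi x -> `|pl (opp_pl b) x| <= eta.
  by move=> Dx px; rewrite opp_plE normrN; exact: hb.
rewrite opp_plE => /(_ hb') h2.
set J1 := II D _ in h1; set J2 := II D _ in h2.
have J10 : 0 <= J1 by apply: Rintegral_ge0 => x _; rewrite mulr_ge0 ?raise_ge0.
have J20 : 0 <= J2 by apply: Rintegral_ge0 => x _; rewrite mulr_ge0 ?raise_ge0.
have -> : II D phi = J1 + J2.
  rewrite /J1 /J2 -(IID mD fD); [|exact: bm_pos_part..].
  apply: II_eq_ae => //; [exact: bm_raise|by apply: bmD; exact: bm_pos_part|].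
  apply: (ae_inS (ae_plane_neq0 b0)) => x Dx bx.
  rewrite !indicE; have [b1|b1|/eqP] := ltgtP 0 (pl b x); last by rewrite eq_sym (negPf bx).
    by rewrite mem_set// memNset ?mul1r ?mul0r ?addr0//= opp_plE => ?; lra.
  by rewrite memNset ?[_ \in _]mem_set ?mul1r ?mul0r ?add0r//= ?opp_plE; [lra|move=> ?; lra].
have := ler_wpM2r J10 (lerB dz (lexx (3 * eta))).
have : (d - 3 * eta) * J2 <= (- pl b z' - 3 * eta) * J2 by apply: ler_wpM2r => //; lra.
lra.
Qed.

(** The area [s] is bounded by itself: [hgt * s] by the mass, the mass by the slope, the slope by
    the energy and [s], the energy by [s]. Young's inequality with parameter [3 * A] makes the term
    in [s] alone come back with factor [1/2]; absorbing it gives the constant 36. *)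
Lemma raise_contra (A B : R) : 0 < A -> II D phi <= A * hgt * slope_mass ->
  II D (fun x => dot (dphi x) (vs k x0)) <= B * s -> 1 <= 36 * A ^+ 2 * (B + 3 * hgt).
Proof.
move=> A0 h1 h2; have t0 := hgt0.
have s0 := sraise_gt0; have e1 := raise_mass; have e2 := raise_le_mass; have e3 := raise_energy.
have e4 : energy <= 2 * (B + 3 * hgt) * s by lra.
have l0 : 0 < 3 * A by lra.
have e5 : slope_mass <= 3 * A * energy + (2 * (3 * A))^-1 * s.
  rewrite -(IIZ mD fD _ bm_sqnorm) -(IIZ mD fD _ bm_raise_indic) -(IID mD fD); last 2 first.
  - exact: bmZ bm_sqnorm.
  - exact: bmZ bm_raise_indic.
  apply: II_le_ae => //; [exact: bm_norm1| |].
    by apply: bmD; [exact: bmZ bm_sqnorm|exact: bmZ bm_raise_indic].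
  apply: (ae_inS raise_dichotomy) => x Dx; rewrite indic_raise => -[[-> ->]|[-> _ _]].
    by rewrite ltxx /norm1 /sqnorm /= normr0; lra.
  rewrite mulr1 /norm1 /sqnorm -(real_normK (num_real (dphi x).1)) -(real_normK (num_real (dphi x).2)).
  move: `|_| `|_| => p q; move: (3 * A) l0 => l l0.
  rewrite -subr_ge0 (_ : _ - _ = ((l * p - l * q) ^+ 2 + (l * (p + q) - 1) ^+ 2) / (2 * l)); last first.
    by field; rewrite gt_eqF.
  by rewrite divr_ge0 ?addr_ge0 ?sqr_ge0 ?mulr_ge0// ltW.
have e6 : 1 <= 3 * A * (3 * A * (2 * (B + 3 * hgt)) + (2 * (3 * A))^-1).
  have hs : 0 < hgt * s by exact: mulr_gt0.
  rewrite -(ler_pM2r hs) mul1r; apply: le_trans e1 _.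
  apply: le_trans (ler_wpM2l _ h1) _ => //.
  have := ler_wpM2l (ltW l0) e4 => e7.
  have := ler_wpM2l (mulr_ge0 (ltW l0) (ltW t0)) (le_trans e5 (lerD e7 (lexx _))).
  by move=> e8; apply: le_trans (_ : 3 * A * hgt * slope_mass <= _); [lra|apply: le_trans e8 _; lra].
have e7 : 3 * A * (2 * (3 * A))^-1 = 2^-1 by field; rewrite gt_eqF.
by move: e6; rewrite mulrDr e7; lra.
Qed.

End raising.

(** * Uniqueness of the subgradient at interior points *)

Section interior_points.
Context {R : realType}.
Implicit Types (A : set (R * R)) (f g w : R * R -> R) (x y z e v p q : R * R).

Lemma pl_at p x0 x : pl (p, - dot p x0) x = dot p (vs x x0).
Proof. by rewrite /pl /dot /vs /=; ring. Qed.

Lemma dot_mv p x0 v (r : R) : dot p (vs (mv x0 r v) x0) = r * dot p v.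
Proof. by rewrite /dot /vs /mv /=; ring. Qed.

Lemma sqnorm_gt0 v : v != (0, 0) -> 0 < dot v v.
Proof.
move=> v0; rewrite lt_neqAle eq_sym addr_ge0 -?expr2 ?sqr_ge0// andbT; apply: contraNneq v0.
rewrite /dot => /eqP; rewrite paddr_eq0 -?expr2 ?sqr_ge0// !sqrf_eq0.
by move=> /andP[/eqP h1 /eqP h2]; rewrite [v]surjective_pairing h1 h2.
Qed.

Lemma bounded_closure (D : set (R * R)) : bounded_set D -> exists2 C : R, 0 < C &
  forall x y, D x -> closure D y -> `|y.1 - x.1| <= C /\ `|y.2 - x.2| <= C.
Proof.
move=> bD; have [M M0 hM] := bounded_setP bD.
exists (2 * M + 1); first lra.
move=> x y /hM[]; rewrite !ler_norml => /andP[h1 h2] /andP[h3 h4] cy.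
have [z /hM[] + + []] := (closureP D y).1 cy _ ltr01.
rewrite !ler_norml !ltr_norml => /andP[h5 h6] /andP[h7 h8] /andP[h9 h10] /andP[h11 h12].
by split; apply/andP; split; lra.
Qed.

Variables (D : set (R * R)) (u : R * R -> R) (M : R).
Hypotheses (oD : open D) (cD : cset D) (bD : bounded_set D).
Hypotheses (lu : lipc M u) (u0 : forall x, 0 <= u x) (mu_ : minimizes D u).

(** With [k] the mean and [f] half the difference of [p] and [q], [u] exceeds the plane of slope [k]
    by [|f . (x - x0)|], so the raised set lies in a strip of width of order [h]. As [x0] is
    interior, [k - x0] is a positive multiple of some [z - x0] with [z] in [D], and the flux is of
    order [h] per unit area. *)
Lemma interior_subgradient_unique x0 p q : D x0 ->
  (forall x, u x0 + dot p (vs x x0) <= u x) ->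
  (forall x, u x0 + dot q (vs x x0) <= u x) -> p = q.
Proof.
move=> Dx0 hp hq; have cx0 : closure D x0 := subset_closure Dx0.
apply: contrapT => pq.
pose k : R * R := (2^-1 * (p.1 + q.1), 2^-1 * (p.2 + q.2)).
pose f : R * R := (2^-1 * (q.1 - p.1), 2^-1 * (q.2 - p.2)).
pose b : R * R * R := (f, - dot f x0).
have bE x : pl b x = dot f (vs x x0) := pl_at f x0 x.
have f0 : f != (0, 0).
  apply/eqP => -[/eqP + /eqP]; rewrite !mulf_eq0 !invr_eq0 !pnatr_eq0/= !subr_eq0.
  move=> /eqP e1 /eqP e2; apply: pq.
  by rewrite [LHS]surjective_pairing [RHS]surjective_pairing e1 e2.
have ff : 0 < dot f f := sqnorm_gt0 f0.
have below x : D x -> u x0 + dot k (vs x x0) <= u x.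
  by move=> _; have := hp x; have := hq x; rewrite /dot /vs /=; lra.
have [C C0 hC] := bounded_closure bD.
have [r r0 hr] := open_mv f oD Dx0.
have rr : `|r| <= r by rewrite gtr0_norm.
have rr' : `|- r| <= r by rewrite normrN gtr0_norm.
pose d := r * dot f f.
have d0 : 0 < d by exact: mulr_gt0.
have z1 : pl b (mv x0 r f) = d by rewrite bE dot_mv.
have z2 : pl b (mv x0 (- r) f) = - d by rewrite bE dot_mv mulNr.
have [t t0 ht] := open_mv (vs k x0) oD Dx0.
have tt : `|t| <= t by rewrite gtr0_norm.
pose A := 4 * C / d.
have A0 : 0 < A by rewrite divr_gt0// mulr_gt0.
pose W := 36 * A ^+ 2 * (2 / t + 3).
have W0 : 0 < W.
  apply: mulr_gt0; first by apply: mulr_gt0 => //; exact: exprn_gt0.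
  by apply: addr_gt0 => //; exact: divr_gt0.
(* The first bound gives [d - 3 h >= d / 2] in [raise_thin2]; the second contradicts the inequality
   [1 <= h * W] of [raise_contra]. *)
pose h := Num.min (d / 6) (2^-1 / W).
have h0 : 0 < h by rewrite lt_min !divr_gt0// invr_gt0.
have [hd hW] : h <= d / 6 /\ h * W <= 2^-1.
  by split; [rewrite ge_min lexx|rewrite -ler_pdivlMr// ge_min lexx orbT].
have eta x : D x -> 0 < raise u x0 k h x -> `|pl b x| <= h.
  move=> Dx /raise_gt0[_ e]; have := raise_ge0 u x0 k h x.
  rewrite e raise_plE bE; have := hp x; have := hq x; rewrite /dot /vs /=.
  by rewrite ler_norml => *; apply/andP; split; lra.
have T := raise_thin2 (b := b) oD cD bD lu (ltW h0) f0 eta (subset_closure (hr _ rr))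
   (subset_closure (hr _ rr')) hC.
have {}T := T d; rewrite z1 z2 !lexx in T; have {}T := T isT isT.
have i0 : 0 <= II D (raise u x0 k h) by apply: Rintegral_ge0 => x _; exact: raise_ge0.
have h1 : II D (raise u x0 k h) <= A * h * slope_mass D u x0 k h.
  rewrite (_ : A * h * _ = 2 * (h * C) * slope_mass D u x0 k h / (d / 2)); last first.
    by rewrite /A; field; rewrite gt_eqF.
  rewrite ler_pdivlMr ?divr_gt0// mulrC; apply: le_trans T; apply: ler_wpM2r => //; lra.
have h2 : II D (fun x => dot (draise u x0 k h x) (vs k x0)) <= 2 / t * h * sraise D u x0 k h.
  have := flux_pos oD cD bD lu h0 below (subset_closure (ht _ tt)) (b := t^-1).
  rewrite invr_ge0 (ltW t0) => /(_ isT).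
  rewrite (_ : (_, _) = vs k x0); last by rewrite /mv /vs /=; congr pair; field; rewrite gt_eqF.
  move=> /le_trans; apply; rewrite -[leRHS]mulrA; apply: ler_wpM2l.
    by rewrite divr_ge0// ltW.
  exact: (raise_le_mass oD bD lu h0 below).
have := raise_contra oD cD bD lu u0 mu_ cx0 h0 below A0 h1 h2.
rewrite (_ : 36 * A ^+ 2 * (2 / t * h + 3 * h) = h * W); last by rewrite /W; ring.
lra.
Qed.

End interior_points.

(** * Directional derivatives at a boundary point *)

Section tangent_cone.
Context {R : realType}.
Implicit Types (A : set (R * R)) (f g w : R * R -> R) (x y z e v p q : R * R).

Definition sc (c : R) y : R * R := (c * y.1, c * y.2).
Definition lc (a b : R) y z : R * R := (a * y.1 + b * z.1, a * y.2 + b * z.2).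

Definition sublin (E : R * R -> R) := (forall c y, 0 < c -> E (sc c y) = c * E y) /\
  (forall y z, E (y.1 + z.1, y.2 + z.2) <= E y + E z).

(** The directional derivative. At a boundary point it refers to the extension of the minimizer to
    the plane; linearity is proved for the directions pointing to points of [D]. *)
Definition tg f x y : R := right_slope setT f y x.

Section tg_lemmas.
Variables (f : R * R -> R) (x : R * R).
Hypothesis cf : cvx setT f.

Lemma tg_le y (s : R) : 0 < s -> f x + s * tg f x y <= f (mv x s y).
Proof.
move=> s0; have := right_slope_le openT cf (I : setT x) s0 (I : setT (mv x s y)).
by rewrite ler_pdivlMr// -/(tg f x y); lra.
Qed.

Lemma tg_near y (k : R) : 0 < k -> exists2 s0 : R, 0 < s0 &
  forall s, 0 < s <= s0 -> f (mv x s y) <= f x + s * (tg f x y + k).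
Proof.
move=> k0; have [t t0 ht] := right_slope_near openT cf y (I : setT x) k0.
exists t => // s /[dup]/ht[_ + /andP[s0 _]].
by rewrite ler_pdivrMr// -/(tg f x y); lra.
Qed.

Lemma tg_subgradient z : f x + tg f x (vs z x) <= f z.
Proof.
have := tg_le (vs z x) ltr01; rewrite mul1r (_ : mv x 1 _ = z)//.
by rewrite [RHS]surjective_pairing /mv /vs /=; congr pair; ring.
Qed.

Lemma mv_sc (s c : R) y : mv x s (sc c y) = mv x (s * c) y.
Proof. by rewrite /mv /sc /= !mulrA. Qed.

Lemma sublin_tg : sublin (tg f x).
Proof.
have le c y : 0 < c -> tg f x (sc c y) <= c * tg f x y.
  move=> c0; apply/ler_addgt0Pr => k k0.
  have [s0 s00 hs] := tg_near y (divr_gt0 k0 c0).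
  have sp : 0 < s0 / c by exact: divr_gt0.
  have := tg_le (sc c y) sp; rewrite mv_sc mulfVK ?gt_eqF// => h1.
  have := hs s0; rewrite s00 lexx => /(_ isT) h2.
  have h3 := le_trans h1 h2.
  have : s0 / c * tg f x (sc c y) <= s0 / c * (c * tg f x y + k).
    rewrite (_ : s0 / c * (c * tg f x y + k) = s0 * (tg f x y + k / c)); first lra.
    by field; rewrite gt_eqF.
  by rewrite ler_pM2l.
split => [c y c0|y z].
  apply/eqP; rewrite eq_le le//=.
  have ci : 0 < c^-1 by rewrite invr_gt0.
  have := le c^-1 (sc c y) ci.
  rewrite (_ : sc _ _ = y); last first.
    by rewrite [RHS]surjective_pairing /sc /= !mulKf ?gt_eqF.
  by rewrite mulrC ler_pdivlMr// mulrC.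
apply/ler_addgt0Pr => k k0; have k2 : 0 < k / 2 by rewrite divr_gt0.
have [s s0 hs] := tg_near y k2; have [t t0 ht] := tg_near z k2.
pose r := Num.min s t; have r0 : 0 < r by rewrite lt_min s0.
have := hs r; rewrite r0 ge_min lexx => /(_ isT) h1.
have := ht r; rewrite r0 ge_min lexx orbT => /(_ isT) h2.
have r2 : 0 < r / 2 by rewrite divr_gt0.
have h3 := tg_le (y.1 + z.1, y.2 + z.2) r2.
have i2 : 0 <= (2^-1 : R) <= 1 by apply/andP; split; lra.
have := cf (I : setT (mv x r y)) (I : setT (mv x r z)) i2.
rewrite (_ : cb _ _ _ = mv x (r / 2) (y.1 + z.1, y.2 + z.2)); last first.
  by rewrite /cb /mv /=; congr pair; field.
move=> h4; rewrite -(ler_pM2l r2); lra.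
Qed.

End tg_lemmas.

Lemma sublin_sub E p : sublin E -> sublin (fun y => E y - dot p y).
Proof.
move=> [h a]; split => [c y c0|y z].
  by rewrite h// /dot /sc /=; ring.
by have := a y z; rewrite /dot /=; lra.
Qed.

Lemma sublin0 E : sublin E -> E (0, 0) = 0.
Proof.
move=> [h _]; have := h 2 (0, 0) (ltr0Sn _ _).
by rewrite /sc /= mulr0; lra.
Qed.

Lemma sublin_homo E c y : sublin E -> 0 <= c -> E (sc c y) = c * E y.
Proof.
move=> sE; rewrite le_eqVlt => /predU1P[<-|c0]; last by case: sE => + _; exact.
by rewrite /sc !mul0r sublin0.
Qed.

Lemma sublin_lc E a b y z : sublin E -> 0 <= a -> 0 <= b -> E (lc a b y z) <= a * E y + b * E z.
Proof.
move=> sE a0 b0; rewrite -!sublin_homo//.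
by case: sE => _ /(_ (sc a y) (sc b z)).
Qed.

Lemma cb_lc (t : R) y z : cb t y z = lc (1 - t) t y z.
Proof. by []. Qed.

Definition crs y z : R := y.1 * z.2 - y.2 * z.1.

Definition dual_basis y1 y2 a1 a2 := [/\ dot a1 y1 = 1, dot a1 y2 = 0, dot a2 y1 = 0, dot a2 y2 = 1 &
  forall y, y = lc (dot a1 y) (dot a2 y) y1 y2].

Lemma dual_basisP y1 y2 : crs y1 y2 != 0 -> exists a1 a2, dual_basis y1 y2 a1 a2.
Proof.
move=> d0; exists (y2.2 / crs y1 y2, - y2.1 / crs y1 y2), (- y1.2 / crs y1 y2, y1.1 / crs y1 y2).
rewrite /crs in d0 *; split; rewrite /dot /=; try by field.
by move=> y; rewrite [LHS]surjective_pairing /lc /=; congr pair; field.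
Qed.

Lemma dual_basis_sym y1 y2 a1 a2 : dual_basis y1 y2 a1 a2 -> dual_basis y2 y1 a2 a1.
Proof.
move=> [h1 h2 h3 h4 h5]; split => // y; rewrite {1}(h5 y) /lc; congr pair; exact: addrC.
Qed.

(* Outside the cone spanned by [y1] and [y2] the vector [y2] lies between [y]
   and [cb b y1 y2], where [E] is small. *)
Lemma outside_cone E y1 y2 a1 a2 (b g : R) y : sublin E -> dual_basis y1 y2 a1 a2 ->
  0 < b < 1 -> 0 < g -> g <= E y2 -> E (cb b y1 y2) <= g / 2 * b ->
  dot a1 y < 0 -> 0 < dot a2 y ->
  (`|dot a1 y| + `|dot a2 y|) * b <= 2 / g * E y /\
  (1 - b) * dot a2 y - b * dot a1 y <= 2 / g * E y /\
  0 <= (1 - b) * dot a2 y - b * dot a1 y.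
Proof.
move=> sE [_ _ _ _ /(_ y) yE] /andP[b0 b1] g0 gy eb.
move: (dot a1 y) (dot a2 y) yE => a c yE an cp.
have b1' : 0 < 1 - b by lra.
pose c' := c - a * b / (1 - b).
pose a' := - a / (1 - b).
have ab0 : 0 <= - a * b / (1 - b) by rewrite divr_ge0 ?mulr_ge0 ?ltW//; lra.
have c'E : c' = c + - a * b / (1 - b) by rewrite /c' !mulNr.
have a'0 : 0 <= a' by rewrite divr_ge0 ?ltW//; lra.
have c'0 : 0 < c' by lra.
have h : c' * E y2 <= E y + a' * E (cb b y1 y2).
  rewrite -(sublin_homo _ sE (ltW c'0)) -(sublin_homo (cb b y1 y2) sE a'0).
  rewrite (_ : sc c' y2 = (y.1 + (sc a' (cb b y1 y2)).1, y.2 + (sc a' (cb b y1 y2)).2)); last first.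
    by rewrite {1 2}yE /sc /cb /lc /a' /c' /=; congr pair; field; rewrite gt_eqF.
  by case: sE => _; apply.
have ab : a' * b <= c' by rewrite c'E /a' mulrAC; lra.
have h2 : c' * (g / 2) <= E y.
  have := ler_wpM2l (ltW c'0) gy; have := ler_wpM2l a'0 eb.
  have g2 : 0 <= g / 2 by rewrite divr_ge0// ltW.
  have := ler_wpM2l g2 ab; lra.
have h3 : c' <= 2 / g * E y.
  by rewrite mulrC mulrA ler_pdivlMr//; lra.
rewrite ltr0_norm// gtr0_norm//.
have fE : (1 - b) * c - b * a = (1 - b) * c'.
  by rewrite /c'; field; rewrite gt_eqF.
have aE : - a * b = (1 - b) * (- a * b / (1 - b)) by field; rewrite gt_eqF.
rewrite fE; split; last split.
- by apply: le_trans h3; rewrite mulrDl aE c'E; nra.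
- by apply: le_trans h3; nra.
- by rewrite mulr_ge0// ltW.
Qed.

End tangent_cone.

Lemma fine_measure_near {R : realType} (D : set (R * R)) x (r : R) :
  open D -> bounded_set D -> 0 < r ->
  fine (plane_measure ((D `&` near_pt x r) : set (measurableTypeR R * measurableTypeR R))) <=
    (2 * r) ^+ 2.
Proof.
move=> oD bD r0; set Q := near_pt x r; have mD := open_plane_measurable oD.
have mQ := open_plane_measurable (near_pt_open (x := x) (r := r)).
have mDQ := measurableI _ _ mD mQ.
rewrite -lee_fin fineK; last first.
  rewrite ge0_fin_numE; last exact: measure_ge0.
  by apply: le_lt_trans (bounded_measure oD bD); apply: le_measure; rewrite ?inE.
apply: le_trans (_ : plane_measure (Q : set (measurableTypeR R * measurableTypeR R)) <= _)%E.
  by apply: le_measure; rewrite ?inE.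
rewrite /Q near_pt_box box_measure; [|lra|lra].
by rewrite lee_fin le_eqVlt; apply/orP; left; apply/eqP; ring.
Qed.

(** For a raise of slope [k] and height [h], the raised points of [D] satisfy [excess < h] in the
    direction [x - x0], because [u] lies above its tangent cone. *)
Definition excess {R : realType} (u : R * R -> R) (x0 k y : R * R) : R :=
  tg u x0 y - dot k y.

Lemma clamp01 {R : realType} (q : R) : 0 <= Num.max (q - 1) 0 - Num.max (q - 2) 0 <= 1.
Proof.
by apply/andP; case: (leP (q - 1) 0) => q1; case: (leP (q - 2) 0) => q2; split; lra.
Qed.

Lemma clamp0 {R : realType} (q : R) : q <= 1 -> Num.max (q - 1) 0 - Num.max (q - 2) 0 = 0.
Proof.
by move=> q1; case: (leP (q - 1) 0) => h1; case: (leP (q - 2) 0) => h2; lra.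
Qed.

Lemma cone_shift {R : realType} (l c d p q : R) : 0 < l -> l <= c -> l <= d -> c + d <= 2^-1 ->
  - p < l -> - q < l -> p + q <= 4^-1 ->
  0 <= c + p /\ 0 <= d + q /\ 0 < c + p + (d + q) <= 1.
Proof. by move=> *; split; [lra|split; [lra|apply/andP; split; lra]]. Qed.

(** * Raising along a kink of the directional derivative *)

Section sliver.
Context {R : realType}.
Local Notation R2 := (measurableTypeR R * measurableTypeR R)%type.
Variables (D : set (R * R)) (u : R * R -> R) (M : R) (x0 y1 y2 a1 a2 : R * R) (b g : R).
Implicit Types (x y z p q : R * R).
Hypotheses (oD : open D) (cD : cset D) (bD : bounded_set D).
Hypotheses (lu : lipc M u) (u0 : forall x, 0 <= u x) (mu_ : minimizes D u).
Hypotheses (cx0 : closure D x0) (nDx0 : ~ D x0).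
Hypotheses (Dy1 : D (mv x0 1 y1)) (Dy2 : D (mv x0 1 y2)) (ba : dual_basis y1 y2 a1 a2).
Hypotheses (b01 : 0 < b < 1) (g0 : 0 < g).

Let mD : measurable (D : set R2).
Proof. exact: open_plane_measurable. Qed.

Let fD := bounded_measure oD bD.

Let cu : cvx setT u. Proof. by case: lu. Qed.

Lemma vsE x : x = mv x0 1 (vs x x0).
Proof. by rewrite [LHS]surjective_pairing /mv /vs /=; congr pair; ring. Qed.

(** Otherwise [x0] would be a convex combination of [x] and the two points of [D] in the directions
    [y1] and [y2]. *)
Lemma cone_not_opposite x : D x -> dot a1 (vs x x0) <= 0 -> dot a2 (vs x x0) <= 0 -> False.
Proof.
move=> Dx h1 h2; have [_ _ _ _ /(_ (vs x x0))] := ba.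
move: (dot a1 _) (dot a2 _) h1 h2 => a c a0 c0 yE.
have x1 : x.1 = x0.1 + a * y1.1 + c * y2.1.
  by move: yE => /(congr1 fst); rewrite /vs /lc /=; lra.
have x2 : x.2 = x0.2 + a * y1.2 + c * y2.2.
  by move: yE => /(congr1 snd); rewrite /vs /lc /=; lra.
apply: nDx0; have [ac|ac] := eqVneq (a + c) 0.
  have a00 : a = 0 by lra. have c00 : c = 0 by lra.
  by rewrite a00 c00 !mul0r !addr0 in x1 x2; rewrite [x0]surjective_pairing -x1 -x2 -surjective_pairing.
have ac0 : 0 < - (a + c) by rewrite oppr_gt0 lt_neqAle ac; lra.
have i1 : 0 <= c / (a + c) <= 1.
  have -> : c / (a + c) = - c / - (a + c) by rewrite invrN mulrNN.
  by apply/andP; split; [apply: divr_ge0; lra|rewrite ler_pdivrMr//; lra].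
have i2 : 0 <= - (a + c) / (1 - (a + c)) <= 1.
  by apply/andP; split; [apply: divr_ge0; lra|rewrite ler_pdivrMr//; lra].
have := cD Dx (cD Dy1 Dy2 i1) i2; congr D.
rewrite [RHS]surjective_pairing /cb /mv /= x1 x2; congr pair; field;
  by rewrite ac /= gt_eqF//; lra.
Qed.

Lemma in_cone (a c : R) : 0 <= a -> 0 <= c -> 0 < a + c <= 1 -> D (mv x0 1 (lc a c y1 y2)).
Proof.
move=> a0 c0 /andP[s0 s1].
have i1 : 0 <= c / (a + c) <= 1.
  by apply/andP; split; [apply: divr_ge0; lra|rewrite ler_pdivrMr//; lra].
have i2 : 0 <= 1 - (a + c) < 1 by apply/andP; split; lra.
have := closure_cb oD cD (cD Dy1 Dy2 i1) cx0 i2; congr D.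
by rewrite /cb /mv /lc /=; congr pair; field; rewrite gt_eqF.
Qed.

Variables (k : R * R) (dl e : R).
Local Notation E := (excess u x0 k).
Hypotheses (dl0 : 0 < dl) (e0 : 0 < e).
Hypotheses (Eb1 : E (cb b y1 y2) <= g / 2 * b) (Eb2 : E (cb b y1 y2) <= g / 2 * (1 - b)).
Hypotheses (Ey1 : g <= E y1) (Ey2 : g <= E y2).
Hypotheses (E1 : forall t, 0 <= t <= 1 -> dl * `|t - b| <= E (cb t y1 y2)).
Hypotheses (E2 : forall t, 0 <= t <= 1 -> dl * e <= E (cb t y1 y2)).

(** The linear form with value [t - b] at [cb t y1 y2]: it measures the deviation from the kink. *)
Definition kink_slope : R * R := ((1 - b) * a2.1 - b * a1.1, (1 - b) * a2.2 - b * a1.2).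
Local Notation f := kink_slope.

Lemma kink_slopeE y : dot f y = (1 - b) * dot a2 y - b * dot a1 y.
Proof. by rewrite /dot /kink_slope /=; ring. Qed.

Let sE : sublin E. Proof. by apply: sublin_sub; exact: sublin_tg. Qed.

Local Ltac clear_local := clear -oD cD bD lu u0 mu_ cx0 nDx0 Dy1 Dy2 ba b01 g0 mD fD cu
  dl0 e0 Eb1 Eb2 Ey1 Ey2 E1 E2 sE.

(** Inside the cone of [y1] and [y2], homogeneity reduces to the segment and to [E1], [E2]. Outside
    it, [outside_cone] applies, with [y1] and [y2] exchanged according to the side. *)
Lemma tangent_cases y : ~ (dot a1 y <= 0 /\ dot a2 y <= 0) ->
  [/\ 0 <= dot a1 y /\ 0 <= dot a2 y, 0 < dot a1 y + dot a2 y,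
     E y = (dot a1 y + dot a2 y) *
       E (cb (dot a2 y / (dot a1 y + dot a2 y)) y1 y2),
     dl * `|dot f y| <= E y & dl * e * (dot a1 y + dot a2 y) <= E y] \/
  [/\ `|dot a1 y| * Num.min b (1 - b) <= 2 / g * E y,
      `|dot a2 y| * Num.min b (1 - b) <= 2 / g * E y,
      `|dot f y| <= 2 / g * E y &
      (dot a1 y + dot a2 y) * Num.min b (1 - b) <= 2 / g * E y].
Proof.
move=> ny; have /andP[b0 b1] := b01; have g00 := g0.
have [a0|a0] := leP 0 (dot a1 y); have [c0|c0] := leP 0 (dot a2 y).
- left; have s0 : 0 < dot a1 y + dot a2 y.
    rewrite lt_neqAle addr_ge0// andbT; apply/eqP => s0; apply: ny; split; lra.
  set s := dot a1 y + dot a2 y in s0 *.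
  have i1 : 0 <= dot a2 y / s <= 1.
    by apply/andP; split; [rewrite divr_ge0// ltW|rewrite ler_pdivrMr// /s; lra].
  have EE : E y = s * E (cb (dot a2 y / s) y1 y2).
    rewrite -(sublin_homo _ sE (ltW s0)); congr E.
    have [_ _ _ _ /(_ y) yE] := ba; rewrite {1}yE /sc /cb /lc /=.
    by rewrite -/(dot a1 y) -/(dot a2 y); congr pair; rewrite /s; field; rewrite -/s gt_eqF.
  split => //.
    rewrite EE; apply: le_trans (ler_wpM2l (ltW s0) (E1 i1)).
    rewrite [leRHS]mulrCA; apply: (ler_wpM2l (ltW dl0)).
    rewrite -[X in X * _](gtr0_norm s0) -normrM.
    rewrite kink_slopeE (_ : _ - _ = s * (dot a2 y / s - b))//.
    by rewrite mulrBr mulrCA mulfV ?gt_eqF// /s; ring.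
  by rewrite EE [leLHS]mulrC; apply: ler_wpM2l (ltW s0) _ _ (E2 i1).
- right.
  have h := outside_cone sE (dual_basis_sym ba) (b := 1 - b) (g := g) (y := y).
  have [|//|//||//||h1 [h2 h3]] := h; [by apply/andP; split; lra| | |].
  + rewrite (_ : cb _ _ _ = cb b y1 y2)//.
    by rewrite /cb; congr pair; ring.
  + by rewrite lt_neqAle a0 andbT; apply/eqP => a00; apply: ny; split; lra.
  have m1 : Num.min b (1 - b) <= 1 - b by rewrite ge_min lexx orbT.
  have n1 := normr_ge0 (dot a1 y); have n2 := normr_ge0 (dot a2 y).
  have m0 : 0 <= Num.min b (1 - b) by rewrite le_min subr_ge0 !ltW.
  have h4 : (`|dot a1 y| + `|dot a2 y|) * Num.min b (1 - b) <= 2 / g * E y.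
    apply: le_trans h1; rewrite addrC; apply: ler_wpM2l => //; exact: addr_ge0.
  split.
  + by apply: le_trans h4; apply: ler_wpM2r => //; rewrite lerDl.
  + by apply: le_trans h4; apply: ler_wpM2r => //; rewrite lerDr.
  + by move: h2 h3; clear_local; rewrite kink_slopeE -normrN => h2 h3; rewrite ger0_norm; lra.
  + apply: le_trans h4; apply: ler_wpM2r => //.
    by apply: lerD; exact: ler_norm.
- right.
  have [|//|//||//||h1 [h2 h3]] := outside_cone sE ba (b := b) (g := g) (y := y).
  + exact: b01.
  + exact: Eb1.
  + by rewrite lt_neqAle c0 andbT; apply/eqP => a00; apply: ny; split; lra.
  have m1 : Num.min b (1 - b) <= b by rewrite ge_min lexx.
  have n1 := normr_ge0 (dot a1 y); have n2 := normr_ge0 (dot a2 y).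
  have m0 : 0 <= Num.min b (1 - b) by rewrite le_min subr_ge0 !ltW.
  have h4 : (`|dot a1 y| + `|dot a2 y|) * Num.min b (1 - b) <= 2 / g * E y.
    apply: le_trans h1; apply: ler_wpM2l => //; exact: addr_ge0.
  split.
  + by apply: le_trans h4; apply: ler_wpM2r => //; rewrite lerDl.
  + by apply: le_trans h4; apply: ler_wpM2r => //; rewrite lerDr.
  + by move: h2 h3; clear_local; rewrite kink_slopeE => h2 h3; rewrite ger0_norm; lra.
  + apply: le_trans h4; apply: ler_wpM2r => //.
    by apply: lerD; exact: ler_norm.
- by exfalso; apply: ny; split; exact: ltW.
Qed.

Lemma tangent_ge0 x : D x -> 0 <= E (vs x x0).
Proof.
move=> Dx; have dl00 := dl0; have g00 := g0.
have [|[_ _ _ h _]|[_ _ h _]] := @tangent_cases (vs x x0).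
- by move=> [h1 h2]; exact: (cone_not_opposite Dx h1 h2).
- by apply: le_trans h; rewrite mulr_ge0// ltW.
- have := le_trans (normr_ge0 _) h.
  by rewrite pmulr_rge0// divr_gt0.
Qed.

Lemma kink_below x : D x -> u x0 + dot k (vs x x0) <= u x.
Proof.
by move=> Dx; have := tangent_ge0 Dx; have := tg_subgradient x0 cu x; rewrite /excess; lra.
Qed.

Lemma raise_tangent h x : D x -> 0 < raise u x0 k h x -> E (vs x x0) < h.
Proof.
move=> Dx; have := tg_subgradient x0 cu x => h1.
by move=> /[dup]/raise_gt0[_ ->]; rewrite raise_plE /excess; lra.
Qed.

(** Both cases of [tangent_cases] confine the raised set to a strip of [kink_slope] of width
    [h / d1], and the points in the directions [y1] and [y2] lie on its two sides. *)
Lemma kink_thin (C h : R) : 0 < h -> h <= Num.min b (1 - b) * Num.min dl (g / 2) / 6 ->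
  (forall x y, D x -> closure D y -> `|y.1 - x.1| <= C /\ `|y.2 - x.2| <= C) ->
  II D (raise u x0 k h) <= 4 * C / (Num.min b (1 - b) * Num.min dl (g / 2)) * h * slope_mass D u x0 k h.
Proof.
move=> h0 hh hC; have /andP[b0 b1] := b01; have g00 := g0.
set bb := Num.min b (1 - b) in hh *; set d1 := Num.min dl (g / 2) in hh *.
have bb0 : 0 < bb by rewrite lt_min b0 subr_gt0.
have d10 : 0 < d1 by rewrite lt_min dl0 divr_gt0.
have [bbb bb1] : bb <= b /\ bb <= 1 - b by rewrite /bb !ge_min !lexx orbT.
have [d1a d1b] : d1 <= dl /\ d1 <= g / 2 by rewrite /d1 !ge_min !lexx orbT.
pose P : R * R * R := (f, - dot f x0).
have PE x : pl P x = dot f (vs x x0) := pl_at f x0 x.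
have [d11 d12 d21 d22 _] := ba.
have f1 : dot f y1 = - b by rewrite kink_slopeE d11 d21; ring.
have f2 : dot f y2 = 1 - b by rewrite kink_slopeE d12 d22; ring.
have P0 : P.1 != (0, 0).
  apply/eqP => /= f0; move: f1; rewrite f0 /dot /= !mul0r addr0 => /eqP.
  by rewrite eq_sym oppr_eq0 gt_eqF.
have eta x : D x -> 0 < raise u x0 k h x -> `|pl P x| <= h / d1.
  move=> Dx rx; have Eh := raise_tangent Dx rx; rewrite PE ler_pdivlMr//.
  have n0 := normr_ge0 (dot f (vs x x0)).
  have [|[_ _ _ hd _]|[_ _ hd _]] := @tangent_cases (vs x x0).
  - by move=> [h1 h2]; exact: (cone_not_opposite Dx h1 h2).
  - by apply: le_trans (ltW Eh); apply: le_trans hd; rewrite mulrC; apply: ler_wpM2r.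
  - apply: le_trans (ltW Eh); rewrite mulrAC ler_pdivlMr// in hd.
    by apply: le_trans (_ : `|dot f (vs x x0)| * (g / 2) <= _); [exact: ler_wpM2l|lra].
have e0' : 0 <= h / d1 by rewrite divr_ge0// ltW.
have T := raise_thin2 (b := P) oD cD bD lu e0' P0 eta (subset_closure Dy2) (subset_closure Dy1) hC (d := bb).
have vv y : vs (mv x0 1 y) x0 = y.
  by rewrite [RHS]surjective_pairing /vs /mv /=; congr pair; ring.
rewrite !PE !vv f1 f2 lerN2 in T; have {}T := T bb1 bbb.
have i0 : 0 <= II D (raise u x0 k h) by apply: Rintegral_ge0 => x _; exact: raise_ge0.
have bd : 0 < bb * d1 by exact: mulr_gt0.
have hd : h / d1 <= bb / 6.
  by rewrite ler_pdivrMr//; lra.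
have T2 : bb / 2 * II D (raise u x0 k h) <= 2 * (h / d1 * C) * slope_mass D u x0 k h.
  by apply: le_trans T; apply: ler_wpM2r => //; lra.
rewrite (_ : 4 * C / (bb * d1) * h * _ = 2 * (h / d1 * C) * slope_mass D u x0 k h / (bb / 2)); last first.
  by field; rewrite !gt_eqF.
by rewrite ler_pdivlMr ?divr_gt0// mulrC.
Qed.

Lemma dot_abs (N : R) v x : `|v.1| <= N -> `|v.2| <= N -> `|dot v x| <= N * norm1 x.
Proof.
move=> v1 v2; rewrite ler_norml; apply/andP; split; last exact: dot_le.
rewrite lerNl (_ : - dot v x = dot (opv v) x); last by rewrite /dot /opv /=; ring.
by apply: dot_le; rewrite /= normrN.
Qed.

(** Away from [x0], raised points lie well inside the cone. They lie in it, as outside it [a1 + a2]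
    is below the threshold. Their direction is at least [t1] away from both ends, since the excess
    is below [g / 2] there and at least [g] at the ends; and [dl * e * s <= E < h] keeps [s] below
    [1/2]. A short translation therefore stays in [D]. *)
Lemma kink_far (h : R) m : 0 < h -> h <= dl * e / 2 -> exists2 t0 : R, 0 < t0 &
  forall x t, D x -> 0 < raise u x0 k h x ->
   2 / (g * Num.min b (1 - b)) * h < dot a1 (vs x x0) + dot a2 (vs x x0) ->
   0 < t <= t0 -> D (mv x t m).
Proof.
move=> h0 hh; have /andP[b0 b1] := b01; have g00 := g0.
set bb := Num.min b (1 - b).
have bb0 : 0 < bb by rewrite lt_min b0 subr_gt0.
have [bbb bb1] : bb <= b /\ bb <= 1 - b by rewrite /bb !ge_min !lexx orbT.
set L := 2 / (g * bb) * h.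
have gb0 : 0 < g * bb by exact: mulr_gt0.
have L0 : 0 < L by rewrite mulr_gt0// divr_gt0.
have de0 : 0 < dl * e by exact: mulr_gt0.
pose La := Num.max 1 (Num.max (E (vs y2 y1)) (E (vs y1 y2))).
have La0 : 0 < La by rewrite lt_max ltr01.
have [La1 La2] : E (vs y2 y1) <= La /\ E (vs y1 y2) <= La.
  by rewrite /La !le_max !lexx !orbT.
pose t1 := g / (2 * La).
have t10 : 0 < t1 by rewrite divr_gt0// mulr_gt0.
pose K := `|dot a1 m| + `|dot a2 m| + 1.
have K0 : 0 < K by rewrite ltr_wpDl// addr_ge0.
exists (Num.min (t1 * L / 2) 4^-1 / K).
  apply: divr_gt0 => //; rewrite lt_min; apply/andP; split; last by rewrite invr_gt0.
  by apply: divr_gt0 => //; exact: mulr_gt0.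
move=> x t Dx rx hx /andP[tp tt].
have {}tt : t * K <= t1 * L / 2 /\ t * K <= 4^-1.
  by move: tt; rewrite ler_pdivlMr// le_min => /andP.
have Eh := raise_tangent Dx rx.
have [|[[p1 p2] s0 EE _ Es]|[_ _ _ hs]] := @tangent_cases (vs x x0).
- by move=> [h1 h2]; exact: (cone_not_opposite Dx h1 h2).
- set y := vs x x0 in hx p1 p2 s0 EE Es Eh *.
  have yx : x = mv x0 1 y := vsE x.
  set s := dot a1 y + dot a2 y in hx s0 EE Es.
  set th := dot a2 y / s in EE.
  have th01 : 0 <= th <= 1.
    by apply/andP; split; [rewrite divr_ge0// ltW|rewrite ler_pdivrMr// /s; lra].
  have /andP[th0 th1] := th01.
  have Eth : E (cb th y1 y2) < g / 2.
    have h1 : L * E (cb th y1 y2) < h.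
      apply: le_lt_trans Eh; rewrite EE; apply: ler_wpM2r; last exact: ltW.
      by apply: le_trans (E2 th01); exact: ltW.
    have h2 : E (cb th y1 y2) < h / L by rewrite ltr_pdivlMr// mulrC.
    apply: lt_le_trans h2 _; rewrite /L.
    rewrite (_ : h / _ = g * bb / 2); last by field; rewrite !gt_eqF.
    by have := ler_wpM2l (ltW g00) (le_trans bbb (ltW b1)); clear_local; lra.
  have e1 : g - g / 2 <= (1 - th) * La.
    have := sE.2 (cb th y1 y2) (sc (1 - th) (vs y2 y1)).
    rewrite (_ : (_, _) = y2); last first.
      by rewrite [RHS]surjective_pairing /cb /sc /vs /=; congr pair; ring.
    have t1' : 0 <= 1 - th by rewrite subr_ge0.
    rewrite sublin_homo//.
    by move: Eth (ler_wpM2l t1' La1) Ey2; clear_local; lra.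
  have e2 : g - g / 2 <= th * La.
    have := sE.2 (cb th y1 y2) (sc th (vs y1 y2)).
    rewrite (_ : (_, _) = y1); last first.
      by rewrite [RHS]surjective_pairing /cb /sc /vs /=; congr pair; ring.
    rewrite sublin_homo//.
    by move: Eth (ler_wpM2l th0 La2) Ey1; clear_local; lra.
  have e3 : t1 <= 1 - th by rewrite /t1 ler_pdivrMr ?mulr_gt0//; lra.
  have e4 : t1 <= th by rewrite /t1 ler_pdivrMr ?mulr_gt0//; lra.
  have c2 : t1 * L <= dot a2 y.
    rewrite (_ : dot a2 y = th * s); last by rewrite mulfVK// gt_eqF.
    by apply: ler_pM => //; exact: ltW.
  have c1 : t1 * L <= dot a1 y.
    rewrite (_ : dot a1 y = (1 - th) * s); last by rewrite mulrBl mulfVK ?gt_eqF// /s; ring.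
    by apply: ler_pM => //; exact: ltW.
  have sh : s <= 2^-1.
    have h1 : dl * e * s < dl * e * 2^-1 by apply: le_lt_trans Es _; move: Eh hh; clear_local; lra.
    by move: h1; rewrite ltr_pM2l// => /ltW.
  have tm (z : R) : `|z| + 1 <= K -> `|t * z| < t1 * L.
    move=> zK; rewrite normrM gtr0_norm//.
    have h1 : t * `|z| <= t * K.
      by apply: ler_wpM2l; [exact: ltW|apply: le_trans zK; rewrite lerDl].
    have h2 : 0 < t1 * L by exact: mulr_gt0.
    by move: tt.1 tt.2 h1 h2; clear_local; lra.
  have /ltr_normlP[u1 u2] : `|t * dot a1 m| < t1 * L by apply: tm; rewrite lerD2r lerDl.
  have /ltr_normlP[u3 u4] : `|t * dot a2 m| < t1 * L by apply: tm; rewrite lerD2r lerDr.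
  have u5 : t * dot a1 m + t * dot a2 m <= 4^-1.
    apply: le_trans tt.2; rewrite -mulrDr; apply: ler_wpM2l; first exact: ltW.
    by apply: le_trans (lerD (ler_norm _) (ler_norm _)) _; rewrite lerDl.
  have -> : mv x t m = mv x0 1 (lc (dot a1 y + t * dot a1 m) (dot a2 y + t * dot a2 m) y1 y2).
    have [_ _ _ _ yE] := ba; have mE := yE m; have {}yE := yE y.
    rewrite yx; move: yE mE; move: (dot a1 y) (dot a2 y) (dot a1 m) (dot a2 m) => c d c' d' -> ->.
    by rewrite /mv /lc /=; congr pair; ring.
  have tL : 0 < t1 * L by exact: mulr_gt0.
  by have [? [? ?]] := cone_shift tL c1 c2 sh u1 u3 u5; exact: in_cone.
- exfalso; move: hs; apply/negP; rewrite -ltNge.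
  rewrite mulrAC ltr_pdivrMr//.
  move: hx; rewrite /L mulrAC ltr_pdivrMr// => hx.
  have hx2 : (dot a1 (vs x x0) + dot a2 (vs x x0)) * (g * bb) = (dot a1 (vs x x0) + dot a2 (vs x x0)) * bb * g by ring.
  by rewrite -hx2; apply: lt_trans hx; rewrite ltr_pM2l.
Qed.

Definition kink_scale : R := 2 / (g * Num.min b (1 - b)).

(** A bound on [Dphi] and on the cutoff error, times one on [k - x0], times the area of a square
    divided by [h^2]. It depends on neither [dl] nor [e], on which [sliver] relies. *)
Definition kink_flux_const (Kb : R) : R :=
  (Kb + M + 2 * (norm1 a1 + norm1 a2) / kink_scale) * (2 * Kb + norm1 x0) *
  (4 * kink_scale * (norm1 y1 + norm1 y2 + 1)) ^+ 2.

Lemma kink_near (h : R) x : 0 < h -> D x -> 0 < raise u x0 k h x ->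
  dot a1 (vs x x0) + dot a2 (vs x x0) <= 2 * (kink_scale * h) ->
  near_pt x0 (2 * kink_scale * (norm1 y1 + norm1 y2 + 1) * h) x.
Proof.
move=> h0 Dx rx hx; have /andP[b0 b1] := b01; have g00 := g0.
set bb := Num.min b (1 - b).
have bb0 : 0 < bb by rewrite lt_min b0 subr_gt0.
have gb0 : 0 < g * bb by exact: mulr_gt0.
have S0 : 0 < kink_scale by rewrite divr_gt0.
set L := kink_scale * h in hx.
have L0 : 0 < L by exact: mulr_gt0.
have Eh := raise_tangent Dx rx.
have LE : L = 2 / g * h / bb by rewrite /L /kink_scale -/bb; field; rewrite !gt_eqF.
have [n1 n2] : `|dot a1 (vs x x0)| <= 2 * L /\ `|dot a2 (vs x x0)| <= 2 * L.
  have [|[[p1 p2] _ _ _ _]|[h1 h2 _ _]] := @tangent_cases (vs x x0).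
  - by move=> [h1 h2]; exact: (cone_not_opposite Dx h1 h2).
  - by rewrite !ger0_norm//; split; lra.
  - have key (z : R) : z * bb <= 2 / g * E (vs x x0) -> z <= 2 * L.
      move=> hz; apply: le_trans (_ : L <= _); last lra.
      rewrite LE ler_pdivlMr//; apply: le_trans hz _.
      by apply: ler_wpM2l; [rewrite divr_ge0// ltW|exact: ltW].
    by split; exact: key.
have [_ _ _ _ /(_ (vs x x0)) yE] := ba.
have v0 (v : R) : 0 <= v -> `|v| = v by move=> ?; rewrite ger0_norm.
have key (c d p q N : R) : `|c| <= 2 * L -> `|d| <= 2 * L -> `|p| + `|q| <= N ->
    `|c * p + d * q| < 2 * L * (N + 1).
  move=> hc hd hN; apply: le_lt_trans (ler_normD _ _) _; rewrite !normrM.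
  have L2 : 0 < 2 * L by exact: mulr_gt0.
  apply: le_lt_trans (lerD (ler_wpM2r (normr_ge0 p) hc) (ler_wpM2r (normr_ge0 q) hd)) _.
  rewrite -mulrDr ltr_pM2l//; by apply: le_lt_trans hN _; rewrite ltrDl.
have -> : 2 * kink_scale * (norm1 y1 + norm1 y2 + 1) * h = 2 * L * (norm1 y1 + norm1 y2 + 1).
  by rewrite /L mulrAC !mulrA.
have m1 := normr_ge0 y1.1; have m2 := normr_ge0 y1.2.
have m3 := normr_ge0 y2.1; have m4 := normr_ge0 y2.2.
split.
- rewrite -[x.1 - x0.1]/((vs x x0).1) yE /=; apply: key => //; rewrite /norm1; lra.
- rewrite -[x.2 - x0.2]/((vs x x0).2) yE /=; apply: key => //; rewrite /norm1; lra.
Qed.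

(** The cutoff [chi] vanishes up to distance [L] and equals 1 beyond [2 * L], distance being
    [a1 + a2]. On its support translations do not exit, so [chi * phi] has flux at most zero. The
    rest lives in a square of side of order [h] with bounded integrand: [phi <= h] compensates the
    slope of [chi], of order [1/h]. *)
Lemma kink_flux (Kb h : R) : `|k.1| <= Kb -> `|k.2| <= Kb -> 0 < h -> h <= dl * e / 2 ->
  II D (fun x => dot (draise u x0 k h x) (vs k x0)) <= kink_flux_const Kb * h ^+ 2.
Proof.
move=> k1 k2 h0 hh; have /andP[b0 b1] := b01; have g00 := g0.
have [M0 _ _] := lu.
have bb0 : 0 < Num.min b (1 - b) by rewrite lt_min b0/=; lra.
have S0 : 0 < kink_scale by rewrite divr_gt0// mulr_gt0.
set m := vs k x0.
have [t0 t00 far] := kink_far m h0 hh.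
rewrite -/kink_scale in far.
set L := kink_scale * h in far.
have L0 : 0 < L by exact: mulr_gt0.
pose hv : R * R := (a1.1 + a2.1, a1.2 + a2.2).
have hvE y : dot hv y = dot a1 y + dot a2 y by rewrite /dot /hv /=; ring.
pose v : R * R := (hv.1 / L, hv.2 / L).
pose P (j : R) : R * R * R := (v, - dot v x0 - j).
have PE j x : pl (P j) x = dot hv (vs x x0) / L - j.
  by rewrite /pl /P /v /dot /vs /=; field; rewrite gt_eqF.
pose zero : R * R * R := ((0, 0), 0).
have zeroE x : pl zero x = 0 by rewrite /pl /dot /= !mul0r !addr0.
pose c j x := Num.max (pl (P j) x) (pl zero x).
pose N := (norm1 a1 + norm1 a2) / L.
have N0 : 0 <= N by rewrite divr_ge0 ?addr_ge0 ?norm1_ge0// ltW.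
have vN : `|v.1| <= N /\ `|v.2| <= N.
  rewrite /v /= !normrM !normfV (gtr0_norm L0) !ler_pM2r ?invr_gt0//.
  have m1 := normr_ge0 a1.1; have m2 := normr_ge0 a1.2.
  have m3 := normr_ge0 a2.1; have m4 := normr_ge0 a2.2.
  by split; apply: le_trans (ler_normD _ _) _; rewrite /norm1; lra.
have lc_ j : lipc N (c j).
  by apply: lipc_max; apply: pl_lipc; split; rewrite /= ?normr0//; case: vN.
pose chi x := c 1 x - c 2 x.
pose dchi x := vs (gd (c 1) x) (gd (c 2) x).
have rchi : reg D chi dchi by apply: regB; exact: lipc_reg (lc_ _).
pose psi x := chi x * raise u x0 k h x.
have rphi := raise_reg x0 k h bD lu.
have rpsi : reg D psi _ := regM rchi rphi.
set dpsi := (fun x => (_, _)) in rpsi.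
have chi01 x : 0 <= chi x <= 1.
  rewrite /chi /c !PE zeroE; set q := dot hv _ / L.
  exact: clamp01.
have chi_pos x : 0 < chi x -> L < dot hv (vs x x0).
  move=> cx; rewrite ltNge; apply/negP => hx; move: cx.
  have q1 : dot hv (vs x x0) / L <= 1 by rewrite ler_pdivrMr// mul1r.
  rewrite /chi /c !PE zeroE; set q := dot hv _ / L in q1 *.
  by rewrite clamp0// ltxx.
have chi_one x : 2 * L < dot hv (vs x x0) ->
    [/\ chi x = 1, c 1 x = pl (P 1) x & c 2 x = pl (P 2) x].
  move=> hx; have q1 : 2 < dot hv (vs x x0) / L by rewrite ltr_pdivlMr.
  have e1 : c 1 x = pl (P 1) x by apply/max_idPl; rewrite PE zeroE; lra.
  have e2 : c 2 x = pl (P 2) x by apply/max_idPl; rewrite PE zeroE; lra.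
  by split => //; rewrite /chi e1 e2 !PE; lra.
have psi0 x : D x -> 0 <= psi x.
  by move=> _; rewrite mulr_ge0 ?raise_ge0//; have /andP[] := chi01 x.
have fl : II D (fun x => dot (dpsi x) m) <= 0.
  have := flux_reg (l := 0) (B := 0) (t0 := t0) (c := m) oD bD (lexx 0) t00 rpsi psi0.
  rewrite (_ : (fun x => dot (dpsi x) (field 0 m x)) = (fun x => dot (dpsi x) m)); last first.
    by apply/funext => x; rewrite /field !mul0r !subr0 -surjective_pairing.
  rewrite mulr0 mul0r addr0; apply => t tt; rewrite mulr0.
  apply: le_trans (_ : II D (fun=> 0) <= 0); last by rewrite (II_cst mD) mul0r.
  rewrite le_eqVlt; apply/orP; left; apply/eqP; apply: eq_Rintegral => x /set_mem Dx.
  rewrite indicE; have [px|] := ltP 0 (psi x); last first.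
    by move=> px; rewrite (_ : psi x = 0) ?mulr0//; apply/le_anti/andP; split => //; exact: psi0.
  rewrite memNset ?mul0r//= => nD; apply: nD.
  rewrite (_ : field 0 m x = m); last by rewrite /field !mul0r !subr0 -surjective_pairing.
  have rx : 0 < raise u x0 k h x.
    by have := raise_ge0 u x0 k h x; rewrite le_eqVlt => /predU1P[r0|//]; move: px; rewrite /psi -r0 mulr0 ltxx.
  apply: (far _ _ Dx rx) => //; rewrite -hvE; apply: chi_pos.
  by rewrite lt_neqAle; have /andP[-> _] := chi01 x; rewrite andbT; apply: contraTneq px => c0; rewrite /psi -c0 mul0r ltxx.
pose r := 2 * kink_scale * (norm1 y1 + norm1 y2 + 1) * h.
have n0 := norm1_ge0 y1; have n0' := norm1_ge0 y2.
have n3 : 0 < norm1 y1 + norm1 y2 + 1 by lra.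
have r0 : 0 < r by apply: mulr_gt0 => //; apply: mulr_gt0 => //; exact: mulr_gt0.
pose Q : set (R * R) := near_pt x0 r.
have mQ : measurable (Q : set R2) by rewrite /Q near_pt_box; exact: box_measurable.
pose K2 := (Kb + M + 2 * (norm1 a1 + norm1 a2) / kink_scale) * (2 * Kb + norm1 x0).
have Kb0 : 0 <= Kb by exact: le_trans k1.
have k3 : 0 <= 2 * (norm1 a1 + norm1 a2) / kink_scale.
  apply: divr_ge0; last exact: ltW.
  by apply: mulr_ge0 => //; apply: addr_ge0; exact: norm1_ge0.
have KM0 : 0 <= Kb + M by exact: addr_ge0.
have k4 : 0 <= Kb + M + 2 * (norm1 a1 + norm1 a2) / kink_scale by exact: addr_ge0.
have K20 : 0 <= K2.
  apply: mulr_ge0 => //; apply: addr_ge0; [exact: mulr_ge0|exact: norm1_ge0].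
have bQ : bm D (fun x => \1_(Q : set R2) x) by exact: bm_indic.
have b1' := bm_dotr x0 k h bD lu m.
have b2' : bm D (fun x => dot (dpsi x) m).
  by have [_ _ [? ?] _ _] := rpsi; apply: bm_dot => //; exact: bm_cst.
have main : II D (fun x => dot (draise u x0 k h x) m) <=
    II D (fun x => dot (dpsi x) m + K2 * \1_(Q : set R2) x).
  apply: II_le_ae => //; first by apply: bmD => //; exact: bmZ.
  apply: (ae_in3 (raise_dichotomy D x0 k h lu)
    (ae_gd_plane (b := P 1) D (lc_ 1) (fun y => le_max_l _ _))
    (ae_gd_plane (b := P 2) D (lc_ 2) (fun y => le_max_l _ _))).
  move=> x Dx hd g1 g2.
  have Q0 : 0 <= K2 * \1_(Q : set R2) x by rewrite mulr_ge0// indicE.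
  case: hd => [[p0 d0]|[p0 gw _]].
    by rewrite /dpsi p0 d0 /dot /=; lra.
  have [hx|hx] := leP (dot hv (vs x x0)) (2 * L); last first.
    have [c1 e1 e2] := chi_one _ hx.
    have dc : dchi x = (0, 0).
      by rewrite /dchi g1 ?e1// g2 ?e2// /vs /P /= !subrr.
    rewrite (_ : dpsi x = draise u x0 k h x) ?lerDl//.
    have [e3 e4] : (dchi x).1 = 0 /\ (dchi x).2 = 0 by rewrite dc.
    by rewrite /dpsi c1 e3 e4 !mulr0 !addr0 !mul1r -surjective_pairing.
  have xQ : Q x by apply: kink_near => //; rewrite -hvE.
  rewrite indicE mem_set// mulr1.
  have [gu1 gu2] := lipc_gd x lu.
  have dr1 : `|(draise u x0 k h x).1| <= Kb + M.
    by rewrite /draise gw /vs /=; apply: le_trans (ler_normB _ _) _; exact: lerD.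
  have dr2 : `|(draise u x0 k h x).2| <= Kb + M.
    by rewrite /draise gw /vs /=; apply: le_trans (ler_normB _ _) _; exact: lerD.
  have [gc1 gc2] := lipc_gd x (lc_ 1); have [gc3 gc4] := lipc_gd x (lc_ 2).
  have dc1 : `|(dchi x).1| <= 2 * N.
    by rewrite /dchi /vs /=; apply: le_trans (ler_normB _ _) _; rewrite mulr_natl mulr2n lerD.
  have dc2 : `|(dchi x).2| <= 2 * N.
    by rewrite /dchi /vs /=; apply: le_trans (ler_normB _ _) _; rewrite mulr_natl mulr2n lerD.
  have := dot_abs m dr1 dr2; have := dot_abs m dc1 dc2.
  rewrite (_ : dot (dpsi x) m = chi x * dot (draise u x0 k h x) m +
     raise u x0 k h x * dot (dchi x) m); last by rewrite /dpsi /dot /=; ring.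
  have rh := raise_le h0 kink_below Dx.
  have mn : norm1 m <= 2 * Kb + norm1 x0.
    rewrite /norm1 /m /vs /=.
    by move: k1 k2 (ler_normB k.1 x0.1) (ler_normB k.2 x0.2); clear_local; lra.
  have /andP[c0 c1] := chi01 x.
  rewrite !ler_norml => /andP[l1 _] /andP[_ l4].
  have nm := norm1_ge0 m.
  have f1 : (1 - chi x) * dot (draise u x0 k h x) m <= (Kb + M) * norm1 m.
    apply: le_trans (ler_wpM2l _ l4) _; first by rewrite subr_ge0.
    by rewrite -[leRHS]mul1r; apply: ler_wpM2r; [exact: mulr_ge0|rewrite gerBl].
  have f2 : - (raise u x0 k h x * dot (dchi x) m) <= h * (2 * N * norm1 m).
    rewrite -mulrN; apply: le_trans (ler_wpM2l (ltW p0) (_ : _ <= 2 * N * norm1 m)) _; first by rewrite lerNl.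
    by apply: ler_wpM2r => //; apply: mulr_ge0 => //; exact: mulr_ge0.
  have f3 : (Kb + M) * norm1 m + h * (2 * N * norm1 m) <= K2.
    rewrite (_ : _ + _ = (Kb + M + 2 * (norm1 a1 + norm1 a2) / kink_scale) * norm1 m); last first.
      by rewrite /N /L; field; rewrite !gt_eqF.
    exact: ler_wpM2l.
  by move: f1 f2 f3; clear_local; lra.
apply: le_trans main _; rewrite (IID mD fD)//; last exact: bmZ.
rewrite (IIZ mD fD)// (II_indic mD)//.
have q1 := fine_measure_near x0 oD bD r0.
have := ler_wpM2l K20 q1; rewrite /kink_flux_const -/K2.
rewrite (_ : (2 * r) ^+ 2 = (4 * kink_scale * (norm1 y1 + norm1 y2 + 1)) ^+ 2 * h ^+ 2); last first.
  by rewrite /r; ring.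
lra.
Qed.

End sliver.

Section sliver_mass.
Context {R : realType}.
Local Notation mu := (@plane_measure R).
Local Notation R2 := (measurableTypeR R * measurableTypeR R)%type.
Implicit Types (D : set (R * R)) (u : R * R -> R) (x y z p q k : R * R).

Lemma crs_dual p q y1 y2 : dual_basis y1 y2 p q -> crs p q * crs y1 y2 = 1.
Proof.
move=> [h1 h2 h3 h4 _].
rewrite (_ : crs p q * crs y1 y2 = dot p y1 * dot q y2 - dot p y2 * dot q y1).
  by rewrite h1 h2 h3 h4; ring.
by rewrite /crs /dot; ring.
Qed.

Lemma dual_basis_measure p q y1 y2 x0 : dual_basis y1 y2 p q ->
  let P := [set x | 0 < dot p (vs x x0) < 2^-1 /\ 0 < dot q (vs x x0) < 2^-1] in
  measurable (P : set R2) /\ mu (P : set R2) = (`|crs y1 y2| / 4)%:E.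
Proof.
move=> hb P; have hc := crs_dual hb.
have d0 : p.1 * q.2 - p.2 * q.1 != 0.
  by apply/eqP => d0; move: hc; rewrite {1}/crs d0 mul0r => /eqP; rewrite eq_sym oner_eq0.
have [mT hT] := scales_measure_affine (- dot p x0) (- dot q x0) d0.
have PE : (P : set R2) = affine_map p.1 p.2 q.1 q.2 (- dot p x0) (- dot q x0) @^-1` (box 0 2^-1 0 2^-1 : set R2).
  apply/seteqP; split => x; rewrite /P /box /affine_map /dot /vs /=.
    by move=> [/andP[? ?] /andP[? ?]]; split; lra.
  by move=> [? ? ? ?]; split; apply/andP; split; lra.
have mB := @box_measurable R 0 2^-1 0 2^-1.
split; first by rewrite PE -[X in measurable X]setTI; exact: mT.
rewrite PE hT// box_measure ?invr_ge0// -EFinM; congr EFin.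
have -> : `|p.1 * q.2 - p.2 * q.1|^-1 = `|crs y1 y2|.
  rewrite -[LHS]mul1r -(normr1 R) -hc normrM /crs mulrAC mulfV ?mul1r//.
  by rewrite normr_eq0.
by field.
Qed.

(** The raised set contains a parallelogram of a quarter of the area spanned by [l ym] and [l yp];
    coordinates below [1/2] keep it in the triangle with apex [x0]. *)
Lemma sliver_mass D u (M : R) x0 k y1 y2 (s t dl e : R) :
  open D -> cset D -> bounded_set D -> lipc M u -> closure D x0 ->
  D (mv x0 1 y1) -> D (mv x0 1 y2) -> 0 < dl -> 0 < e -> 0 <= s -> s < t -> t <= 1 ->
  crs y1 y2 != 0 ->
  excess u x0 k (cb s y1 y2) <= 3 * dl * e -> excess u x0 k (cb t y1 y2) <= 3 * dl * e ->
  exists2 h0 : R, 0 < h0 & forall h, 0 < h <= h0 ->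
    h ^+ 2 * (t - s) * `|crs y1 y2| / (144 * dl ^+ 2 * e ^+ 2) <= sraise D u x0 k h.
Proof.
move=> oD cD bD lu cx0 Dy1 Dy2 dl0 e0 s0 st t1 c0 Es Et.
have cu : cvx setT u by case: lu.
have de0 : 0 < dl * e by exact: mulr_gt0.
set ym := cb s y1 y2 in Es *; set yp := cb t y1 y2 in Et *.
have [sm sm0 hm] := tg_near x0 cu ym de0.
have [sp sp0 hp] := tg_near x0 cu yp de0.
pose m := Num.min 1 (Num.min sm sp).
have m0 : 0 < m by rewrite !lt_min ltr01 sm0.
exists (6 * (dl * e) * m); first by rewrite !mulr_gt0.
move=> h /andP[h0 hh].
(* At distance [l] the excess [3 dl e], plus an error [dl e] for replacing [u] by its tangent cone,
   amounts to [2/3 h], still below the height. The constant 144 is [4 * 6^2]. *)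
pose l := h / (6 * (dl * e)).
have l0 : 0 < l by rewrite divr_gt0// mulr_gt0.
have lm : l <= m by rewrite ler_pdivrMr ?mulr_gt0// mulrC.
have hl : h = 6 * (dl * e) * l by rewrite /l mulrC mulfVK// gt_eqF// mulr_gt0.
have [l1 [l2 l3]] : l <= 1 /\ l <= sm /\ l <= sp.
  by move: lm; rewrite /m !le_min => /andP[? /andP[]].
have i1 : 0 <= 1 - l < 1 by apply/andP; split; lra.
have mem r : 0 <= r <= 1 -> D (mv x0 l (cb r y1 y2)).
  move=> r01; have := closure_cb oD cD (cD _ _ _ Dy1 Dy2 r01) cx0 i1; congr D.
  by rewrite /cb /mv /=; congr pair; ring.
have D1 : D (mv x0 l ym) by apply: mem; apply/andP; split; lra.
have D2 : D (mv x0 l yp) by apply: mem; apply/andP; split; lra.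
have u1 : u (mv x0 l ym) <= u x0 + l * dot k ym + 2 / 3 * h.
  have := hm l; rewrite l0 l2 => /(_ isT); move: Es; rewrite /excess => Es.
  have := ler_wpM2l (ltW l0) Es; rewrite hl; lra.
have u2 : u (mv x0 l yp) <= u x0 + l * dot k yp + 2 / 3 * h.
  have := hp l; rewrite l0 l3 => /(_ isT); move: Et; rewrite /excess => Et.
  have := ler_wpM2l (ltW l0) Et; rewrite hl; lra.
pose w1 := sc l ym; pose w2 := sc l yp.
have cw : crs w1 w2 = l ^+ 2 * (t - s) * crs y1 y2.
  by rewrite /w1 /w2 /ym /yp /crs /sc /cb /=; ring.
have cw0 : crs w1 w2 != 0.
  by rewrite cw mulf_neq0// mulf_neq0 ?expf_neq0 ?subr_eq0 ?gt_eqF.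
have [p [q hb]] := dual_basisP cw0.
have [] := dual_basis_measure x0 hb.
set P := [set x | _] => mP muP.
have sub x : P x -> D x /\ 0 < raise u x0 k h x.
  rewrite /P /= => -[]; have [_ _ _ _ /(_ (vs x x0))] := hb.
  move: (dot p _) (dot q _) => a c yE /andP[a0 a1] /andP[c00 c1].
  have ac : 0 < a + c by exact: addr_gt0.
  have i2 : 0 <= c / (a + c) <= 1.
    by apply/andP; split; [by apply: divr_ge0; exact: ltW|by rewrite ler_pdivrMr// mul1r lerDr ltW].
  have i3 : 0 <= 1 - (a + c) < 1 by clear -a0 a1 c00 c1; apply/andP; split; lra.
  set z := cb (c / (a + c)) (mv x0 l ym) (mv x0 l yp).
  have Dz : D z := cD _ _ _ D1 D2 i2.
  have xE : x = cb (1 - (a + c)) z x0.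
    rewrite [LHS](vsE x0 x) yE /z /w1 /w2 /mv /cb /lc /sc /=.
    by congr pair; field; rewrite gt_eqF.
  split; first by rewrite xE; exact: closure_cb.
  apply: lt_le_trans (raise_ge u x0 k h x); rewrite raise_plE yE.
  have i4 : 0 <= 1 - (a + c) <= 1 by clear -a0 a1 c00 c1; apply/andP; split; lra.
  have h1 := cu z x0 (1 - (a + c)) I I i4; rewrite -xE in h1.
  have h2 := cu (mv x0 l ym) (mv x0 l yp) _ I I i2; rewrite -/z in h2.
  have h3 : (a + c) * u z <= a * u (mv x0 l ym) + c * u (mv x0 l yp).
    apply: le_trans (ler_wpM2l (ltW ac) h2) _; rewrite le_eqVlt; apply/orP; left; apply/eqP.
    by field; rewrite gt_eqF.
  have h4 := ler_wpM2l (ltW a0) u1; have h5 := ler_wpM2l (ltW c00) u2.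
  have h6 : (a + c) * (2 / 3 * h) < h by clear -a0 a1 c00 c1 h0; nra.
  rewrite (_ : dot k (lc a c w1 w2) = a * (l * dot k ym) + c * (l * dot k yp)); last first.
    by rewrite /w1 /w2 /lc /sc /dot /=; ring.
  clear -h1 h3 h4 h5 h6; lra.
have mD := open_plane_measurable oD.
have fD := bounded_measure oD bD.
have mS := measurable_raise_set x0 k h lu.
rewrite /sraise (II_indic mD)//.
apply: le_trans (_ : fine (mu (P : set R2)) <= _).
  rewrite muP /= cw normrM ger0_norm; last first.
    by apply: mulr_ge0; [rewrite exprn_ge0// ltW|lra].
  rewrite le_eqVlt; apply/orP; left; apply/eqP; rewrite /l; field.
  by rewrite !gt_eqF.
apply: fine_le.
- by rewrite muP.
- rewrite ge0_fin_numE//; apply: le_lt_trans fD; apply: le_measure; rewrite ?inE//.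
  exact: measurableI.
apply: le_measure; rewrite ?inE//; first exact: measurableI.
Qed.

End sliver_mass.

(** * Kinks of a convex function of one variable *)

Section one_variable.
Context {R : realType}.

Lemma three_points (m : R -> R) (x y z : R) :
  (forall s t l, 0 <= s <= 1 -> 0 <= t <= 1 -> 0 <= l <= 1 ->
    m ((1 - l) * s + l * t) <= (1 - l) * m s + l * m t) ->
  0 <= x -> z <= 1 -> x <= y -> y <= z -> (z - x) * m y <= (z - y) * m x + (y - x) * m z.
Proof.
move=> cm x0 z1 xy yz.
have [xz|xz] := eqVneq x z.
  by have -> : y = z; [lra|rewrite xz subrr !mul0r addr0].
have zx : 0 < z - x by rewrite subr_gt0 lt_neqAle xz/=; lra.
have l01 : 0 <= (y - x) / (z - x) <= 1.
  by apply/andP; split; [apply: divr_ge0; lra|rewrite ler_pdivrMr//; lra].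
have xI : 0 <= x <= 1 by apply/andP; split; lra.
have zI : 0 <= z <= 1 by apply/andP; split; lra.
have := cm _ _ _ xI zI l01.
rewrite (_ : _ + _ * z = y); last by field; rewrite gt_eqF.
move=> h; apply: le_trans (ler_wpM2l (ltW zx) h) _; rewrite le_eqVlt; apply/orP; left; apply/eqP.
by field; rewrite gt_eqF.
Qed.

(** Taking the last minimizer makes the slope over [[b, b + e]] positive for every [e], whence a
    positive [dl] in [convex_kink]. *)
Lemma last_argmin (m : R -> R) (K : R) : 0 <= K -> (forall s t, m s - m t <= K * `|s - t|) ->
  exists2 b, 0 <= b <= 1 & forall t, 0 <= t <= 1 -> m b <= m t /\ (b < t -> m b < m t).
Proof.
move=> K0 lm.
have cm : {within `[0, 1]%classic, continuous m}.
  apply: continuous_subspaceT => x; apply/cvgrPdist_le => e e0.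
  have K1 : 0 < K + 1 by lra.
  near=> y.
  have xy : `|x - y| < e / (K + 1).
    by near: y; apply: cvgr_dist_lt => //; exact: divr_gt0.
  have h : K * `|x - y| <= e.
    move: xy; rewrite ltr_pdivlMr//; have := normr_ge0 (x - y); nra.
  rewrite ler_norml; have := lm x y; have := lm y x; rewrite (distrC y).
  by move=> h1 h2; apply/andP; split; lra.
have [c] := EVT_min ler01 cm; rewrite in_itv/= => c01 hc.
pose A := [set t : R | 0 <= t <= 1 /\ m t <= m c].
have hA : has_sup A.
  split; first by exists c.
  by exists 1 => t [/andP[]].
have b01 : 0 <= sup A <= 1.
  apply/andP; split; last by apply: ge_sup; [exists c|move=> t [/andP[]]].
  case/andP: c01 => c0 c1; apply: (le_trans c0).
  by apply: ub_le_sup; [exact: hA.2|split => //; apply/andP; split].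
have mb : m (sup A) <= m c.
  apply/ler_addgt0Pr => e e0.
  have K1 : 0 < K + 1 by lra.
  have [t At tb] := sup_adherent (divr_gt0 e0 K1) hA.
  have tb' : t <= sup A by apply: ub_le_sup => //; exact: hA.2.
  have := lm (sup A) t; rewrite ger0_norm ?subr_ge0// => h.
  have h2 : K * (sup A - t) <= e.
    have : (sup A - t) * (K + 1) < e by rewrite -ltr_pdivlMr//; lra.
    have : 0 <= sup A - t by lra.
    nra.
  by case: At => _; lra.
exists (sup A) => // t t01; split.
  by apply: le_trans mb _; apply: hc; rewrite in_itv.
move=> bt; rewrite ltNge; apply/negP => mt.
have : t <= sup A by apply: ub_le_sup; [exact: hA.2|split => //; lra].
by rewrite leNgt bt.
Unshelve. all: by end_near.
Qed.

(* The line [kap] has the mean of the two slopes of [m] over [[b - e, b]] and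
   [[b, b + e]], and is lowered so that it stays below [m]. *)
Lemma convex_kink (m : R -> R) (K ts : R) :
  (forall s t l, 0 <= s <= 1 -> 0 <= t <= 1 -> 0 <= l <= 1 ->
    m ((1 - l) * s + l * t) <= (1 - l) * m s + l * m t) ->
  0 <= K -> (forall s t, m s - m t <= K * `|s - t|) -> m 0 = 0 -> m 1 = 0 ->
  0 <= ts <= 1 -> m ts < 0 ->
  exists b g, [/\ 0 < b < 1, 0 < g & forall e, 0 < e -> e <= b -> e <= 1 - b ->
    exists dl sg, let kap t := - (2 * g) - 2 * dl * e + sg * (t - b) in
    [/\ 0 < dl <= K, `|sg| <= K,
      forall t, 0 <= t <= 1 -> dl * `|t - b| <= m t - kap t /\ dl * e <= m t - kap t,
      [/\ m (b - e) - kap (b - e) <= 3 * dl * e, m (b + e) - kap (b + e) <= 3 * dl * e &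
        m b - kap b = 2 * dl * e] &
      g <= m 0 - kap 0 /\ g <= m 1 - kap 1]].
Proof.
move=> cm K0 lm m0 m1 ts01 mts.
have [b b01 hb] := last_argmin K0 lm.
have mb : m b < 0 by have [] := hb _ ts01; lra.
have /andP[b0 b1] : 0 < b < 1.
  case/andP: b01 => b0 b1; rewrite !lt_neqAle b0 b1 !andbT.
  apply/andP; split; apply/eqP => bE; move: mb.
    by rewrite -bE m0 ltxx.
  by rewrite bE m1 ltxx.
exists b, (- m b / 2); split; [by apply/andP|by rewrite divr_gt0// oppr_gt0|].
move=> e e0 eb eb'.
pose sp := (m (b + e) - m b) / e; pose sm := (m b - m (b - e)) / e.
have spE : m (b + e) = m b + sp * e by rewrite /sp mulfVK ?gt_eqF//; ring.
have smE : m (b - e) = m b - sm * e by rewrite /sm mulfVK ?gt_eqF//; ring.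
have sp0 : 0 < sp.
  rewrite divr_gt0// subr_gt0; apply: (hb _ _).2; [apply/andP; split; lra|lra].
have sm0 : sm <= 0.
  rewrite ler_pdivrMr// mul0r subr_le0; apply: (hb _ _).1; apply/andP; split; lra.
have spK : sp <= K.
  rewrite ler_pdivrMr//; have := lm (b + e) b.
  by rewrite (_ : b + e - b = e); [rewrite gtr0_norm|ring].
have smK : - K <= sm.
  rewrite ler_pdivlMr//; have := lm (b - e) b.
  by rewrite (_ : b - e - b = - e); [rewrite normrN gtr0_norm//; lra|ring].
have R1 t : b <= t <= 1 -> m b + sm * (t - b) <= m t.
  move=> /andP[t0 t1]; have := @three_points m (b - e) b t cm.
  move=> /(_ _ t1 _ t0) H; have {}H := H ltac:(lra) ltac:(lra).
  rewrite smE in H; rewrite -(ler_pM2l e0); lra.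
have R2 t : b + e <= t <= 1 -> m b + sp * (t - b) <= m t.
  move=> /andP[t0 t1]; have := @three_points m b (b + e) t cm.
  move=> /(_ _ t1 _ t0) H; have {}H := H ltac:(lra) ltac:(lra).
  rewrite spE in H; rewrite -(ler_pM2l e0); lra.
have L1 t : 0 <= t <= b -> m b + sp * (t - b) <= m t.
  move=> /andP[t0 t1]; have := @three_points m t b (b + e) cm t0.
  move=> /(_ _ t1 _) H; have {}H := H ltac:(lra) ltac:(lra).
  rewrite spE in H; rewrite -(ler_pM2l e0); lra.
have L2 t : 0 <= t <= b - e -> m b + sm * (t - b) <= m t.
  move=> /andP[t0 t1]; have := @three_points m t (b - e) b cm t0.
  move=> /(_ _ t1 _) H; have {}H := H ltac:(lra) ltac:(lra).
  rewrite smE in H; rewrite -(ler_pM2l e0); lra.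
clearbody sp sm; clear cm lm hb ts01 mts b01 K0 ts.
(* [dl] is half the jump between the two slopes and [sg] their mean; since [g = - m b / 2], the line
   passes [2 dl e] below [m b]. *)
exists ((sp - sm) / 2), ((sp + sm) / 2) => kap.
have kE t : kap t = m b - (sp - sm) * e + (sp + sm) / 2 * (t - b) by rewrite /kap; field.
have q0 : 0 <= (sp - sm) * e by rewrite mulr_ge0 ?(ltW e0)//; lra.
split.
- by apply/andP; split; lra.
- by rewrite ler_norml; apply/andP; split; lra.
- move=> t /andP[t0 t1]; rewrite kE; clear kE kap spE smE m0 m1 spK smK mb b0 b1 eb eb'.
  have [bt|bt] := leP b t.
    rewrite ger0_norm ?subr_ge0//; have [te|te] := leP (b + e) t.
      have := R2 t; rewrite te t1 => /(_ isT) h; split; first lra.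
      have : (sp - sm) * e <= (sp - sm) * (t - b) by apply: ler_wpM2l; lra.
      lra.
    have := R1 t; rewrite bt t1 => /(_ isT) h.
    have : (sp - sm) * (t - b) <= (sp - sm) * e by apply: ler_wpM2l; lra.
    by split; lra.
  rewrite ltr0_norm ?subr_lt0//; have [te|te] := leP t (b - e).
    have := L2 t; rewrite te t0 => /(_ isT) h; split; first lra.
    have : (sp - sm) * e <= (sp - sm) * (b - t) by apply: ler_wpM2l; lra.
    lra.
  have := L1 t; rewrite (ltW bt) t0 => /(_ isT) h.
  have : (sp - sm) * (b - t) <= (sp - sm) * e by apply: ler_wpM2l; lra.
  by split; lra.
- by rewrite !kE spE smE; clear; split; lra.
- rewrite !kE m0 m1.
  have h1 := R2 1; have h2 := L2 0.
  have {}h1 := h1 ltac:(by rewrite lexx -lerBrDl eb').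
  have {}h2 := h2 ltac:(by rewrite lexx subr_ge0).
  move: h2 h1.
  rewrite m0 m1 => h3 h4.
  have h5 : 0 <= sp * b by rewrite mulr_ge0// ltW.
  have h6 : sm * (1 - b) <= 0 by rewrite mulr_le0_ge0// subr_ge0 ltW.
  by split; lra.
Qed.

End one_variable.

Lemma min3_le {R : realType} (a b c : R) :
  Num.min a (Num.min b c) <= a /\ Num.min a (Num.min b c) <= b /\ Num.min a (Num.min b c) <= c.
Proof. by rewrite !ge_min !lexx !orbT. Qed.

Section tangent_linear.
Context {R : realType}.
Implicit Types (x y z p q k : R * R).
Variables (D : set (R * R)) (u : R * R -> R) (M : R) (x0 : R * R).
Hypotheses (oD : open D) (cD : cset D) (bD : bounded_set D).
Hypotheses (lu : lipc M u) (u0 : forall x, 0 <= u x) (mu_ : minimizes D u).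
Hypotheses (cx0 : closure D x0) (nDx0 : ~ D x0).

Let cu : cvx setT u. Proof. by case: lu. Qed.

(** The scales in [raise_contra]: [A] is at most of order [1/dl], as [dl <= dm] bounds [dl] by a
    multiple of [d1]; the flux is of order [h^2] and the area at least of order [h^2 / (dl^2 e)], so
    [B] is of order [dl^2 e]. Thus [A^2 B] is of order [e], uniformly in [k] and [dl]; [h] is chosen
    last. *)
Lemma sliver y1 y2 a1 a2 (b g Kb dm : R) : D (mv x0 1 y1) -> D (mv x0 1 y2) ->
  dual_basis y1 y2 a1 a2 -> 0 < b < 1 -> 0 < g -> 0 <= dm ->
  exists2 W : R, 0 < W & forall k dl e, 0 < dl -> dl <= dm -> 0 < e -> e <= b -> e <= 1 - b ->
    `|k.1| <= Kb -> `|k.2| <= Kb ->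
    excess u x0 k (cb b y1 y2) <= g / 2 * b ->
    excess u x0 k (cb b y1 y2) <= g / 2 * (1 - b) ->
    g <= excess u x0 k y1 -> g <= excess u x0 k y2 ->
    (forall t : R, 0 <= t <= 1 -> dl * `|t - b| <= excess u x0 k (cb t y1 y2)) ->
    (forall t : R, 0 <= t <= 1 -> dl * e <= excess u x0 k (cb t y1 y2)) ->
    excess u x0 k (cb (b - e) y1 y2) <= 3 * dl * e ->
    excess u x0 k (cb (b + e) y1 y2) <= 3 * dl * e -> 1 <= W * e.
Proof.
have A1 (c d : R) : 216 * c * d <= 1 -> 36 * c * (3 * d) <= 2^-1 by move=> ?; lra.
have A3 (c d : R) : 0 < d -> c - d < c + d by move=> ?; lra.
have A2 (c d : R) : 0 < d -> 1 <= c * d + 2^-1 -> 1 <= (2 * c + 1) * d by move=> ? ?; lra.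
move=> Dy1 Dy2 ba b01 g0 dm0; have /andP[b0 b1] := b01.
have [C C0 hC] := bounded_closure bD.
have c0 : crs y1 y2 != 0.
  by apply/eqP => c0; have := crs_dual ba; rewrite c0 mulr0 => /eqP; rewrite eq_sym oner_eq0.
have nc0 : 0 < `|crs y1 y2| by rewrite normr_gt0.
pose bb := Num.min b (1 - b).
have bb0 : 0 < bb by rewrite lt_min b0/=; lra.
pose C2 := `|kink_flux_const M x0 y1 y2 a1 a2 b g Kb|.
pose rho := Num.max 1 (2 * dm / g).
have rho1 : 1 <= rho by rewrite le_max lexx.
pose W0 := 36 * 16 * 72 * C ^+ 2 * rho ^+ 2 * C2 / (bb ^+ 2 * `|crs y1 y2|).
have W00 : 0 <= W0.
  apply: divr_ge0; last by apply: mulr_ge0; [exact: sqr_ge0|exact: ltW].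
  apply: mulr_ge0; last exact: normr_ge0.
  by apply: mulr_ge0; [apply: mulr_ge0 => //|]; exact: sqr_ge0.
exists (2 * W0 + 1); first lra.
move=> k dl e dl0 dldm e0 eb eb' k1 k2 Eb1 Eb2 Ey1 Ey2 E1 E2 E3 E4.
pose d1 := Num.min dl (g / 2).
have d10 : 0 < d1 by rewrite lt_min dl0 divr_gt0.
have bd0 : 0 < bb * d1 by exact: mulr_gt0.
pose A := 4 * C / (bb * d1).
have A0 : 0 < A by rewrite divr_gt0// mulr_gt0.
have below : forall x, D x -> u x0 + dot k (vs x x0) <= u x.
  by move=> x Dx; apply: (kink_below cD lu nDx0 Dy1 Dy2 ba b01 g0 dl0 Eb1 Eb2 Ey1 Ey2 E1 E2).
have be0 : 0 <= b - e by rewrite subr_ge0.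
have be1 : b + e <= 1 by rewrite -lerBrDl.
have bee : b - e < b + e by exact: A3.
have [h0 h00 mass] := sliver_mass oD cD bD lu cx0 Dy1 Dy2 dl0 e0 be0 bee be1 c0 E3 E4.
have de0 : 0 < dl * e by exact: mulr_gt0.
have WA0 : 0 < 216 * A ^+ 2 := mulr_gt0 (ltr0Sn _ 215) (exprn_gt0 2 A0).
pose h := Num.min (Num.min h0 (bb * d1 / 6)) (Num.min (dl * e / 2) (216 * A ^+ 2)^-1).
have hp : 0 < h by rewrite !lt_min h00 invr_gt0 WA0 !divr_gt0.
have [[hh1 hh2] [hh3 hh4]] : (h <= h0 /\ h <= bb * d1 / 6) /\
    (h <= dl * e / 2 /\ h <= (216 * A ^+ 2)^-1).
  by rewrite /h !ge_min !lexx !orbT.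
have t1 := kink_thin oD cD bD lu nDx0 Dy1 Dy2 ba b01 g0 dl0 Eb1 Eb2 Ey1 Ey2 E1 E2 hp hh2 hC.
rewrite -/bb -/d1 -/A in t1.
have t2 := kink_flux oD cD bD lu cx0 nDx0 Dy1 Dy2 ba b01 g0 dl0 e0 Eb1 Eb2 Ey1 Ey2 E1 E2 k1 k2 hp hh3.
have := mass h; rewrite hp hh1 => /(_ isT) t3.
pose B := C2 * 72 * dl ^+ 2 * e / `|crs y1 y2|.
have B0 : 0 <= B.
  apply: divr_ge0; last exact: ltW.
  apply: mulr_ge0; last exact: ltW.
  by apply: mulr_ge0; [apply: mulr_ge0 => //; exact: normr_ge0|exact: sqr_ge0].
have t4 : II D (fun x => dot (draise u x0 k h x) (vs k x0)) <= B * sraise D u x0 k h.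
  apply: le_trans t2 _; apply: le_trans (_ : C2 * h ^+ 2 <= _).
    by apply: ler_wpM2r; [rewrite exprn_ge0// ltW|exact: ler_norm].
  apply: le_trans (ler_wpM2l B0 t3); rewrite le_eqVlt; apply/orP; left; apply/eqP.
  by rewrite /B; field; rewrite !gt_eqF.
have := raise_contra oD cD bD lu u0 mu_ cx0 hp below A0 t1 t4.
have t5 : 36 * A ^+ 2 * B <= W0 * e.
  have r1 : dl <= rho * d1.
    rewrite /d1; case: (leP dl (g / 2)) => hd.
      by rewrite -[leLHS]mul1r; apply: ler_wpM2r => //; exact: ltW.
    apply: le_trans dldm _; apply: le_trans (_ : 2 * dm / g * (g / 2) <= _).
      by rewrite le_eqVlt; apply/orP; left; apply/eqP; field; rewrite gt_eqF.
    by apply: ler_wpM2r; [rewrite divr_ge0// ltW|rewrite /rho le_max lexx orbT].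
  have rd : 0 <= rho * d1 by apply: le_trans r1; exact: ltW.
  have r2 : dl ^+ 2 <= (rho * d1) ^+ 2 by rewrite ler_sqr// nnegrE ltW.
  rewrite (_ : 36 * A ^+ 2 * B = 36 * 16 * 72 * C ^+ 2 * C2 * e / (bb ^+ 2 * d1 ^+ 2 * `|crs y1 y2|) * dl ^+ 2); last first.
    by rewrite /A /B; field; rewrite !gt_eqF.
  apply: le_trans (ler_wpM2l _ r2) _.
    apply: divr_ge0.
      apply: mulr_ge0; last exact: ltW.
      apply: mulr_ge0; last exact: normr_ge0.
      by apply: mulr_ge0 => //; exact: sqr_ge0.
    apply: mulr_ge0; last exact: ltW.
    by apply: mulr_ge0; exact: sqr_ge0.
  rewrite le_eqVlt; apply/orP; left; apply/eqP; rewrite /W0; field.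
  by rewrite !gt_eqF.
have t6 : 36 * A ^+ 2 * (3 * h) <= 2^-1.
  have : (216 * A ^+ 2) * h <= 1 by rewrite -ler_pdivlMl// mulr1.
  exact: A1.
by rewrite mulrDr => t7; exact: A2 e0 (le_trans t7 (lerD t5 t6)).
Qed.

Lemma dot_cb p t y z : dot p (cb t y z) = (1 - t) * dot p y + t * dot p z.
Proof. by rewrite /dot /cb /=; ring. Qed.

(** If affinity fails, subtracting the linear form [ph] that agrees with [tg] at [y1] and [y2]
    leaves a convex function [m] on the segment, zero at the ends and negative inside. [convex_kink]
    then supplies slopes [k] for arbitrarily small [e], against [sliver]. *)
Lemma tg_affine y1 y2 t : D (mv x0 1 y1) -> D (mv x0 1 y2) -> crs y1 y2 != 0 -> 0 <= t <= 1 ->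
  tg u x0 (cb t y1 y2) = (1 - t) * tg u x0 y1 + t * tg u x0 y2.
Proof.
have B1 (s b : R) : 0 <= s -> s <= 1 -> 0 < b -> b < 1 -> `|s - b| <= 1.
  by move=> ? ? ? ?; rewrite ler_norml; apply/andP; split; lra.
have B2 (g K dl e v : R) : 0 < g -> 0 <= dl * e -> dl * e <= K -> - K <= v -> v <= K ->
    - (2 * g + 3 * K) <= - (2 * g) - 2 * dl * e + v /\
    - (2 * g) - 2 * dl * e + v <= 2 * g + 3 * K.
  by move=> ? ? ? ? ?; split; lra.
have B3 (k0 k1 c d k n : R) : 0 <= k -> k0 <= k -> k1 <= k -> `|c| + `|d| <= n ->
    k0 * `|c| + k1 * `|d| <= k * n.
  move=> kk h0 h1 h; apply: le_trans (ler_wpM2l kk h); rewrite mulrDr.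
  by apply: lerD; exact: ler_wpM2r.
have B4 (g bb b dl e : R) : 4 * (dl * e) <= g * bb -> g * bb <= g * b -> 2 * dl * e <= g / 2 * b.
  by move=> ? ?; lra.
have B6 (c e K x : R) : 0 <= e -> c <= K * e -> e * (4 * (K + 1)) <= x -> 4 * c <= x.
  by move=> ? ? ?; lra.
have B5 : (1 : R) <= 2^-1 -> False by lra.
move=> Dy1 Dy2 c0 t01; have st := sublin_tg x0 cu.
have [a1 [a2 ba]] := dual_basisP c0.
have [d11 d12 d21 d22 _] := ba.
have tle : tg u x0 (cb t y1 y2) <= (1 - t) * tg u x0 y1 + t * tg u x0 y2.
  by rewrite cb_lc; case/andP: t01 => ? ?; apply: sublin_lc => //; lra.
apply/eqP; rewrite eq_le tle /= leNgt; apply/negP => tlt.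
pose ph : R * R := lc (tg u x0 y1) (tg u x0 y2) a1 a2.
have dlc c d y : dot (lc c d a1 a2) y = c * dot a1 y + d * dot a2 y.
  by rewrite /dot /lc /=; ring.
have ph1 : dot ph y1 = tg u x0 y1 by rewrite dlc d11 d21; ring.
have ph2 : dot ph y2 = tg u x0 y2 by rewrite dlc d12 d22; ring.
have [E EE sE] : exists2 E, forall y, E y = tg u x0 y - dot ph y & sublin E.
  by exists (excess u x0 ph) => //; exact: sublin_sub.
pose m s := E (cb s y1 y2).
have m0 : m 0 = 0.
  by rewrite /m EE (_ : cb 0 y1 y2 = y1) ?ph1 ?subrr// [RHS]surjective_pairing /cb; congr pair; ring.
have m1 : m 1 = 0.
  by rewrite /m EE (_ : cb 1 y1 y2 = y2) ?ph2 ?subrr// [RHS]surjective_pairing /cb; congr pair; ring.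
have mt : m t < 0 by rewrite /m EE dot_cb ph1 ph2; lra.
have cm : forall s t l, 0 <= s <= 1 -> 0 <= t <= 1 -> 0 <= l <= 1 ->
    m ((1 - l) * s + l * t) <= (1 - l) * m s + l * m t.
  move=> s r l _ _ /andP[l0 l1]; rewrite /m.
  rewrite (_ : cb _ _ _ = lc (1 - l) l (cb s y1 y2) (cb r y1 y2)); last first.
    by rewrite /cb /lc /=; congr pair; ring.
  by apply: sublin_lc => //; lra.
pose K := Num.max 0 (Num.max (E (vs y2 y1)) (E (vs y1 y2))).
have K0 : 0 <= K by rewrite le_max lexx.
have [K1 K2] : E (vs y2 y1) <= K /\ E (vs y1 y2) <= K by rewrite /K !le_max !lexx !orbT.
have lm s r : m s - m r <= K * `|s - r|.
  have [sr|sr] := leP r s.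
    have sr' : 0 <= s - r by rewrite subr_ge0.
    rewrite ger0_norm//; have := sE.2 (cb r y1 y2) (sc (s - r) (vs y2 y1)).
    rewrite (sublin_homo _ sE sr') (_ : (_, _) = cb s y1 y2); last by rewrite /cb /sc /vs /=; congr pair; ring.
    by have := ler_wpM2l sr' K1; rewrite /m; lra.
  have sr' : 0 <= r - s by rewrite subr_ge0 ltW.
  rewrite ltr0_norm ?subr_lt0//; have := sE.2 (cb r y1 y2) (sc (r - s) (vs y1 y2)).
  rewrite (sublin_homo _ sE sr') (_ : (_, _) = cb s y1 y2); last by rewrite /cb /sc /vs /=; congr pair; ring.
  by have := ler_wpM2l sr' K2; rewrite /m; lra.
have [b [g [b01 g0 kink]]] := convex_kink cm K0 lm m0 m1 t01 mt.
have /andP[b0 b1] := b01.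
pose Kb := `|ph.1| + `|ph.2| + (2 * g + 3 * K) * (norm1 a1 + norm1 a2).
have [W W0 hW] := sliver Kb Dy1 Dy2 ba b01 g0 K0.
pose bb := Num.min b (1 - b).
have bb0 : 0 < bb by rewrite lt_min b0/=; lra.
have [bb1 bb2] : bb <= b /\ bb <= 1 - b by rewrite /bb !ge_min !lexx orbT.
have gK : 0 < 4 * (K + 1) by rewrite mulr_gt0// ltr_wpDl.
pose e := Num.min bb (Num.min (g * bb / (4 * (K + 1))) (2^-1 / W)).
have e0 : 0 < e.
  rewrite /e lt_min bb0 /= lt_min; apply/andP; split; apply: divr_gt0 => //.
  exact: mulr_gt0.
have [e1 [e2 e3]] : e <= bb /\ e <= g * bb / (4 * (K + 1)) /\ e <= 2^-1 / W.
  exact: min3_le.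
have eb : e <= b by exact: le_trans bb1.
have eb' : e <= 1 - b by exact: le_trans bb2.
have [dl [sg]] := kink e e0 eb eb'.
set kap := (fun t : R => _) => -[/andP[dl0 dlK] sgK k1 [k2 k3 k4] [k5 k6]].
pose q := lc (kap 0) (kap 1) a1 a2.
pose k : R * R := (ph.1 + q.1, ph.2 + q.2).
have kE y : excess u x0 k y = E y - dot q y by rewrite EE /excess /dot /k /=; ring.
have qE s : dot q (cb s y1 y2) = kap s.
  by rewrite dot_cb !dlc d11 d12 d21 d22 /kap; ring.
have mE s : excess u x0 k (cb s y1 y2) = m s - kap s by rewrite kE qE.
have y1E : y1 = cb 0 y1 y2 by rewrite [LHS]surjective_pairing /cb; congr pair; ring.
have y2E : y2 = cb 1 y1 y2 by rewrite [LHS]surjective_pairing /cb; congr pair; ring.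
have de : 4 * (dl * e) <= g * bb.
  rewrite ler_pdivlMr// in e2.
  have h : dl * e <= K * e by apply: ler_wpM2r => //; exact: ltW.
  exact: B6 (ltW e0) h e2.
have nk s : 0 <= s <= 1 -> `|kap s| <= 2 * g + 3 * K.
  move=> /andP[s0 s1]; rewrite /kap.
  have h1 : `|sg * (s - b)| <= K.
    rewrite normrM -[leRHS]mulr1; apply: ler_pM => //.
    exact: B1.
  have h2 : dl * e <= K by rewrite -[leRHS]mulr1; apply: ler_pM; [exact: ltW|exact: ltW|by []|exact: le_trans eb (ltW b1)].
  have h3 : 0 <= dl * e by rewrite mulr_ge0// ltW.
  move: h1; rewrite !ler_norml => /andP[h4 h5].
  by apply/andP; exact: B2.
have nk0 : `|kap 0| <= 2 * g + 3 * K by apply: nk; rewrite lexx ler01.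
have nk1 : `|kap 1| <= 2 * g + 3 * K by apply: nk; rewrite lexx ler01.
have kb (c d z : R) : `|c| + `|d| <= norm1 a1 + norm1 a2 -> `|z| <= `|ph.1| + `|ph.2| ->
    `|z + (kap 0 * c + kap 1 * d)| <= Kb.
  move=> hcd hz; apply: le_trans (ler_normD _ _) _; rewrite /Kb; apply: lerD => //.
  apply: le_trans (ler_normD _ _) _; rewrite !normrM.
  have gK0 : 0 <= 2 * g + 3 * K by exact: le_trans nk0.
  exact: B3.
have := hW k dl e dl0 dlK e0 eb eb'.
have k1b : `|k.1| <= Kb by apply: kb; rewrite ?lerD ?lerDl.
have k2b : `|k.2| <= Kb by apply: kb; rewrite ?lerD ?lerDr.
have gb : g * bb <= g * b by apply: ler_wpM2l => //; exact: ltW.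
have gb' : g * bb <= g * (1 - b) by apply: ler_wpM2l => //; exact: ltW.
move=> /(_ k1b k2b); rewrite !mE k4.
have x1 : excess u x0 k y1 = m 0 - kap 0 by rewrite -mE -y1E.
have x2 : excess u x0 k y2 = m 1 - kap 1 by rewrite -mE -y2E.
rewrite x1 x2 => H.
have : 1 <= W * e.
  apply: H => //; [exact: B4 gb|exact: B4 gb'| |].
    by move=> s s01; rewrite mE; have [] := k1 _ s01.
  by move=> s s01; rewrite mE; have [] := k1 _ s01.
have h2 : W * e <= 2^-1 by rewrite mulrC -ler_pdivlMr.
by move=> h1; have := B5 (le_trans h1 h2).
Qed.

(** Let [y1], [y2] be independent directions into [D]. A third one either lies in their cone, or
    forms with one of them a cone containing the other, or is opposite, which is excluded;
    [tg_affine] applies in each remaining case. *)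
Lemma tg_linear : exists p, forall x, D x -> tg u x0 (vs x x0) = dot p (vs x x0).
Proof.
have st := sublin_tg x0 cu.
have [x Dx _] := (closureP D x0).1 cx0 1 ltr01.
pose y1 := vs x x0.
have y10 : y1 != (0, 0).
  apply/eqP => -[/eqP + /eqP]; rewrite !subr_eq0 => /eqP e1 /eqP e2; apply: nDx0.
  by rewrite [x0]surjective_pairing -e1 -e2 -surjective_pairing.
pose v : R * R := (- y1.2, y1.1).
have [r r0 hr] := open_mv v oD Dx.
have rr : `|r| <= r by rewrite gtr0_norm.
pose y2 := vs (mv x r v) x0.
have Dy1 : D (mv x0 1 y1) by rewrite -vsE.
have Dy2 : D (mv x0 1 y2) by rewrite -vsE; exact: hr.
have c0 : crs y1 y2 != 0.
  rewrite (_ : crs y1 y2 = r * dot y1 y1); last by rewrite /crs /y2 /v /y1 /dot /vs /mv /=; ring.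
  by rewrite mulf_neq0 ?gt_eqF// sqnorm_gt0.
have [a1 [a2 ba]] := dual_basisP c0.
have [d11 d12 d21 d22 yE] := ba.
exists (lc (tg u x0 y1) (tg u x0 y2) a1 a2) => z Dz.
set y := vs z x0.
have Dy : D (mv x0 1 y) by rewrite -vsE.
rewrite (_ : dot _ y = dot a1 y * tg u x0 y1 + dot a2 y * tg u x0 y2); last first.
  by rewrite /dot /lc /=; ring.
have no := cone_not_opposite cD nDx0 Dy1 Dy2 ba Dz; rewrite -/y in no.
have := yE y; move: (dot a1 y) (dot a2 y) no => a c no {}yE.
have [a0|a0] := leP 0 a; have [c00|c00] := leP 0 c.
- have s0 : 0 < a + c.
    by rewrite lt_neqAle addr_ge0// andbT; apply/eqP => s0; apply: no; lra.
  have i1 : 0 <= c / (a + c) <= 1.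
    by apply/andP; split; [apply: divr_ge0; lra|rewrite ler_pdivrMr//; lra].
  have -> : y = sc (a + c) (cb (c / (a + c)) y1 y2).
    by rewrite yE /sc /cb /lc /=; congr pair; field; rewrite gt_eqF.
  rewrite (sublin_homo _ st (ltW s0)) tg_affine//; field.
  by rewrite gt_eqF.
- have a00 : 0 < a by rewrite ltNge; apply/negP => ?; apply: no; lra.
  have c1 : 0 < 1 - c by lra.
  have i1 : 0 <= - c / (1 - c) <= 1.
    by apply/andP; split; [apply: divr_ge0; lra|rewrite ler_pdivrMr//; lra].
  have cc : crs y y2 != 0.
    rewrite (_ : crs y y2 = a * crs y1 y2); last by rewrite yE /crs /lc /=; ring.
    by rewrite mulf_neq0// gt_eqF.
  have := tg_affine Dy Dy2 cc i1.
  rewrite (_ : cb _ _ _ = sc (a / (1 - c)) y1); last first.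
    by rewrite /sc /cb yE /lc /=; congr pair; field; rewrite gt_eqF.
  have ac : 0 <= a / (1 - c) by rewrite divr_ge0// ltW.
  rewrite (sublin_homo _ st ac) => H.
  have {}H : a * tg u x0 y1 = tg u x0 y - c * tg u x0 y2.
    have e1 : (1 - c) * (a / (1 - c) * tg u x0 y1) = a * tg u x0 y1 by field; rewrite gt_eqF.
    by rewrite -e1 H; field; rewrite gt_eqF.
  lra.
- have c000 : 0 < c by rewrite ltNge; apply/negP => ?; apply: no; lra.
  have c1 : 0 < 1 - a by lra.
  have i1 : 0 <= - a / (1 - a) <= 1.
    by apply/andP; split; [apply: divr_ge0; lra|rewrite ler_pdivrMr//; lra].
  have cc : crs y y1 != 0.
    rewrite (_ : crs y y1 = - c * crs y1 y2); last by rewrite yE /crs /lc /=; ring.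
    by rewrite mulf_neq0// oppr_eq0 gt_eqF.
  have := tg_affine Dy Dy1 cc i1.
  rewrite (_ : cb _ _ _ = sc (c / (1 - a)) y2); last first.
    by rewrite /sc /cb yE /lc /=; congr pair; field; rewrite gt_eqF.
  have ac : 0 <= c / (1 - a) by rewrite divr_ge0// ltW.
  rewrite (sublin_homo _ st ac) => H.
  have {}H : c * tg u x0 y2 = tg u x0 y - a * tg u x0 y1.
    have e1 : (1 - a) * (c / (1 - a) * tg u x0 y2) = c * tg u x0 y2 by field; rewrite gt_eqF.
    by rewrite -e1 H; field; rewrite gt_eqF.
  lra.
- by exfalso; apply: no; exact: ltW.
Qed.

End tangent_linear.

(** * Jumps of the gradient at a boundary point *)

Section boundary_slopes.
Context {R : realType}.
Implicit Types (x y z p q k : R * R).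

(** The bounded parts of the [Q r] form a filter base on a compact square as [r] decreases. *)
Lemma compact_cluster (Q : R -> R * R -> Prop) (M : R) :
  (forall r s q, r <= s -> Q r q -> Q s q) ->
  (forall r : R, 0 < r -> exists q, [/\ Q r q, `|q.1| <= M & `|q.2| <= M]) ->
  exists q0, forall r e : R, 0 < r -> 0 < e -> exists2 q, Q r q & near_pt q0 e q.
Proof.
move=> mQ hQ.
pose B (r : R) : set (R * R) := [set q | [/\ Q r q, `|q.1| <= M & `|q.2| <= M]].
pose F := filter_from [set r : R | 0 < r] B.
have FF : ProperFilter F.
  apply: filter_from_proper; last by move=> r /= /hQ.
  apply: filter_from_filter; first by exists 1 => /=.
  move=> r s /= r0 s0; exists (Num.min r s); first by rewrite /= lt_min r0.
  by move=> q [Qq q1 q2]; split; split => //; apply: mQ Qq; rewrite ge_min lexx ?orbT.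
pose C : set (R * R) := `[- M, M]%classic `*` `[- M, M]%classic.
have cC : compact C by apply: compact_setX; exact: segment_compact.
have FC : F C.
  by exists 1 => //= q [_ q1 q2]; split => /=; rewrite in_itv/= -ler_norml.
have [q0 [_ cl]] := cC F FF FC.
exists q0 => r e r0 e0.
have [q [[Qq _ _] qe]] := cl (B r) (near_pt q0 e) (ex_intro2 _ _ r r0 (fun _ h => h)) (near_pt_nbhs q0 e0).
by exists q.
Qed.

Lemma dot_near p q y (e : R) : near_pt p e q -> `|dot q y - dot p y| <= e * norm1 y.
Proof.
move=> [h1 h2]; rewrite (_ : _ - _ = dot (vs q p) y); last by rewrite /dot /vs /=; ring.
by apply: dot_abs; exact: ltW.
Qed.

Lemma norm1_near x0 x (r : R) : near_pt x0 r x -> norm1 (vs x x0) <= 2 * r.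
Proof. by move=> [h1 h2]; rewrite /norm1 /vs /=; lra. Qed.

Variables (D : set (R * R)) (u : R * R -> R) (M : R) (x0 p : R * R).
Hypotheses (oD : open D) (cD : cset D) (bD : bounded_set D).
Hypotheses (lu : lipc M u) (u0 : forall x, 0 <= u x) (mu_ : minimizes D u).
Hypotheses (cx0 : closure D x0) (nDx0 : ~ D x0).
Hypotheses (pM1 : `|p.1| <= M) (pM2 : `|p.2| <= M).
Hypothesis tgp : forall x, D x -> tg u x0 (vs x x0) = dot p (vs x x0).

Let cu : cvx setT u. Proof. by case: lu. Qed.

Definition dslope x := vs (gd u x) p.
Local Notation q := dslope.

Definition good x := D x /\ dif u x (gd u x).

Lemma dslope_le x : `|(q x).1| <= 2 * M /\ `|(q x).2| <= 2 * M.
Proof.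
have p1 := pM1; have p2 := pM2.
have [h1 h2] := lipc_gd x lu; rewrite /q /vs.
by split; apply: le_trans (ler_normB _ _) _; rewrite mulrDl !mul1r; exact: lerD.
Qed.

Lemma tangent_below x : D x -> u x0 + dot p (vs x x0) <= u x.
Proof. by move=> Dx; rewrite -tgp//; exact: tg_subgradient. Qed.

Lemma gap_ge0 x : good x -> u x - (u x0 + dot p (vs x x0)) <= dot (q x) (vs x x0).
Proof.
move=> [Dx dx]; have := dif_subgradient cu (I : setT x) (I : setT x0) dx.
by rewrite /dslope /dot /vs /=; lra.
Qed.

(** The subgradient inequality at [x] is tested at [x0 + s (z - x0)], where [u] is within [s e / 2]
    of its tangent of slope [p]. *)
Lemma slope_polar z (e : R) : D z -> 0 < e -> exists2 r : R, 0 < r &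
  forall x, good x -> near_pt x0 r x -> dot (q x) (vs z x0) <= e.
Proof.
move=> Dz e0; have [M0 _ _] := lu.
have e2 : 0 < e / 2 by rewrite divr_gt0.
have [s s0 /(_ s)] := tg_near x0 cu (vs z x0) e2.
rewrite s0 lexx => /(_ isT); rewrite tgp// => hs.
have M1 : 0 < 4 * M + 1 by lra.
have es : 0 < s * (e / 2) by exact: mulr_gt0.
exists (s * (e / 2) / (4 * M + 1)); first by rewrite divr_gt0.
move=> x [Dx dx] /norm1_near nx.
have h1 := dif_subgradient cu (I : setT x) (I : setT (mv x0 s (vs z x0))) dx.
have h2 := tangent_below Dx.
have [q1 q2] := dslope_le x.
have h3 := dot_le (vs x x0) q1 q2.
have h4 : 2 * M * norm1 (vs x x0) <= s * (e / 2).
  apply: le_trans (_ : 2 * M * (2 * (s * (e / 2) / (4 * M + 1))) <= _).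
    by apply: ler_wpM2l => //; rewrite mulr_ge0.
  rewrite mulrCA !mulrA ler_pdivrMr// -!mulrA; have := es; nra.
have h5 : s * dot (q x) (vs z x0) <= s * e.
  by move: h1 h2 h3 hs; rewrite /dslope /dot /vs /mv /=; lra.
by move: h5; rewrite ler_pM2l.
Qed.

Definition cluster_slope tau := forall r e : R, 0 < r -> 0 < e ->
  exists x, [/\ good x, near_pt x0 r x & near_pt tau e (q x)].

Lemma cluster_polar tau z : cluster_slope tau -> D z -> dot tau (vs z x0) <= 0.
Proof.
move=> ct Dz; apply/ler_addgt0Pr => e e0; rewrite add0r.
have e2 : 0 < e / 2 by rewrite divr_gt0.
have n1 : 0 < norm1 (vs z x0) + 1 by have := norm1_ge0 (vs z x0); lra.
have [r r0 hr] := slope_polar Dz e2.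
have [x [gx xr tx]] := ct r (e / 2 / (norm1 (vs z x0) + 1)) r0 (divr_gt0 e2 n1).
have := hr x gx xr; have := dot_near (vs z x0) tx; rewrite ler_norml => /andP[h _].
have : e / 2 / (norm1 (vs z x0) + 1) * norm1 (vs z x0) <= e / 2.
  by rewrite mulrAC ler_pdivrMr// ler_pM2l//; lra.
lra.
Qed.

Lemma cluster_polar_lt tau z : cluster_slope tau -> tau != (0, 0) -> D z -> dot tau (vs z x0) < 0.
Proof.
move=> ct t0 Dz; have [r r0 hr] := open_mv tau oD Dz.
have rr : `|r| <= r by rewrite gtr0_norm.
have := cluster_polar ct (hr r rr).
rewrite (_ : dot tau _ = dot tau (vs z x0) + r * dot tau tau); last first.
  by rewrite /dot /vs /mv /=; ring.
by have := mulr_gt0 r0 (sqnorm_gt0 t0); lra.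
Qed.

(* A slope jump [tau] at [x0] is only attained at points tending tangentially
   to [x0]. *)
Lemma cluster_tangential tau x (e : R) : cluster_slope tau -> good x ->
  near_pt tau e (q x) ->
  - (e * norm1 (vs x x0)) <= dot tau (vs x x0) /\
  u x - (u x0 + dot p (vs x x0)) <= e * norm1 (vs x x0).
Proof.
move=> ct gx tx; have := cluster_polar ct gx.1.
have := dot_near (vs x x0) tx; rewrite ler_norml => /andP[h1 h2].
have := gap_ge0 gx; have := tangent_below gx.1.
by split; lra.
Qed.

Definition perp y : R * R := (- y.2, y.1).

Lemma perp_coord tau y : tau != (0, 0) ->
  y = lc (dot (perp tau) y / dot tau tau) (dot tau y / dot tau tau) (perp tau) tau.
Proof.
move=> /sqnorm_gt0 t0; rewrite [LHS]surjective_pairing /lc; congr pair; move: t0;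
  by rewrite /dot /perp /= => t0; field; rewrite gt_eqF.
Qed.

Lemma norm1_perp tau : norm1 (perp tau) = norm1 tau.
Proof. by rewrite /norm1 /perp /= normrN addrC. Qed.

Lemma norm1_lc (a b : R) y z : norm1 (lc a b y z) <= `|a| * norm1 y + `|b| * norm1 z.
Proof.
rewrite /norm1 /lc /=; have := ler_normD (a * y.1) (b * z.1); have := ler_normD (a * y.2) (b * z.2).
by rewrite !normrM; lra.
Qed.

Lemma norm1_gt0 y : y != (0, 0) -> 0 < norm1 y.
Proof.
move=> y0; rewrite lt_neqAle norm1_ge0 andbT; apply: contraNneq y0 => /eqP.
rewrite eq_sym paddr_eq0// !normr_eq0 => /andP[/eqP h1 /eqP h2].
by rewrite [y]surjective_pairing h1 h2.
Qed.

(** By [cluster_tangential] the component along [tau] is at most half of [x - x0], so the component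
    along [perp tau] controls the whole vector. *)
Lemma cluster_perp tau x (e : R) : cluster_slope tau -> tau != (0, 0) -> good x ->
  near_pt tau e (q x) -> e * norm1 tau <= dot tau tau / 2 ->
  0 < norm1 (vs x x0) /\
  norm1 (vs x x0) * dot tau tau <= 2 * norm1 tau * `|dot (perp tau) (vs x x0)|.
Proof.
move=> ct t0 gx tx he; have T0 := sqnorm_gt0 t0.
have [h1 _] := cluster_tangential ct gx tx; have h2 := cluster_polar ct gx.1.
set y := vs x x0 in h1 h2 *.
have y0 : y != (0, 0).
  apply/eqP => -[/eqP + /eqP]; rewrite !subr_eq0 => /eqP e1 /eqP e2; apply: nDx0.
  by rewrite [x0]surjective_pairing -e1 -e2 -surjective_pairing; case: gx.
split; first exact: norm1_gt0.
have n0 := norm1_ge0 y; have nt := norm1_ge0 tau.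
have := norm1_lc (dot (perp tau) y / dot tau tau) (dot tau y / dot tau tau) (perp tau) tau.
rewrite -perp_coord// norm1_perp !normrM normfV (gtr0_norm T0).
have h3 : `|dot tau y| <= e * norm1 y by rewrite ler0_norm//; lra.
have h4 : `|dot tau y| / dot tau tau * norm1 tau <= norm1 y / 2.
  rewrite mulrAC ler_pdivrMr//; apply: le_trans (ler_wpM2r nt h3) _.
  have := ler_wpM2l n0 he; lra.
move=> h5.
have h6 : norm1 y / 2 <= `|dot (perp tau) y| / dot tau tau * norm1 tau by lra.
have := ler_wpM2l (ltW T0) h6.
rewrite (_ : dot tau tau * (`|dot (perp tau) y| / _ * _) = `|dot (perp tau) y| * norm1 tau); last first.
  by field; rewrite gt_eqF.
lra.
Qed.

End boundary_slopes.

Lemma small3 {R : realType} (a b c : R) : 0 < a -> 0 < b -> 0 < c ->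
  exists2 e : R, 0 < e & [/\ e <= a, e <= b & e <= c].
Proof.
move=> a0 b0 c0; exists (Num.min a (Num.min b c)); first by rewrite !lt_min a0 b0.
by have [h1 [h2 h3]] := min3_le a b c.
Qed.

Section jump_sign.
Context {R : realType}.
Local Notation R2 := (measurableTypeR R * measurableTypeR R)%type.
Implicit Types (x y z p q k : R * R).
Variables (D : set (R * R)) (u : R * R -> R) (M : R) (x0 p : R * R).
Hypotheses (oD : open D) (cD : cset D) (bD : bounded_set D).
Hypotheses (lu : lipc M u) (u0 : forall x, 0 <= u x) (mu_ : minimizes D u).
Hypotheses (cx0 : closure D x0) (nDx0 : ~ D x0).
Hypotheses (pM1 : `|p.1| <= M) (pM2 : `|p.2| <= M).
Hypothesis tgp : forall x, D x -> tg u x0 (vs x x0) = dot p (vs x x0).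

Let mD : measurable (D : set R2).
Proof. exact: open_plane_measurable. Qed.

Let fD := bounded_measure oD bD.

Lemma raise_slope_le k (h N : R) v : `|k.1| <= N -> `|k.2| <= N -> 0 < h ->
  II D (fun x => dot (draise u x0 k h x) v) <= (N + M) * norm1 v * sraise D u x0 k h.
Proof.
move=> k1 k2 h0; have fD' := fD; have mD' := mD.
have bi : bm D (fun x => \1_([set x | 0 < raise u x0 k h x] : set R2) x).
  exact: (bm_raise_indic D x0 k h lu).
rewrite -(IIZ mD fD _ bi); apply: II_le_ae => //.
- exact: (bm_dotr x0 k h bD lu v).
- exact: bmZ.
apply: (ae_inS (raise_dichotomy D x0 k h lu)) => x Dx; rewrite indic_raise => -[[-> ->]|[-> gk _]].
  by rewrite ltxx /dot /= !mul0r mulr0 addr0.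
rewrite mulr1; have [g1 g2] := lipc_gd x lu.
by apply: dot_le; rewrite /draise gk /vs /=; apply: le_trans (ler_normB _ _) _; apply: lerD.
Qed.

Lemma flux_along k (h : R) z (b c : R) : 0 < h -> 
  (forall x, D x -> u x0 + dot k (vs x x0) <= u x) -> closure D z ->
  0 <= c -> u z - (u x0 + dot k (vs z x0)) <= c ->
  II D (fun x => dot (draise u x0 k h x) (b * (z.1 - x0.1), b * (z.2 - x0.2))) <=
    `|b| * (2 * h + c) * sraise D u x0 k h.
Proof.
move=> h0 below cz c0 hc; have s0 := sraise_gt0 k oD bD lu cx0 h0.
have m := raise_le_mass oD bD lu h0 below.
have [b0|b0] := leP 0 b.
  rewrite ger0_norm//; apply: le_trans (flux_pos oD cD bD lu h0 below cz b0) _.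
  have := ler_wpM2l b0 m; have := mulr_ge0 (mulr_ge0 b0 c0) (ltW s0); lra.
rewrite ltr0_norm//; have b1 : 0 <= - b by lra.
have := flux_neg oD cD bD lu cx0 h0 below cz b1 hc.
rewrite (_ : (fun x => _) = (fun x => dot (draise u x0 k h x) (b * (z.1 - x0.1), b * (z.2 - x0.2)))); last first.
  by apply/funext => x; rewrite /dot /=; ring.
move=> e; apply: le_trans e _; have := ler_wpM2l b1 m; lra.
Qed.

Local Ltac clear_local := clear -oD cD bD lu u0 mu_ cx0 nDx0 pM1 pM2 tgp mD fD.

(** If the product were negative, a multiple of [tau] could be added to [p] so that [k - x0] becomes
    orthogonal to [tau]. Points [x] with slope jump near [tau] lie in almost that direction, up to
    sign, and have a small gap, so the flux along [x - x0] is small for both signs. The raised set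
    is thin in the direction [tau], because [tau] is negative on [D]. *)
Lemma cluster_slope_sign tau : cluster_slope D u x0 p tau -> tau != (0, 0) ->
  0 <= dot tau (vs p x0).
Proof.
move=> ct t0; rewrite leNgt; apply/negP => c0.
have fD' := fD; have mD' := mD.
have T0 := sqnorm_gt0 t0; have n0 := norm1_gt0 t0.
pose kap := - dot tau (vs p x0) / dot tau tau.
have kap0 : 0 < kap by rewrite divr_gt0 ?oppr_gt0.
pose k := mv p kap tau.
have kt : dot tau (vs k x0) = 0.
  rewrite (_ : dot tau _ = dot tau (vs p x0) + kap * dot tau tau); last first.
    by rewrite /dot /vs /k /mv /=; ring.
  by rewrite /kap mulfVK ?gt_eqF//; ring.
pose bet := dot (perp tau) (vs k x0) / dot tau tau.
have mE : vs k x0 = sc bet (perp tau).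
  by rewrite [LHS](perp_coord (vs k x0) t0) kt mul0r -/bet /lc /sc !mul0r !addr0.
have [z1 Dz1 _] := (closureP D x0).1 cx0 1 ltr01.
pose P : R * R * R := (sc (- kap) tau, kap * dot tau x0).
have PE x : pl P x = - kap * dot tau (vs x x0) by rewrite /P /pl /dot /sc /vs /=; ring.
have P0 x : D x -> 0 < pl P x.
  move=> Dx; rewrite PE mulNr oppr_gt0 pmulr_rlt0//.
  exact: (cluster_polar_lt oD lu pM1 pM2 tgp ct t0 Dx).
have d0 := P0 _ Dz1; set d := pl P z1 in d0.
have [C C0 hC] := bounded_closure bD.
have below x : D x -> u x0 + dot k (vs x x0) <= u x.
  move=> Dx; apply: le_trans (tangent_below lu tgp Dx).
  have := P0 _ Dx; rewrite PE /k => h.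
  suff : dot (mv p kap tau) (vs x x0) = dot p (vs x x0) + kap * dot tau (vs x x0) by lra.
  by rewrite /dot /vs /mv /=; ring.
pose N := Num.max `|k.1| `|k.2|.
pose A := 2 * C / d.
have A0 : 0 < A by rewrite /A divr_gt0 ?mulr_gt0.
pose B := `|bet| * (2 * norm1 tau * (3 + kap) + 2 * norm1 tau / dot tau tau * ((N + M) * norm1 tau)).
have [M0 _ _] := lu.
have N0 : 0 <= N by rewrite /N le_max normr_ge0.
have B0 : 0 <= B.
  have nt := norm1_ge0 tau; have k3 : 0 <= 3 + kap by rewrite addr_ge0// ltW.
  have NM : 0 <= N + M by exact: addr_ge0.
  by rewrite /B mulr_ge0// addr_ge0// !mulr_ge0// invr_ge0 ltW.
pose W := 36 * A ^+ 2 * (B + 6).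
have W0 : 0 <= W by apply: mulr_ge0; [apply: mulr_ge0 => //; apply: exprn_ge0; exact: ltW|exact: addr_ge0].
have W1 : 0 < W + 1 by rewrite ltr_wpDl.
have [e e0 [e1 e2 e3]] : exists2 e : R, 0 < e & [/\ e <= Num.min 1 (W + 1)^-1,
    e <= dot tau tau / 2 / norm1 tau & e <= d / 12].
  apply: small3; [by rewrite lt_min ltr01 invr_gt0|by rewrite !divr_gt0|by rewrite divr_gt0].
have {}e1 : e <= 1 /\ e * (W + 1) <= 1.
  move: e1; rewrite le_min => /andP[-> h]; split => //.
  by rewrite -ler_pdivlMr ?mul1r.
have [e11 e12] := e1.
rewrite ler_pdivlMr// in e2.
have [x [gx xe tx]] := ct e e e0 e0.
have [y0 yN] := cluster_perp lu nDx0 pM1 pM2 tgp ct t0 gx tx e2.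
have [tb gap] := cluster_tangential lu pM1 pM2 tgp ct gx tx.
have tneg := cluster_polar lu pM1 pM2 tgp ct gx.1.
have n2 := norm1_near xe.
(* The height equals the bound on the gap at [x]. Then [|b| * h] is of order [e], because [b] is of
   order [1 / |x - x0|]. *)
pose h := e * norm1 (vs x x0).
have h0 : 0 < h by exact: mulr_gt0.
have h2 : h <= 2 * e.
  rewrite /h mulrC; apply: ler_wpM2r; [exact: ltW|]; apply: le_trans n2 _.
  by rewrite -[leRHS]mulr1 ler_pM2l.
have t1 : II D (raise u x0 k h) <= A * h * slope_mass D u x0 k h.
  have := @raise_thin _ D u M x0 k h oD cD bD lu P z1 h C (ltW h0) _ (subset_closure Dz1).
  have hb y : D y -> 0 < raise u x0 k h y -> `|pl P y| <= h.
    move=> Dy ry; rewrite gtr0_norm ?P0//; have [_ E] := raise_gt0 ry.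
    move: ry; rewrite E raise_plE => ry.
    have := tangent_below lu tgp Dy; rewrite PE.
    suff : dot k (vs y x0) = dot p (vs y x0) + kap * dot tau (vs y x0) by lra.
    by rewrite /k /dot /vs /mv /=; ring.
  move=> /(_ hb (fun y Dy => hC y z1 Dy (subset_closure Dz1))); rewrite -/d.
  rewrite (_ : II D (fun x => _ * _) = II D (raise u x0 k h)); last first.
    apply: II_eq_ae => //; first exact: (bm_pos_part x0 k h bD lu P).
      exact: (bm_raise x0 k h bD lu).
    by apply: ae_inT => y Dy; rewrite indicE mem_set ?mul1r//; exact: P0.
  move=> th; have I0 : 0 <= II D (raise u x0 k h) by apply: Rintegral_ge0 => y _; exact: raise_ge0.
  have : d / 2 * II D (raise u x0 k h) <= h * C * slope_mass D u x0 k h.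
    by apply: le_trans th; apply: ler_wpM2r => //; lra.
  rewrite /A -(ler_pM2l (_ : 0 < 2 / d)) ?divr_gt0//.
  rewrite mulrA (_ : 2 / d * (d / 2) = 1); last by field; rewrite gt_eqF.
  by rewrite mul1r; lra.
pose Ny := dot (perp tau) (vs x x0); pose Sy := dot tau (vs x x0).
have Ny0 : 0 < `|Ny|.
  have := mulr_gt0 y0 T0; rewrite /Ny; move: yN.
  have := normr_ge0 (dot (perp tau) (vs x x0)); move: `|_| => a; nra.
have Nn : Ny != 0 by rewrite -normr_gt0.
pose b := bet * dot tau tau / Ny.
(* The part of [k - x0] not carried by [x - x0]; [Sy / Ny] is of order [e], so a crude bound on its
   flux suffices. *)
pose v := sc (- bet * Sy / Ny) tau.
have sE : vs k x0 = (b * (x.1 - x0.1) + v.1, b * (x.2 - x0.2) + v.2).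
  rewrite mE /v /b /sc /=.
  have := perp_coord (vs x x0) t0; rewrite -/Ny -/Sy /lc => -[E1 E2].
  rewrite E1 E2; rewrite [LHS]surjective_pairing /=.
  congr pair; field; rewrite Nn gt_eqF//.
have s0 := sraise_gt0 k oD bD lu cx0 h0.
have bN : `|b| * norm1 (vs x x0) <= `|bet| * (2 * norm1 tau).
  rewrite /b (normrM (bet * _)) (normrM bet) normfV (gtr0_norm T0) mulrAC ler_pdivrMr//.
  by rewrite -!mulrA; apply: ler_wpM2l => //; rewrite mulrC mulrA.
have t2 : II D (fun z => dot (draise u x0 k h z) (vs k x0)) <= (e * B) * sraise D u x0 k h.
  have cc : 0 <= (1 + kap) * h by apply: mulr_ge0; [apply: addr_ge0 => //; exact: ltW|exact: ltW].
  have gp : u x - (u x0 + dot k (vs x x0)) <= (1 + kap) * h.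
    rewrite (_ : dot k _ = dot p (vs x x0) + kap * Sy); last first.
      by rewrite /Sy /k /dot /vs /mv /=; ring.
    have := ler_wpM2l (ltW kap0) tb; rewrite -/Sy -/h; by move: gap; rewrite -/h; clear_local; lra.
  have f1 := flux_along b h0 below (subset_closure gx.1) cc gp.
  have f2 := raise_slope_le v (le_max_l _ _ : `|k.1| <= N) (le_max_r _ _ : `|k.2| <= N) h0.
  rewrite (_ : II D _ = II D (fun z => dot (draise u x0 k h z) (b * (x.1 - x0.1), b * (x.2 - x0.2)))
     + II D (fun z => dot (draise u x0 k h z) v)); last first.
    rewrite -(IID mD fD)//; try exact: (bm_dotr x0 k h bD lu).
    congr (II D _); apply/funext => z; rewrite sE; move: (draise u x0 k h z) => g.
    by rewrite /dot /=; ring.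
  apply: le_trans (lerD f1 f2) _; rewrite -mulrDl ler_pM2r//.
  have nv : norm1 v <= e * `|bet| * (2 * norm1 tau / dot tau tau * norm1 tau).
    have -> : norm1 v = `|bet| * (`|Sy| / `|Ny|) * norm1 tau.
      by rewrite /v /norm1 /sc /= !(normrM (- bet * Sy / Ny)) (normrM (- bet * Sy)) (normrM (- bet)) normrN normfV; ring.
    have hr : `|Sy| / `|Ny| <= e * (2 * norm1 tau / dot tau tau).
      rewrite ler_pdivrMr// mulrA mulrAC ler_pdivlMr//.
      have hS : `|Sy| <= e * norm1 (vs x x0) by rewrite /Sy ler0_norm// lerNl.
      have := ler_wpM2r (ltW T0) hS; have := ler_wpM2l (ltW e0) yN; rewrite -/Ny; clear_local; lra.
    by have := ler_wpM2r (ltW n0) (ler_wpM2l (normr_ge0 bet) hr); clear_local; lra.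
  have NM : 0 <= N + M by exact: addr_ge0.
  have g1 := ler_wpM2l NM nv.
  have g2 : `|b| * (2 * h + (1 + kap) * h) <= e * (`|bet| * (2 * norm1 tau * (3 + kap))).
    have k3 : 0 <= (3 + kap) * e by apply: mulr_ge0; [apply: addr_ge0 => //; exact: ltW|exact: ltW].
    by have := ler_wpM2l k3 bN; rewrite /h; clear_local; lra.
  by move: g1 g2; rewrite /B; clear_local; lra.
have := raise_contra oD cD bD lu u0 mu_ cx0 h0 below A0 t1 t2.
have a2 : 0 <= 36 * A ^+ 2 by rewrite mulr_ge0// exprn_ge0// ltW.
have hB : e * B + 3 * h <= e * (B + 6) by move: h2; clear_local; lra.
have := ler_wpM2l a2 hB; move: e0 e12; rewrite /W; move: (36 * A ^+ 2) (e * B + 3 * h) => c g.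
by clear_local; lra.
Qed.

End jump_sign.

(** * Lowering the minimizer in a sector *)

(** When the segment first leaves the sector, either [N = 3 r] or [S = 4 a N], both beyond the core.
    Moving back by an explicit fraction [d] gives a point strictly inside the sector and still
    outside the core. *)
Lemma sector_exit {R : realType} (r a N0 S0 N1 S1 : R) : 0 < r -> 0 < a -> 0 < S0 -> 0 < S1 ->
  N0 < 3 * r -> S0 < 4 * a * N0 -> ~ (N1 < 3 * r /\ S1 < 4 * a * N1) ->
  exists s : R, let N := (1 - s) * N0 + s * N1 in let S := (1 - s) * S0 + s * S1 in
    [/\ 0 <= s < 1, N < 3 * r, S < 4 * a * N & ~ (N <= 2 * r /\ S <= 2 * a * N)].
Proof.
move=> r0 a0 S00 S10 h1 h2 hn.
have N00 : 0 < N0 by rewrite -(pmulr_rgt0 _ (_ : 0 < 4 * a)); lra.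
have lin (f0 f1 : R) : f0 < 0 -> 0 <= f1 -> exists s : R, 0 < s <= 1 /\ (1 - s) * f0 + s * f1 = 0.
  move=> f00 f10; exists (- f0 / (f1 - f0)).
  have d0 : 0 < f1 - f0 by lra.
  split; last by field; rewrite gt_eqF.
  by rewrite divr_gt0 ?oppr_gt0//= ler_pdivrMr// mul1r; lra.
pose L0 := N0 - 3 * r; pose L1 := N1 - 3 * r.
pose Q0 := S0 - 4 * a * N0; pose Q1 := S1 - 4 * a * N1.
have fin s d : 0 < s <= 1 -> 0 < d < 1 -> (1 - s) * L0 + s * L1 <= 0 ->
    (1 - s) * Q0 + s * Q1 <= 0 ->
    ~ ((1 - d) * ((1 - s) * N0 + s * N1) + d * N0 <= 2 * r /\
       (1 - d) * ((1 - s) * S0 + s * S1) + d * S0 <=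
       2 * a * ((1 - d) * ((1 - s) * N0 + s * N1) + d * N0)) ->
    exists s : R, let N := (1 - s) * N0 + s * N1 in let S := (1 - s) * S0 + s * S1 in
    [/\ 0 <= s < 1, N < 3 * r, S < 4 * a * N & ~ (N <= 2 * r /\ S <= 2 * a * N)].
  move=> /andP[s0 s1] /andP[d0 d1] e1 e2 e3; exists ((1 - d) * s) => /=.
  have hN : (1 - (1 - d) * s) * N0 + (1 - d) * s * N1 = (1 - d) * ((1 - s) * N0 + s * N1) + d * N0 by ring.
  have hS : (1 - (1 - d) * s) * S0 + (1 - d) * s * S1 = (1 - d) * ((1 - s) * S0 + s * S1) + d * S0 by ring.
  have d2 : 0 <= 1 - d by lra.
  have e4 := ler_wpM2l d2 e1; have e5 := ler_wpM2l d2 e2.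
  have e6 : d * L0 < 0 by rewrite pmulr_rlt0// /L0; lra.
  have e7 : d * Q0 < 0 by rewrite pmulr_rlt0// /Q0; lra.
  split; [|move: e4 e6|move: e5 e7|]; rewrite ?hN ?hS//.
  - by clear -s0 s1 d0 d1; apply/andP; split; nra.
  - by rewrite /L0 /L1; clear; lra.
  - by rewrite /Q0 /Q1; clear; lra.
have first_exit s : 0 < s <= 1 -> (1 - s) * L0 + s * L1 = 0 -> (1 - s) * Q0 + s * Q1 <= 0 ->
    exists s : R, let N := (1 - s) * N0 + s * N1 in let S := (1 - s) * S0 + s * S1 in
    [/\ 0 <= s < 1, N < 3 * r, S < 4 * a * N & ~ (N <= 2 * r /\ S <= 2 * a * N)].
  move=> s01 e1 e2; pose d := r / (4 * r - N0).
  have d0 : 0 < 4 * r - N0 by lra.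
  apply: (fin s d) => //; first by rewrite divr_gt0//= ltr_pdivrMr//; lra.
    by rewrite e1.
  move=> [+ _]; apply/negP; rewrite -ltNge.
  have -> : (1 - s) * N0 + s * N1 = 3 * r by move: e1; rewrite /L0 /L1; lra.
  have -> : (1 - d) * (3 * r) + d * N0 = 2 * r + r * r / (4 * r - N0).
    by rewrite /d; field; rewrite gt_eqF.
  by rewrite ltrDl divr_gt0// mulr_gt0.
have second_exit s : 0 < s <= 1 -> (1 - s) * Q0 + s * Q1 = 0 -> (1 - s) * L0 + s * L1 <= 0 ->
    exists s : R, let N := (1 - s) * N0 + s * N1 in let S := (1 - s) * S0 + s * S1 in
    [/\ 0 <= s < 1, N < 3 * r, S < 4 * a * N & ~ (N <= 2 * r /\ S <= 2 * a * N)].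
  move=> s01 e1 e2; have /andP[s0 s1] := s01.
  pose N' := (1 - s) * N0 + s * N1; pose S' := (1 - s) * S0 + s * S1.
  have eS : S' = 4 * a * N' by move: e1; rewrite /Q0 /Q1 /S' /N'; lra.
  have S'0 : 0 < S' by rewrite /S' ltr_wpDl// ?mulr_ge0 ?mulr_gt0//; lra.
  have N'0 : 0 < N' by rewrite -(pmulr_rgt0 _ (_ : 0 < 4 * a)) -?eS//; lra.
  have n0 : 0 < N' + N0 by lra.
  pose d := N' / (N' + N0).
  have d0 : 0 < d by rewrite divr_gt0.
  apply: (fin s d) => //; first by rewrite d0/= ltr_pdivrMr//; lra.
    by rewrite e1.
  rewrite -/N' -/S' eS => -[_]; apply/negP; rewrite -ltNge.
  have hd : (1 - d) * N' = d * N0 by rewrite /d; field; rewrite gt_eqF.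
  have := mulr_gt0 d0 S00; move: hd; move: N' d {e1 e2 fin eS S'0 N'0 n0 d0} => m d hd hS.
  rewrite -subr_gt0 (_ : _ - _ = d * S0 + 2 * a * ((1 - d) * m - d * N0)); last by ring.
  by rewrite hd; lra.
have L00 : L0 < 0 by rewrite /L0; lra.
have Q00 : Q0 < 0 by rewrite /Q0; lra.
case: (ltP L1 0) => l1; case: (ltP Q1 0) => q1.
- by exfalso; apply: hn; move: l1 q1; rewrite /L1 /Q1; clear; split; lra.
- have [s [s01 e]] := lin _ _ Q00 q1; apply: (second_exit s s01 e).
  by have /andP[s0 s1] := s01; clear -s0 s1 l1 q1 L00 Q00; nra.
- have [s [s01 e]] := lin _ _ L00 l1; apply: (first_exit s s01 e).
  by have /andP[s0 s1] := s01; clear -s0 s1 l1 q1 L00 Q00; nra.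
have [s [s01 e]] := lin _ _ L00 l1; have [t [t01 f]] := lin _ _ Q00 q1.
have mono (f0 f1 a1 a2 : R) : f0 < 0 -> 0 <= f1 -> a1 <= a2 -> (1 - a2) * f0 + a2 * f1 = 0 ->
    (1 - a1) * f0 + a1 * f1 <= 0.
  by clear; move=> ? ? ? ?; nra.
have [st|/ltW st] := leP s t.
  by apply: (first_exit s) => //; exact: mono st f.
by apply: (second_exit t) => //; exact: mono st e.
Qed.

(** Lowering the first coordinate by [t] at constant second coordinate stays in the triangle spanned
    by the apex and the two points. The equation in [S] fixes [m = (1 - l) S / Sz], and the one in
    [N] then gives [l]. *)
Lemma cone_combination {R : realType} (N S Nz Sz t : R) : 0 < N -> 0 < S -> 0 < Sz -> S <= Sz ->
  S * `|Nz| <= N / 4 * Sz -> 0 < t -> 2 * t <= N ->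
  exists l m : R, [/\ 0 <= l, 0 <= m, 0 < l + m <= 1, l * N + m * Nz = N - t & l * S + m * Sz = S].
Proof.
move=> N0 S0 Sz0 SS h t0 ht; pose q := S * Nz / Sz.
have : `|q| <= N / 4.
  by rewrite /q !normrM normfV (gtr0_norm S0) (gtr0_norm Sz0) ler_pdivrMr.
rewrite ler_norml => /andP[q1 q2].
have d0 : 0 < N - q by lra.
pose l := (N - t - q) / (N - q).
have l0 : 0 < l by rewrite divr_gt0//; lra.
have l1 : l <= 1 by rewrite ler_pdivrMr// mul1r; lra.
have k0 : 0 <= S / Sz by rewrite divr_ge0// ltW.
have k1 : S / Sz <= 1 by rewrite ler_pdivrMr// mul1r.
exists l, ((1 - l) * (S / Sz)); split.
- exact: ltW.
- by rewrite mulr_ge0//; lra.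
- have l10 : 0 <= 1 - l by lra.
  by have := mulr_ge0 l10 k0; have := ler_wpM2l l10 k1; move=> ? ?; apply/andP; split; lra.
- rewrite (_ : (1 - l) * (S / Sz) * Nz = (1 - l) * q); last by rewrite /q; field; rewrite gt_eqF.
  have : l * (N - q) = N - t - q by rewrite /l divfK// gt_eqF.
  by lra.
by rewrite mulrA mulfVK ?gt_eqF//; ring.
Qed.

Section competitor.
Context {R : realType}.
Local Notation R2 := (measurableTypeR R * measurableTypeR R)%type.
Implicit Types (x y z p q k : R * R).

Definition tangent_plane (u : R * R -> R) x : R * R * R := (gd u x, u x - dot (gd u x) x).

Lemma tangent_planeE u x y : pl (tangent_plane u x) y = u x + dot (gd u x) (vs y x).
Proof. by rewrite /tangent_plane; move: (gd u x) => g; rewrite /pl /dot /vs /=; ring. Qed.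

Variables (D : set (R * R)) (u : R * R -> R) (M : R) (x0 p tau n z : R * R).
Variables (r a kk cG th : R).
Hypotheses (oD : open D) (cD : cset D) (bD : bounded_set D).
Hypotheses (lu : lipc M u) (u0 : forall x, 0 <= u x) (mu_ : minimizes D u).
Hypotheses (cx0 : closure D x0) (pM1 : `|p.1| <= M) (pM2 : `|p.2| <= M).
Hypothesis below : forall x, D x -> u x0 + dot p (vs x x0) <= u x.

Definition ncoord x := dot n (vs x x0).
Definition scoord x := - dot tau (vs x x0).
Local Notation N := ncoord.
Local Notation S := scoord.
Definition sector x := N x < 3 * r /\ S x < 4 * a * N x.
(** The core has two thirds of the length and half of the opening of [sector]. The room in between
    lets planes that touch at the exterior be exchanged for cheap ones before the core is
    reached. *)
Definition core x := N x <= 2 * r /\ S x <= 2 * a * N x.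
Definition tilted_cost (b : R * R * R) := pl_cost (sc (- kk) n) cG b.
Local Notation G := tilted_cost.

Hypotheses (T0 : 0 < dot tau tau) (nn : dot n n = dot tau tau) (nt : dot tau n = 0).
Hypothesis coord : forall y, y = lc (dot n y / dot tau tau) (dot tau y / dot tau tau) n tau.
Hypothesis S0 : forall x, D x -> 0 < S x.
Hypotheses (r0 : 0 < r) (a0 : 0 < a) (kk0 : 0 <= kk).
Hypotheses (Dz : D z) (hz1 : a * `|N z| <= S z / 64) (hz2 : 4 * a * r <= S z).
Hypothesis Gp : G (p, u x0 - dot p x0) <= th.
Hypothesis core0 : forall x, D x -> core x -> 0 <= u x0 + dot p (vs x x0).
Hypothesis hcore : forall x, good D u x -> sector x -> th < G (tangent_plane u x) -> core x.

Let mD : measurable (D : set R2).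
Proof. exact: open_plane_measurable. Qed.

Let fD := bounded_measure oD bD.

Let cu : cvx setT u. Proof. by case: lu. Qed.

(** Planes touching [u] outside the sector are kept whatever their cost, so that only the sector is
    modified. *)
Definition competitors : set (R * R * R) := [set b | [/\ tilt_le M b,
  forall x, D x -> pl b x <= u x &
  G b <= th \/ exists y, [/\ D y, ~ sector y & pl b y = u y]]].
Local Notation F := competitors.

Lemma competitors_tangent : F (p, u x0 - dot p x0).
Proof.
split=> //; last by left.
by move=> x Dx; apply: le_trans (below Dx); rewrite /pl /dot /vs /=; lra.
Qed.

Lemma good_tangent x y : good D u x -> pl (tangent_plane u x) y <= u y.
Proof. by move=> [Dx dx]; rewrite tangent_planeE; exact: (dif_subgradient cu I I dx). Qed.

Lemma good_competitor x : good D u x ->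
  G (tangent_plane u x) <= th \/ ~ sector x -> F (tangent_plane u x).
Proof.
move=> gx h; split.
- exact: lipc_gd lu.
- by move=> y _; exact: good_tangent.
case: h => h; [by left|right; exists x; split => //; first by case: gx].
by rewrite tangent_planeE /dot /vs !subrr !mulr0 !addr0.
Qed.

Lemma good_outside_core x : good D u x -> ~ core x -> F (tangent_plane u x).
Proof.
move=> gx nc; apply: good_competitor => //.
have [sx|sx] := pselect (sector x); [left|by right].
by rewrite leNgt; apply/negP => /(hcore gx sx).
Qed.

Let F0 : F !=set0. Proof. by eexists; exact: competitors_tangent. Qed.

Let FM b : F b -> tilt_le M b. Proof. by case. Qed.

Let Fb : exists x B, forall b, F b -> pl b x <= B.
Proof. by exists z, (u z) => b [_ + _]; exact. Qed.

Definition lowered := sup_pl F.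
Local Notation w := lowered.

Lemma lipc_lowered : lipc M w.
Proof. exact: sup_pl_lipc F0 FM Fb. Qed.

Lemma lowered_le x : D x -> w x <= u x.
Proof. by move=> Dx; apply: (sup_pl_le F0 FM Fb) => b [_ h _]; exact: h. Qed.

Lemma lowered_tangent x : u x0 + dot p (vs x x0) <= w x.
Proof.
rewrite (_ : _ + _ = pl (p, u x0 - dot p x0) x); last by rewrite /pl /dot /vs /=; ring.
rewrite /lowered; exact: (sup_pl_ub F0 FM Fb x competitors_tangent).
Qed.

Lemma open_not_core : open [set x | ~ core x].
Proof.
have -> : [set x | ~ core x] = [set x | 2 * r < N x] `|` [set x | 0 < S x - 2 * a * N x].
  apply/seteqP; split => x /=.
    move=> nc; have [h|] := leP (N x) (2 * r); [right|by left].
    by rewrite subr_gt0 ltNge; apply/negP => h2; apply: nc.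
  move=> h [h1 h2]; by case: h => ?; lra.
have lN : lipc (Num.max `|n.1| `|n.2|) (pl (n, - dot n x0)).
  by apply: pl_lipc; split; [exact: le_max_l|exact: le_max_r].
pose b : R * R := (- tau.1 - 2 * a * n.1, - tau.2 - 2 * a * n.2).
have lS : lipc (Num.max `|b.1| `|b.2|) (pl (b, - dot b x0)).
  by apply: pl_lipc; split; [exact: le_max_l|exact: le_max_r].
apply: openU.
  rewrite (_ : [set x | _] = [set x | 2 * r < pl (n, - dot n x0) x]).
    by have [_ _] := lN; exact: lip_open.
  by apply/seteqP; split => x /=; rewrite pl_at.
rewrite (_ : [set x | _] = [set x | 0 < pl (b, - dot b x0) x]).
  by have [_ _] := lS; exact: lip_open.
by apply/seteqP; split => x /=; rewrite pl_at /scoord /ncoord /b /dot /vs /=; lra.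
Qed.

Lemma open_sector : open [set x | sector x].
Proof.
have lN : lipc (Num.max `|(opv n).1| `|(opv n).2|) (pl (opv n, - dot (opv n) x0)).
  by apply: pl_lipc; split; [exact: le_max_l|exact: le_max_r].
pose c : R * R := (tau.1 + 4 * a * n.1, tau.2 + 4 * a * n.2).
have lS : lipc (Num.max `|c.1| `|c.2|) (pl (c, - dot c x0)).
  by apply: pl_lipc; split; [exact: le_max_l|exact: le_max_r].
have -> : [set x | sector x] = [set x | - (3 * r) < pl (opv n, - dot (opv n) x0) x] `&`
    [set x | 0 < pl (c, - dot c x0) x].
  apply/seteqP; split => v /=; rewrite !pl_at /sector /N /S /c /opv /dot /vs /= => -[h1 h2]; split; lra.
by apply: openI; [have [_ _] := lN|have [_ _] := lS]; exact: lip_open.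
Qed.

(** Outside the core every tangent plane of [u] is a competitor, being cheap or based outside the
    sector. Differentiability points are dense there, and both functions are Lipschitz. *)
Lemma loweredE x : D x -> ~ core x -> w x = u x.
Proof.
move=> Dx nc; apply/eqP; rewrite eq_le lowered_le//=; apply/ler_addgt0Pr => e e0.
have [M0 _ lu'] := lu; have [_ _ lw'] := lipc_lowered.
have oA := openI oD open_not_core.
have ad : ae_in (D `&` [set x | ~ core x]) (fun x => dif u x (gd u x)) by exact: lipc_ae_dif lu.
have M1 : 0 < 4 * M + 1 by lra.
have [y [[Dy ncy] dy xy]] := ae_in_dense oA ad (subset_closure (conj Dx nc)) (divr_gt0 e0 M1).
have gy : good D u y by split.
have := sup_pl_ub F0 FM Fb y (good_outside_core gy ncy).
rewrite tangent_planeE [dot _ _](_ : _ = 0); last by rewrite /dot /vs !subrr !mulr0 addr0.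
rewrite -/(w y) addr0 => uw.
have := lu' x y; have := lw' y x; rewrite norm1_vsC.
have xn := norm1_near xy; rewrite norm1_vsC in xn.
have : 2 * (M * norm1 (vs x y)) <= e.
  apply: le_trans (_ : 2 * (M * (2 * (e / (4 * M + 1)))) <= _).
    by apply: ler_wpM2l => //; exact: ler_wpM2l.
  rewrite (_ : 2 * _ = 4 * M * e / (4 * M + 1)); last by field; rewrite gt_eqF.
  by rewrite ler_pdivrMr//; lra.
by lra.
Qed.

Lemma core_sector x : D x -> core x -> sector x.
Proof.
move=> Dx [h1 h2]; have s0 := S0 Dx; have r00 := r0; have aa := a0.
have n0 : 0 < N x by rewrite -(pmulr_rgt0 _ (_ : 0 < 2 * a)); lra.
split; first lra.
by have := mulr_gt0 aa n0; lra.
Qed.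

Lemma lowered_ge0 x : D x -> 0 <= w x.
Proof.
move=> Dx; have [cx|cx] := pselect (core x); last by rewrite loweredE.
exact: le_trans (core0 Dx cx) (lowered_tangent x).
Qed.

Lemma affine_cb q (t : R) x y : dot q (vs (cb t x y) x0) = (1 - t) * dot q (vs x x0) + t * dot q (vs y x0).
Proof. by rewrite /dot /vs /cb /=; ring. Qed.

(* Sliding a contact point of [b] towards [x] keeps the plane above [b] at [x],
   and just before the segment enters the core the contact is cheap. *)
Lemma sector_competitor x (e : R) : D x -> sector x -> 0 < e ->
  exists b, [/\ F b, w x - e <= pl b x & G b <= th].
Proof.
move=> Dx [sx1 sx2] e0; have e2 : 0 < e / 2 by rewrite divr_gt0.
have [b Fb' hb] := sup_pl_near F0 FM Fb x e2.
rewrite -/(w x) in hb.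
have [_ bu [Gb|[y [Dy nsy by_]]]] := Fb'; first by exists b; split => //; lra.
have [s [/andP[s0 s1] e1 e3 e4]] := sector_exit r0 a0 (S0 Dx) (S0 Dy) sx1 sx2 nsy.
pose x' := cb s x y.
have Dx' : D x' by apply: cD => //; rewrite s0 ltW.
have NE : N x' = (1 - s) * N x + s * N y by exact: affine_cb.
have SE : S x' = (1 - s) * S x + s * S y by rewrite /S affine_cb; ring.
have cx' : ~ core x' by rewrite /core NE SE.
have sx' : sector x' by rewrite /sector NE SE.
have oA : open (D `&` [set x | ~ core x] `&` [set x | sector x]).
  exact: openI (openI oD open_not_core) open_sector.
have ad : ae_in (D `&` [set x | ~ core x] `&` [set x | sector x]) (fun x => dif u x (gd u x)).
  exact: lipc_ae_dif lu.
have [M0 _ lu'] := lu.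
have M1 : 0 < 8 * M + 1 by lra.
have s10 : 0 < 1 - s by lra.
pose d := (1 - s) * e / (8 * M + 1).
have d0 : 0 < d by rewrite divr_gt0// mulr_gt0.
have [y' [[[Dy' ncy] sy'] dy' xy]] := ae_in_dense oA ad (subset_closure (conj (conj Dx' cx') sx')) d0.
have gy : good D u y' by split.
have cst : G (tangent_plane u y') <= th.
  by rewrite leNgt; apply/negP => /(hcore gy sy').
exists (tangent_plane u y'); split => //; first by apply: good_competitor => //; left.
set c := tangent_plane u y'.
have [g1 g2] := lipc_gd y' lu.
have hx' : u x' - (1 - s) * (e / 2) <= pl c x'.
  rewrite /c tangent_planeE.
  have := lu' x' y'; have := dot_le (vs y' x') g1 g2; rewrite (norm1_vsC x').
  have : M * norm1 (vs y' x') <= (1 - s) * (e / 4).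
    apply: le_trans (ler_wpM2l M0 (norm1_near xy)) _.
    rewrite (_ : M * _ = (8 * M * ((1 - s) * e)) / (8 * M + 1) / 4); last first.
      by rewrite /d; field; rewrite gt_eqF.
    rewrite (_ : (1 - s) * (e / 4) = ((1 - s) * e) / 4); last by field.
    rewrite ler_pM2r ?invr_gt0// ler_pdivrMr//; have := mulr_gt0 s10 e0; lra.
  rewrite (_ : dot (gd u y') (vs x' y') = - dot (gd u y') (vs y' x')); first lra.
  by move: (gd u y') => g; rewrite /dot /vs /=; ring.
have cy : pl c y <= u y by exact: good_tangent.
have bx' : pl b x' <= u x' by exact: bu.
have h1 : (1 - s) * (pl b x - e / 2) <= (1 - s) * pl c x.
  have := ler_wpM2l s0 cy; move: hx' bx'; rewrite !pl_cb by_; lra.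
by move: h1; rewrite ler_pM2l//; lra.
Qed.

(** The translated point has the same [S] and a smaller [N]. It lies in the triangle with vertices
    [x0], [x] and [z], as [z] is far enough from the axis of the sector by [hz1] and [hz2]. *)
Lemma core_no_exit x (t : R) : D x -> core x -> 0 < t -> 2 * (t * dot tau tau) <= N x ->
  D (mv x t (opv n)).
Proof.
move=> Dx cx t0 tN; have T00 := T0; have s0 := S0 Dx; have sz := S0 Dz; have aa := a0.
have [cx1 cx2] := cx; have [_ sx] := core_sector Dx cx.
have n0 : 0 < N x by rewrite -(pmulr_rgt0 _ (_ : 0 < 4 * a)); lra.
have SS : S x <= S z by have := hz2; have := ler_wpM2l (ltW aa) cx1; lra.
have h : S x * `|N z| <= N x / 4 * S z.
  apply: le_trans (ler_wpM2r (normr_ge0 _) cx2) _.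
  rewrite (_ : 2 * a * N x * _ = 2 * N x * (a * `|N z|)); last by ring.
  apply: le_trans (ler_wpM2l _ hz1) _; first lra.
  by have := mulr_gt0 n0 sz; lra.
have [l [m [l0 m0 lm e1 e2]]] := cone_combination n0 s0 sz SS h (mulr_gt0 t0 T00) tN.
have Dx1 := Dx; have Dz1 := Dz; rewrite (vsE x0 x) in Dx1; rewrite (vsE x0 z) in Dz1.
have := in_cone oD cD cx0 Dx1 Dz1 l0 m0 lm; congr D.
have Tn : dot tau tau != 0 by rewrite gt_eqF.
have e3 : l * N x / dot tau tau + m * N z / dot tau tau = N x / dot tau tau - t.
  by rewrite -mulrDl e1 mulrBl mulfK.
have e4 : l * S x / dot tau tau + m * S z / dot tau tau = S x / dot tau tau by rewrite -mulrDl e2.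
have cX := coord (vs x x0); have cZ := coord (vs z x0).
rewrite [RHS](_ : _ = mv x0 1 (lc 1 (- t) (vs x x0) n)); last first.
  by rewrite /mv /lc /vs /opv /=; congr pair; ring.
congr mv; rewrite cX cZ -/(N x) -/(N z).
rewrite (_ : dot tau (vs x x0) = - S x); last by rewrite /S opprK.
rewrite (_ : dot tau (vs z x0) = - S z); last by rewrite /S opprK.
rewrite /lc /=; congr pair; rewrite -[RHS]addr0.
  transitivity ((l * N x / dot tau tau + m * N z / dot tau tau) * n.1 -
     (l * S x / dot tau tau + m * S z / dot tau tau) * tau.1); first by field.
  by rewrite e3 e4; field.
transitivity ((l * N x / dot tau tau + m * N z / dot tau tau) * n.2 -
     (l * S x / dot tau tau + m * S z / dot tau tau) * tau.2); first by field.
by rewrite e3 e4; field.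
Qed.

Lemma exit_near x (t : R) : D x -> core x -> 0 < t -> ~ D (mv x t (opv n)) ->
  norm1 (vs x x0) <= (2 + 4 * a) * (norm1 n + norm1 tau) * t.
Proof.
move=> Dx cx t0 nD; have T00 := T0; have s0 := S0 Dx; have aa := a0.
have [cx1 cx2] := cx; have [_ sx] := core_sector Dx cx.
have n0 : 0 < N x by rewrite -(pmulr_rgt0 _ (_ : 0 < 4 * a)); lra.
have nN : N x / dot tau tau <= 2 * t.
  rewrite ler_pdivrMr// leNgt; apply/negP => h; apply: nD.
  by apply: core_no_exit => //; lra.
have nS : S x / dot tau tau <= 4 * a * t.
  have := ler_wpM2r (_ : 0 <= (dot tau tau)^-1) cx2; rewrite invr_ge0 => /(_ (ltW T00)) h.
  by have := ler_wpM2l (ltW aa) nN; lra.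
have := norm1_lc (dot n (vs x x0) / dot tau tau) (dot tau (vs x x0) / dot tau tau) n tau.
rewrite -coord !normrM normfV (gtr0_norm T00) -/(N x) (gtr0_norm n0).
have -> : `|dot tau (vs x x0)| = S x by rewrite -(gtr0_norm s0) /scoord normrN.
have := ler_wpM2r (norm1_ge0 n) nN; have := ler_wpM2r (norm1_ge0 tau) nS.
have m1 := norm1_ge0 n; have m2 := norm1_ge0 tau.
have := mulr_ge0 (ltW t0) m2; have := mulr_ge0 (mulr_ge0 (ltW aa) (ltW t0)) m1; lra.
Qed.

Definition lowering x := u x - w x.
Definition dlowering x := vs (gd u x) (gd w x).
Arguments dlowering : simpl never.

Lemma lowering_reg : reg D lowering dlowering.
Proof. by apply: regB => //; [exact: lipc_reg lu|exact: lipc_reg lipc_lowered]. Qed.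

(** After a translation by [- t n], the core points that exit were at distance of order [t] from
    [x0]. There [u - w] is of order [t] and the area of order [t^2], so the lost mass is of order
    [t^3] and [B] can be any positive number. *)
Lemma lowering_flux (B : R) : 0 < B -> - II D (fun x => dot (dlowering x) n) <= B.
Proof.
move=> B0; have mD' := mD; have fD' := fD; have T00 := T0; have aa := a0; have [M0 _ lu'] := lu.
have n0 := norm1_ge0 n; have t0 := norm1_ge0 tau.
pose c := (2 + 4 * a) * (norm1 n + norm1 tau).
have c0 : 0 <= c by rewrite mulr_ge0// ?addr_ge0// ?mulr_ge0// ltW.
pose W := 2 * M * c * (2 * (c + 1)) ^+ 2.
have W0 : 0 <= W by apply: mulr_ge0 (sqr_ge0 _); apply: mulr_ge0 c0; exact: mulr_ge0.
have W1 : 0 < W + 1 by exact: ltr_wpDl.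
have psi0 x : D x -> 0 <= lowering x by move=> Dx; rewrite subr_ge0 lowered_le.
pose s := Num.min 1 (B / (W + 1)).
have s0 : 0 < s by rewrite lt_min ltr01 divr_gt0.
have := flux_reg (l := 0) (B := B) (t0 := s) (c := opv n) oD bD (lexx 0) s0 lowering_reg psi0.
have fE x : field 0 (opv n) x = opv n by rewrite /field !mul0r !subr0.
rewrite mulr0 mul0r add0r.
rewrite (_ : (fun x => _) = (fun x => (-1) * dot (dlowering x) n)); last first.
  by apply/funext => x; rewrite fE /opv; move: (dlowering x) => g; rewrite /dot /=; ring.
have bdn : bm D (fun x => dot (dlowering x) n).
  by have [_ _ [b1 b2] _ _] := lowering_reg; apply: bm_dot => //; exact: bm_cst.
rewrite (IIZ mD fD) // mulN1r; apply => t /andP[tt0].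
rewrite le_min => /andP[t1 tB].
pose E : set (R * R) := (fun x => mv x t (opv n)) @^-1` (~` D).
have mE : measurable (E : set R2).
  rewrite -[E : set R2]setTI; apply: (measurable_mv t (opv n)) => //.
  exact: measurableC.
rewrite (_ : (fun x => mv x t (field 0 (opv n) x)) = (fun x => mv x t (opv n))); last first.
  by apply/funext => x; rewrite fE.
rewrite -/E.
pose rt := (c + 1) * t.
have rt0 : 0 < rt by rewrite mulr_gt0// ltr_wpDl.
pose Q : set (R * R) := near_pt x0 rt.
have mQ : measurable (Q : set R2) by rewrite /Q near_pt_box; exact: box_measurable.
have bQ : bm D (fun x => \1_(Q : set R2) x) by exact: bm_indic.
have [_ bl _ _ _] := lowering_reg.
have i0 x : 0 <= \1_(Q : set R2) x :> R by rewrite indicE ler0n.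
have K0 : 0 <= 2 * M * (c * t) by apply: mulr_ge0; [exact: mulr_ge0|apply: mulr_ge0 => //; exact: ltW].
apply: le_trans (_ : II D (fun x => 2 * M * (c * t) * \1_(Q : set R2) x) <= _).
  apply: II_le_ae => //; [by apply: bmM => //; exact: bm_indic|exact: bmZ|].
  apply: ae_inT => x Dx; have [cx|cx] := pselect (core x); last first.
    by rewrite /lowering loweredE// subrr mulr0; exact: mulr_ge0 K0 (i0 x).
  rewrite [X in X * lowering x]indicE; have [xE|xE] := pselect (E x); last first.
    by rewrite memNset// mul0r; exact: mulr_ge0 K0 (i0 x).
  rewrite mem_set// mul1r.
  have nx := exit_near Dx cx tt0 xE; rewrite -/c in nx.
  have xQ : Q x.
    have h1 := normr_ge0 (vs x x0).1; have h2 := normr_ge0 (vs x x0).2.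
    by move: nx h1 h2; rewrite /Q /near_pt /rt /norm1 /vs /= => *; split; lra.
  rewrite indicE mem_set// mulr1 /lowering.
  have := lowered_tangent x; have := lu' x x0.
  have := dot_abs (vs x x0) pM1 pM2; rewrite ler_norml => /andP[d1 _].
  have := ler_wpM2l M0 nx; lra.
rewrite (IIZ mD fD)// (II_indic mD)//.
have q1 := fine_measure_near x0 oD bD rt0.
apply: le_trans (ler_wpM2l K0 q1) _.
rewrite (_ : 2 * M * (c * t) * (2 * rt) ^+ 2 = t * (t * (t * W))); last by rewrite /W /rt; ring.
apply: ler_wpM2l; first exact: ltW.
have tW : t * W <= B.
  have := ler_wpM2r (ltW W1) tB; rewrite divfK ?gt_eqF//; lra.
by have := ler_wpM2r (mulr_ge0 (ltW tt0) W0) t1; lra.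
Qed.

Definition saving x := fcost u x - fcost w x - kk * dot n (dlowering x).

(** The terms in [|x|^2] and the constant [cG] cancel, so the tilted saving compares tangent planes
    only. *)
Lemma savingE x : saving x = G (tangent_plane u x) - G (tangent_plane w x).
Proof.
rewrite /saving /fcost /dlowering /tilted_cost /tangent_plane.
move: (gd u x) (gd w x) (u x) (w x) => g h b c.
by rewrite /cost /pl_cost /sqnorm /dot /sc /vs /=; field.
Qed.

Lemma saving_cases : ae_in D (fun x => (w x = u x /\ saving x = 0) \/
  (w x < u x /\ 0 < saving x)).
Proof.
apply: (ae_in2 (lipc_ae_dif D lu) (lipc_ae_dif D lipc_lowered)) => x Dx du dw.
have [r1 r10 hr1] := (openP D).1 oD _ Dx.
have [wx|wx] := eqVneq (w x) (u x).
  left; split => //; have gE : gd w x = gd u x.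
    by apply: (dif_touch dw du r10) => // y /hr1 Dy; exact: lowered_le.
  by rewrite savingE /tangent_plane gE wx subrr.
have {}wx : w x < u x by rewrite lt_neqAle wx lowered_le.
right; split => //; have gx : good D u x by split.
have cx : core x by apply: contrapT => /(loweredE Dx) e; move: wx; rewrite e ltxx.
have hu : th < G (tangent_plane u x).
  rewrite ltNge; apply/negP => h.
  have := sup_pl_ub F0 FM Fb x (good_competitor gx (or_introl h)).
  rewrite tangent_planeE [dot _ _](_ : _ = 0); last by rewrite /dot /vs !subrr !mulr0 addr0.
  by rewrite addr0 leNgt => /negP; apply.
rewrite savingE subr_gt0; apply: le_lt_trans hu.
apply: (pl_cost_limit dw r10) => e e0.
have [b [Fb' h1 h2]] := sector_competitor Dx (core_sector Dx cx) e0.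
by exists b; split => // y _; exact: (sup_pl_ub F0 FM Fb).
Qed.

(** By minimality and [lowering_flux] the integral of the saving is at most zero, while the saving
    is positive wherever [w < u]. Hence [w = u], and tangent planes in the sector are limits of
    cheap planes. *)
Lemma sector_cheap x : good D u x -> sector x -> G (tangent_plane u x) <= th.
Proof.
move=> gx sx; have mD' := mD; have fD' := fD; have [Dx dx] := gx.
have bu := bm_fcost bD lu; have bw := bm_fcost bD lipc_lowered.
have bdn : bm D (fun x => dot n (dlowering x)).
  by have [_ _ [b1 b2] _ _] := lowering_reg; apply: bm_dot => //; exact: bm_cst.
have bs : bm D saving by apply: bmB; [exact: bmB|exact: bmZ].
pose g y := Num.max (saving y) 0.
have bg : bm D g by apply: bm_max => //; exact: bm_cst.
have II0 : II D g <= 0.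
  apply/ler_addgt0Pr => e e0; rewrite add0r.
  have -> : II D g = II D saving.
    apply: II_eq_ae => //; apply: (ae_inS saving_cases) => y Dy.
    by move=> [[_ s0]|[_ s0]]; apply/max_idPl; rewrite ?s0// ltW.
  rewrite /saving (IIB mD fD); [|exact: bmB|exact: bmZ].
  rewrite (IIB mD fD)// (IIZ mD fD)//.
  have k1 : 0 < kk + 1 by exact: ltr_wpDl.
  have := lowering_flux (divr_gt0 e0 k1) => /(ler_wpM2l kk0).
  have -> : (fun x => dot (dlowering x) n) = (fun x => dot n (dlowering x)).
    by apply/funext => y; move: (dlowering y) => h; rewrite /dot; ring.
  have : kk * (e / (kk + 1)) <= e by rewrite mulrA ler_pdivrMr//; have := kk0; nra.
  have := mu_ lipc_lowered (fun y Dy => lowered_ge0 Dy); lra.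
have ae0 := II_eq0 mD fD bg (fun y _ => le_max_r _ _) II0.
have ae1 : ae_in D (fun y => w y = u y).
  apply: (ae_in2 saving_cases ae0) => y Dy [[//]|[_ s0]] h.
  by move: (le_max_l (saving y) 0); rewrite -/(g y) h leNgt s0.
have wx : w x = u x.
  apply/eqP; rewrite eq_le lowered_le//= leNgt; apply/negP => wx.
  have [M0 _ lu'] := lu; have [_ _ lw'] := lipc_lowered.
  have M1 : 0 < 4 * M + 1 by lra.
  have d0 : 0 < u x - w x by lra.
  have [y [Dy wy xy]] := ae_in_dense oD ae1 (subset_closure Dx) (divr_gt0 d0 M1).
  have := lu' x y; have := lw' y x; rewrite (norm1_vsC x).
  have : 2 * M * norm1 (vs y x) < u x - w x.
    apply: le_lt_trans (_ : 2 * M * (2 * ((u x - w x) / (4 * M + 1))) < _).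
      by apply: ler_wpM2l (norm1_near xy); exact: mulr_ge0.
    rewrite (_ : _ * _ = 4 * M * (u x - w x) / (4 * M + 1)); last by field; rewrite gt_eqF.
    by rewrite ltr_pdivrMr//; lra.
  by rewrite wy; lra.
have [s s0 hs] := (openP D).1 oD _ Dx.
apply: (pl_cost_limit dx s0) => e e0.
have [b [[_ bu' _] h1 h2]] := sector_competitor Dx sx e0.
exists b; split => //; last by rewrite -wx.
by move=> y /hs; exact: bu'.
Qed.

End competitor.

Lemma quadratic_part {R : realType} (T m a be : R) : 0 <= T -> `|be| <= a ->
  2^-1 * T * a ^+ 2 + a * `|m| <= T / 128 ->
  `|2^-1 * T * be ^+ 2 + be * m| <= T / 128.
Proof.
move=> T0 ba h; apply: le_trans h; apply: le_trans (ler_normD _ _) _.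
apply: lerD.
  have T1 : 0 <= 2^-1 * T by exact: mulr_ge0.
  rewrite ger0_norm; last by rewrite mulr_ge0 ?sqr_ge0.
  apply: ler_wpM2l => //.
  by rewrite -[X in X <= _]real_normK ?num_real// lerXn2r ?nnegrE//; exact: le_trans ba.
by rewrite normrM; exact: ler_wpM2r.
Qed.

Lemma bad_slope {R : realType} (T c m a Nz Sz al be N S E : R) :
  0 < T -> 0 <= c -> 0 < a -> 0 < Sz -> a * `|Nz| <= Sz / 64 ->
  2^-1 * T * a ^+ 2 + a * `|m| <= T / 128 ->
  0 < N -> 0 < S -> S < 4 * a * N -> 0 <= be * N - al * S ->
  be * Nz - al * Sz <= Sz / 64 ->
  let Ph := 2^-1 * T * (al ^+ 2 + be ^+ 2) + al * c + be * m in
  Ph <= 2^-1 * T + c + T / 256 -> E <= 0 ->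
  2^-1 * T + c - T / 128 < Ph + E - T / (32 * a) * be ->
  [/\ 0 <= be, be < a / 2 & `|al - 1| <= 32^-1].
Proof.
move=> T0 c0 a0 Sz0 hz hm N0 S0 SN gap pol; set Q := 2^-1 * T * be ^+ 2 + be * m.
rewrite (_ : 2^-1 * T * (al ^+ 2 + be ^+ 2) + al * c + be * m =
  2^-1 * T * al ^+ 2 + al * c + Q); last by rewrite /Q; ring.
set K := T / (32 * a) => /= up E0 lo.
have Ka : K * a = T / 32 by rewrite /K; field; rewrite gt_eqF.
have K0 : 0 < K by rewrite divr_gt0// mulr_gt0.
have be1 : be < a / 2.
  rewrite -(ltr_pM2l K0) mulrA Ka; lra.
have Qa : `|be| <= a -> `|Q| <= T / 128 by move=> h; exact: quadratic_part (ltW T0) h hm.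
have [al0|al0] := leP 0 al.
  have be0 : 0 <= be.
    by rewrite -(pmulr_lge0 _ N0); have := mulr_ge0 al0 (ltW S0); lra.
  have /Qa : `|be| <= a by rewrite ger0_norm//; clear -be1 a0; lra.
  rewrite ler_norml => /andP[Q1 Q2]; split => //.
  have Kb : 0 <= K * be by exact: mulr_ge0 (ltW K0) be0.
  have T1 : 0 < 2^-1 * T by rewrite mulr_gt0.
  rewrite -(ler_pM2l T1) -{1}(gtr0_norm T1).
  have eq : 2^-1 * T * al ^+ 2 + al * c - 2^-1 * T - c = (al - 1) * (2^-1 * T * (al + 1) + c) by ring.
  rewrite -normrM; apply: le_trans (_ : `|(al - 1) * (2^-1 * T * (al + 1) + c)| <= _).
    rewrite mulrC !normrM; apply: ler_wpM2l => //.
    have h : 0 <= T * al by exact: mulr_ge0 (ltW T0) al0.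
    by clear -T0 c0 al0 h; rewrite !ger0_norm; lra.
  by rewrite -eq ler_norml; clear -T0 up lo E0 Kb Q1 Q2; apply/andP; split; lra.
exfalso; have [be0|be0] := leP 0 be.
  have /Qa : `|be| <= a by rewrite ger0_norm//; clear -be1 a0; lra.
  rewrite ler_norml => /andP[Q1 Q2].
  have Kb : 0 <= K * be by exact: mulr_ge0 (ltW K0) be0.
  have h1 : be * `|Nz| <= Sz / 128 by have := ler_wpM2r (normr_ge0 Nz) (ltW be1); clear -hz; lra.
  have h2 : - (be * Nz) <= be * `|Nz|.
    by rewrite -mulrN; apply: ler_wpM2l => //; rewrite -normrN; exact: ler_norm.
  have h3 : - al <= 64^-1 + 128^-1 by rewrite -(ler_pM2r Sz0); clear -pol h1 h2; lra.
  have h4 : al * c <= 0 by rewrite mulr_le0_ge0// ltW.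
  have h5 : al ^+ 2 <= 4^-1 by clear -al0 h3; rewrite expr2; nra.
  by have := ler_wpM2l (_ : 0 <= 2^-1 * T) h5; clear -T0 c0 lo E0 Kb Q2 h4; lra.
have h0 : - be <= - al * (4 * a).
  rewrite -(ler_pM2r N0); have := ler_wpM2l (_ : 0 <= - al) (ltW SN); clear -al0 gap; lra.
have h2 : (- be) * `|Nz| <= - al * (4 * (Sz / 64)).
  apply: le_trans (ler_wpM2r (normr_ge0 Nz) h0) _.
  by have := ler_wpM2l (_ : 0 <= - al) hz; clear -al0; lra.
have h3 : - (be * Nz) <= - be * `|Nz|.
  by rewrite -mulNr; apply: ler_wpM2l; [rewrite oppr_ge0 ltW|exact: ler_norm].
have h4 : - al <= 60^-1 by rewrite -(ler_pM2r Sz0); clear -pol h2 h3; lra.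
have h5 : - be <= a / 15 by apply: le_trans h0 _; have := ler_wpM2r (ltW a0) h4; clear; lra.
have /Qa : `|be| <= a by rewrite ltr0_norm//; clear -h5 a0; lra.
rewrite ler_norml => /andP[Q1 Q2].
have h6 : al * c <= 0 by rewrite mulr_le0_ge0// ltW.
have h7 : al ^+ 2 <= 4^-1 by clear -al0 h4; rewrite expr2; nra.
have h8 : K * - be <= T / 32 / 15.
  by apply: le_trans (ler_wpM2l (ltW K0) h5) _; rewrite mulrA Ka.
by have := ler_wpM2l (_ : 0 <= 2^-1 * T) h7; clear -T0 c0 lo E0 h8 Q2 h6; lra.
Qed.

(** The slope along [n] is less than half of its value [a] at the reference point [(r, S0)], so
    monotonicity of the gradient excludes [N > 2 r]. The bound on [S] follows from the gap
    inequality with [al] near 1. *)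
Lemma bad_core {R : realType} (a r S0 al0 al be N S : R) : 0 < a -> 0 < r -> 0 < S0 ->
  0 < N -> 0 < S -> `|al0 - 1| <= 32^-1 -> `|al - 1| <= 32^-1 -> 0 <= be -> be < a / 2 ->
  0 <= a * r - al0 * S0 -> 0 <= be * N - al * S ->
  0 <= (be - a) * (N - r) - (al - al0) * (S - S0) ->
  N <= 2 * r /\ S <= 2 * a * N.
Proof.
move=> a0 r0 S00 N0 S1; rewrite !ler_norml => /andP[l1 l2] /andP[l3 l4] b0 b1 g0 g1 mon.
have hS : 31 / 32 * S <= a / 2 * N.
  have := ler_wpM2r (ltW N0) (ltW b1).
  have : 31 / 32 * S <= al * S by apply: ler_wpM2r; [exact: ltW|lra].
  lra.
have hS0 : 31 / 32 * S0 <= a * r.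
  have : 31 / 32 * S0 <= al0 * S0 by apply: ler_wpM2r; [exact: ltW|lra].
  lra.
have aN := mulr_gt0 a0 N0; have ar := mulr_gt0 a0 r0.
split; last by lra.
rewrite leNgt; apply/negP => rN.
have w1 : - (al - al0) * (S - S0) <= 16^-1 * (S + S0).
  apply: le_trans (ler_norm _) _; rewrite normrM normrN; apply: ler_pM => //.
    by rewrite ler_norml; apply/andP; split; lra.
  by rewrite ler_norml; apply/andP; split; lra.
have w2 : (a / 2) * (N - r) <= (a - be) * (N - r) by apply: ler_wpM2r; lra.
have := mulr_gt0 a0 (_ : 0 < N - 2 * r); lra.
Qed.

(** * Extremal slope jump and exclusion of jumps *)

Section no_jump.
Context {R : realType}.
Implicit Types (x y z p q k v tau : R * R).

(** With [v = p - x0], the increase of cost at [x0] when the slope passes from [p] to [p + q], as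
    [tilted_costE] shows. *)
Definition phase v q : R := 2^-1 * dot q q + dot q v.

Lemma phase_near v tau (e : R) : 0 < e ->
  exists2 d : R, 0 < d & forall q, near_pt tau d q -> `|phase v q - phase v tau| <= e.
Proof.
move=> e0; pose y : R * R := (tau.1 + v.1, tau.2 + v.2).
have n0 := norm1_ge0 y.
have d0 : 0 < Num.min 1 (e / (norm1 y + 1)) by rewrite lt_min ltr01 divr_gt0// ltr_wpDl.
exists (Num.min 1 (e / (norm1 y + 1))) => // q; set d := Num.min _ _ in d0 *.
have [d1 de] : d <= 1 /\ d * (norm1 y + 1) <= e.
  rewrite -ler_pdivlMr ?ltr_wpDl//; split; rewrite /d ge_min lexx ?orbT//.
move=> nq; have [q1 q2] := nq.
rewrite (_ : _ - _ = 2^-1 * dot (vs q tau) (vs q tau) + (dot q y - dot tau y)); last first.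
  by rewrite /phase /y /dot /vs /=; field.
apply: le_trans (ler_normD _ _) _.
have h1 := dot_near y nq.
have h2 : `|2^-1 * dot (vs q tau) (vs q tau)| <= d.
  rewrite ger0_norm; last by rewrite mulr_ge0// /dot addr_ge0// -expr2 sqr_ge0.
  have s1 : (vs q tau).1 * (vs q tau).1 <= d.
    rewrite -expr2 -real_normK ?num_real// expr2.
    by have := normr_ge0 (q.1 - tau.1); rewrite /vs /=; nra.
  have s2 : (vs q tau).2 * (vs q tau).2 <= d.
    rewrite -expr2 -real_normK ?num_real// expr2.
    by have := normr_ge0 (q.2 - tau.2); rewrite /vs /=; nra.
  by rewrite /dot; lra.
by have := lerD h2 h1; lra.
Qed.

Variables (D : set (R * R)) (u : R * R -> R) (M : R) (x0 p : R * R).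
Hypotheses (oD : open D) (cD : cset D) (bD : bounded_set D).
Hypotheses (lu : lipc M u) (u0 : forall x, 0 <= u x) (mu_ : minimizes D u).
Hypotheses (cx0 : closure D x0) (nDx0 : ~ D x0).
Hypotheses (pM1 : `|p.1| <= M) (pM2 : `|p.2| <= M).
Hypothesis tgp : forall x, D x -> tg u x0 (vs x x0) = dot p (vs x x0).

Local Notation q := (dslope u p).
Local Notation Ph := (phase (vs p x0)).
Local Notation cluster := (cluster_slope D u x0 p).

(** [Th] is the upper limit of the phase of the slope jump at [x0], attained at a cluster value by
    compactness. By [cluster_slope_sign] it is positive, which excludes [tau = 0]. *)
Lemma max_cluster tau' : cluster tau' -> tau' != (0, 0) ->
  exists tau, [/\ cluster tau, tau != (0, 0) & forall e : R, 0 < e ->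
    exists2 r : R, 0 < r & forall x, good D u x -> near_pt x0 r x -> Ph (q x) <= Ph tau + e].
Proof.
move=> ct' t0'.
have P0 : 0 < Ph tau' / 2.
  have := cluster_slope_sign oD cD bD lu u0 mu_ cx0 nDx0 pM1 pM2 tgp ct' t0'.
  by have := sqnorm_gt0 t0'; rewrite /phase; lra.
pose A : set R := [set th | forall r : R, 0 < r ->
  exists x, [/\ good D u x, near_pt x0 r x & th < Ph (q x)]].
have A0 : A (Ph tau' / 2).
  move=> r r0; have [d d0 hd] := phase_near (vs p x0) tau' (divr_gt0 P0 (ltr0Sn _ 1)).
  have [x [gx xr tx]] := ct' r d r0 d0; exists x; split => //.
  by have := hd _ tx; rewrite ler_norml => /andP[h _]; have := P0; lra.
have hA : has_sup A.
  split; first by exists (Ph tau' / 2).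
  exists (2^-1 * (2 * M * (2 * M + 2 * M)) + 2 * M * norm1 (vs p x0)) => th /(_ 1 ltr01).
  move=> [x [_ _ /ltW h]]; apply: le_trans h _.
  have [q1 q2] := dslope_le lu pM1 pM2 x; have M0 := le_trans (normr_ge0 _) q1.
  apply: lerD; last exact: dot_le.
  apply: ler_wpM2l => //; apply: le_trans (dot_le _ q1 q2) _; apply: ler_wpM2l => //.
  exact: lerD.
pose Th := sup A.
have Th0 : 0 < Th by apply: lt_le_trans P0 _; exact: ub_le_sup hA.2 _ A0.
pose Q r q' := exists x, [/\ good D u x, near_pt x0 r x, q' = q x & Th - r < Ph q'].
have mQ r s q' : r <= s -> Q r q' -> Q s q'.
  move=> rs [x [gx [x1 x2] e h]]; exists x; split => //; last by lra.
  by split; [exact: lt_le_trans x1 rs|exact: lt_le_trans x2 rs].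
have hQ r : 0 < r -> exists q', [/\ Q r q', `|q'.1| <= 2 * M & `|q'.2| <= 2 * M].
  move=> r0; have [th Ath hth] := sup_adherent r0 hA.
  have [x [gx xr hx]] := Ath r r0; have [q1 q2] := dslope_le lu pM1 pM2 x.
  exists (q x); split => //; exists x; split => //.
  exact: lt_trans hx.
have [tau htau] := compact_cluster mQ hQ.
have Pt : Th <= Ph tau.
  apply/ler_addgt0Pr => e e0; have e2 : 0 < e / 2 by rewrite divr_gt0.
  have [d d0 hd] := phase_near (vs p x0) tau e2.
  have [q' [x [_ _ _ h1]] h2] := htau (e / 2) d e2 d0.
  by have := hd _ h2; rewrite ler_norml => /andP[_ h3]; lra.
exists tau; split.
- by move=> r e r0 e0; have [q' [x [gx xr -> _]] h] := htau r e r0 e0; exists x.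
- apply: contraPneq Pt => ->; rewrite /phase /dot /= !mul0r !addr0 mulr0 => h.
  by have := lt_le_trans Th0 h; rewrite ltxx.
move=> e e0; apply: contrapT => nr.
have : A (Th + e / 2).
  move=> r r0; apply: contrapT => nx; apply: nr; exists r => // x gx xr.
  rewrite leNgt; apply/negP => h; apply: nx; exists x; split => //; lra.
by move=> /(ub_le_sup hA.2); rewrite -/Th; lra.
Qed.

Definition frame tau n := [/\ dot n n = dot tau tau, dot tau n = 0, norm1 n = norm1 tau &
  forall y, y = lc (dot n y / dot tau tau) (dot tau y / dot tau tau) n tau].

Lemma frame_perp tau : tau != (0, 0) -> frame tau (perp tau).
Proof.
move=> t0; split.
- by rewrite /dot /perp /=; ring.
- by rewrite /dot /perp /=; ring.
- exact: norm1_perp.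
- by move=> y; exact: perp_coord.
Qed.

Lemma frame_opv tau n : frame tau n -> frame tau (opv n).
Proof.
move=> [h1 h2 h3 h4]; split.
- by rewrite -h1 /dot /opv /=; ring.
- by rewrite -[RHS]oppr0 -h2 /dot /opv /=; ring.
- by rewrite -h3 /norm1 /opv /= !normrN.
- by move=> y; rewrite {1}[y]h4 /lc /dot /opv /=; congr pair; ring.
Qed.

(** Near [x0] the points with jump close to [tau] have a nonzero component along [perp tau], so one
    of the two orientations occurs arbitrarily close to [x0]. *)
Lemma cluster_side tau : cluster tau -> tau != (0, 0) -> exists n, frame tau n /\
  forall r e : R, 0 < r -> 0 < e -> exists x,
    [/\ good D u x, near_pt x0 r x, near_pt tau e (q x) & 0 < dot n (vs x x0)].
Proof.
move=> ct t0; apply: contrapT => nn.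
have H n : frame tau n -> exists r e : R, [/\ 0 < r, 0 < e & forall x, good D u x ->
    near_pt x0 r x -> near_pt tau e (q x) -> dot n (vs x x0) <= 0].
  move=> fn; apply: contrapT => h; apply: nn; exists n; split => // r e r0 e0.
  apply: contrapT => h2; apply: h; exists r, e; split => // x gx xr tx.
  by rewrite leNgt; apply/negP => h3; apply: h2; exists x.
have f1 := frame_perp t0.
have [r1 [e1 [r10 e10 h1]]] := H _ f1; have [r2 [e2 [r20 e20 h2]]] := H _ (frame_opv f1).
have T0 := sqnorm_gt0 t0; have n0 := norm1_gt0 t0.
have [e e0 [ee1 ee2 ee3]] := small3 e10 e20 (divr_gt0 (divr_gt0 T0 (ltr0Sn _ 1)) n0).
have [r r0 [rr1 rr2 _]] := small3 r10 r20 r20.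
have nearS (a b : R) y y' : a <= b -> near_pt y a y' -> near_pt y b y'.
  by move=> ab [? ?]; split; exact: lt_le_trans ab.
have [x [gx xr tx]] := ct r e r0 e0.
rewrite ler_pdivlMr// in ee3.
have [y0 yN] := cluster_perp lu nDx0 pM1 pM2 tgp ct t0 gx tx ee3.
have := h1 x gx (nearS _ _ _ _ rr1 xr) (nearS _ _ _ _ ee1 tx).
have := h2 x gx (nearS _ _ _ _ rr2 xr) (nearS _ _ _ _ ee2 tx).
rewrite (_ : dot (opv _) _ = - dot (perp tau) (vs x x0)); last by rewrite /dot /opv /=; ring.
move=> g1 g2; have g3 : dot (perp tau) (vs x x0) = 0 by apply/le_anti; rewrite g2/=; lra.
by move: yN; rewrite g3 normr0 mulr0 leNgt mulr_gt0.
Qed.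

(** Keeps the lowered function admissible. If [u x0 = 0] the directional derivative is nonnegative;
    otherwise the plane stays positive near [x0]. *)
Lemma tangent_nonneg : exists2 r : R, 0 < r & forall x, D x -> near_pt x0 r x ->
  0 <= u x0 + dot p (vs x x0).
Proof.
have [M0 cu _] := lu.
have := u0 x0; rewrite le_eqVlt => /predU1P[ux0|ux0].
  exists 1 => // x Dx _; rewrite -ux0 add0r -tgp//; apply/ler_addgt0Pr => e e0.
  have [s s0 /(_ s)] := tg_near x0 cu (vs x x0) e0.
  rewrite s0 lexx => /(_ isT); rewrite -ux0 add0r => h.
  by rewrite -(pmulr_rge0 _ s0); exact: le_trans h.
have M1 : 0 < 2 * M + 1 by lra.
exists (u x0 / (2 * M + 1)) => [|x Dx /norm1_near xr]; first exact: divr_gt0.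
have := dot_abs (vs x x0) pM1 pM2; rewrite ler_norml => /andP[h _].
have := ler_wpM2l M0 xr.
have : M * (2 * (u x0 / (2 * M + 1))) <= u x0.
  rewrite (_ : M * _ = 2 * M * u x0 / (2 * M + 1)); last by field; rewrite gt_eqF.
  by rewrite ler_pdivrMr//; lra.
lra.
Qed.

End no_jump.

Section zero_jump.
Context {R : realType}.
Implicit Types (x y z p q k v tau n : R * R).

Lemma dotC p q : dot p q = dot q p.
Proof. by rewrite /dot; ring. Qed.

Lemma frame_dot tau n q y : frame tau n ->
  dot q y = dot n q / dot tau tau * dot n y + dot tau q / dot tau tau * dot tau y.
Proof.
move=> [_ _ _ /(_ y) e]; rewrite [in LHS]e /lc /dot /=; ring.
Qed.

Lemma frame_phase tau n q v : tau != (0, 0) -> frame tau n ->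
  let al := dot tau q / dot tau tau in let be := dot n q / dot tau tau in
  phase v q = 2^-1 * dot tau tau * (al ^+ 2 + be ^+ 2) + al * dot tau v + be * dot n v.
Proof.
move=> t0 fn /=; have T0 := sqnorm_gt0 t0.
by rewrite /phase !(frame_dot q _ fn); field; rewrite gt_eqF.
Qed.

Variables (u : R * R -> R) (x0 p : R * R).

(** Normalizes the tilted cost to vanish on the supporting plane of slope [p] at [x0]. *)
Definition tilt_cst n (kk : R) : R :=
  - (2^-1 * sqnorm p) + dot p x0 - u x0 + kk * dot n p.

Lemma tilted_costE n (kk : R) x : tilted_cost n kk (tilt_cst n kk) (tangent_plane u x) =
  phase (vs p x0) (dslope u p x) + (u x + dot (gd u x) (vs x0 x) - u x0) - kk * dot n (dslope u p x).
Proof.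
rewrite /tilted_cost /tilt_cst /tangent_plane /phase /dslope; move: (gd u x) => g.
by rewrite /pl_cost /sqnorm /dot /vs /sc /=; field.
Qed.

Lemma tilted_cost0 n (kk : R) : tilted_cost n kk (tilt_cst n kk) (p, u x0 - dot p x0) = 0.
Proof. by rewrite /tilted_cost /tilt_cst /pl_cost /sqnorm /dot /sc /=; ring. Qed.

Lemma sector_near tau n (r a : R) x : tau != (0, 0) -> frame tau n -> 0 < a -> a <= 1 ->
  0 < scoord x0 tau x -> sector x0 tau n r a x ->
  norm1 (vs x x0) <= 15 * norm1 tau / dot tau tau * r.
Proof.
move=> t0 [_ _ nn co] a0 a1 S0 [h1 h2]; have T0 := sqnorm_gt0 t0.
have N0 : 0 < ncoord x0 n x by rewrite -(pmulr_rgt0 _ (_ : 0 < 4 * a)); lra.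
have := norm1_lc (dot n (vs x x0) / dot tau tau) (dot tau (vs x x0) / dot tau tau) n tau.
rewrite -co nn !normrM normfV (gtr0_norm T0) -/(ncoord x0 n x) (gtr0_norm N0).
have -> : `|dot tau (vs x x0)| = scoord x0 tau x by rewrite -(gtr0_norm S0) /scoord normrN.
move=> h; apply: le_trans h _; rewrite -mulrDl.
have -> : 15 * norm1 tau / dot tau tau * r = 15 * r / dot tau tau * norm1 tau by ring.
apply: ler_wpM2r; first exact: norm1_ge0.
rewrite -mulrDl ler_pM2r ?invr_gt0//.
have := ler_wpM2r (ltW N0) a1; lra.
Qed.

Variables (D : set (R * R)) (M : R).
Hypotheses (oD : open D) (cD : cset D) (bD : bounded_set D).
Hypotheses (lu : lipc M u) (u0 : forall x, 0 <= u x) (mu_ : minimizes D u).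
Hypotheses (cx0 : closure D x0) (nDx0 : ~ D x0).
Hypotheses (pM1 : `|p.1| <= M) (pM2 : `|p.2| <= M).
Hypothesis tgp : forall x, D x -> tg u x0 (vs x x0) = dot p (vs x x0).

Local Notation q := (dslope u p).

Lemma slope_mono_good x y : good D u x -> good D u y ->
  0 <= dot (vs (q x) (q y)) (vs x y).
Proof.
have [_ cu _] := lu; move=> [_ dx] [_ dy].
have := dif_subgradient cu (I : setT x) (I : setT y) dx.
have := dif_subgradient cu (I : setT y) (I : setT x) dy.
by rewrite /dslope; move: (gd u x) (gd u y) => g h; rewrite /dot /vs /=; lra.
Qed.

Lemma near_frame tau n (e c : R) q' : tau != (0, 0) -> frame tau n -> near_pt tau e q' ->
  e * norm1 tau <= c * dot tau tau ->
  `|dot tau q' / dot tau tau - 1| <= c /\ `|dot n q' / dot tau tau| <= c.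
Proof.
move=> t0 [_ nt nn _] tq h; have T0 := sqnorm_gt0 t0.
have := dot_near tau tq; have := dot_near n tq; rewrite nt subr0 nn.
rewrite !(dotC q').
move=> h1 h2; split.
  rewrite (_ : _ - 1 = (dot tau q' - dot tau tau) / dot tau tau); last by field; rewrite gt_eqF.
  by rewrite normrM normfV (gtr0_norm T0) ler_pdivrMr//; exact: le_trans h.
by rewrite normrM normfV (gtr0_norm T0) ler_pdivrMr//; exact: le_trans h.
Qed.

End zero_jump.

Section continuous_slope.
Context {R : realType}.
Implicit Types (x y z p q k v tau n : R * R).

Lemma dotBr v y z : dot v (vs y z) = dot v y - dot v z.
Proof. by rewrite /dot /vs /=; ring. Qed.

Lemma dot_norm1 v y : `|dot v y| <= norm1 v * norm1 y.
Proof. by apply: dot_abs; rewrite /norm1 ?lerDl ?lerDr. Qed.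

Lemma norm1_near_pt x0 x (r : R) : norm1 (vs x x0) < r -> near_pt x0 r x.
Proof.
by rewrite /norm1 /vs /near_pt /= => h; have := normr_ge0 (x.1 - x0.1);
  have := normr_ge0 (x.2 - x0.2); split; lra.
Qed.

Variables (u : R * R -> R) (x0 p : R * R) (D : set (R * R)) (M : R).
Hypotheses (oD : open D) (cD : cset D) (bD : bounded_set D).
Hypotheses (lu : lipc M u) (u0 : forall x, 0 <= u x) (mu_ : minimizes D u).
Hypotheses (cx0 : closure D x0) (nDx0 : ~ D x0).
Hypotheses (pM1 : `|p.1| <= M) (pM2 : `|p.2| <= M).
Hypothesis tgp : forall x, D x -> tg u x0 (vs x x0) = dot p (vs x x0).

Local Notation q := (dslope u p).
Local Notation cluster := (cluster_slope D u x0 p).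

Lemma frame_gap tau n x : frame tau n -> good D u x ->
  0 <= dot n (q x) / dot tau tau * ncoord x0 n x - dot tau (q x) / dot tau tau * scoord x0 tau x.
Proof.
move=> fn gx; have := gap_ge0 x0 p lu gx; have := tangent_below lu tgp gx.1.
rewrite (frame_dot (q x) (vs x x0) fn) -/(ncoord x0 n x) => h1 h2.
have -> : dot n (q x) / dot tau tau * ncoord x0 n x - dot tau (q x) / dot tau tau * scoord x0 tau x =
  dot n (q x) / dot tau tau * ncoord x0 n x + dot tau (q x) / dot tau tau * dot tau (vs x x0).
  by rewrite /scoord; ring.
by lra.
Qed.

Lemma ncoord_near tau n x (s : R) : frame tau n -> near_pt x0 s x ->
  ncoord x0 n x <= 2 * norm1 tau * s.
Proof.
move=> [_ _ fn1 _] xs; apply: le_trans (ler_norm _) _; apply: le_trans (dot_norm1 _ _) _.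
by rewrite fn1; have := ler_wpM2l (norm1_ge0 tau) (norm1_near xs); lra.
Qed.

Local Ltac clear_local := clear -oD cD bD lu u0 mu_ cx0 nDx0 pM1 pM2 tgp.

(** A point much closer to [x0] than [r], with jump very close to [t], lies in the sector. The
    errors in the phase, in the position and in the tilt are [T / 512] each, together less than the
    [T / 128] by which the bound falls below the phase of [t]. *)
Lemma no_cheap_sector t n (r a : R) : t != (0, 0) -> frame t n ->
  (forall x, D x -> 0 < scoord x0 t x) ->
  (forall s e : R, 0 < s -> 0 < e -> exists x,
    [/\ good D u x, near_pt x0 s x, near_pt t e (q x) & 0 < ncoord x0 n x]) ->
  0 < r -> 0 < a ->
  (forall x, good D u x -> sector x0 t n r a x ->
    tilted_cost n (32 * a)^-1 (tilt_cst u x0 p n (32 * a)^-1) (tangent_plane u x) <=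
    phase (vs p x0) t - dot t t / 128) -> False.
Proof.
move=> t0 fn S0 hside r0 a0 cheap.
have [M0 cu lu'] := lu; have T0 := sqnorm_gt0 t0; have n0 := norm1_gt0 t0.
set T := dot t t in T0 cheap.
have nearS (b c : R) y y' : b <= c -> near_pt y b y' -> near_pt y c y'.
  by move=> bc [? ?]; split; exact: lt_le_trans bc.
have [d d0 hd] := phase_near (vs p x0) t (divr_gt0 T0 (ltr0Sn _ 511)).
have [e1 e10 [e11 e12 e13]] : exists2 e1 : R, 0 < e1 & [/\ e1 <= d, e1 * norm1 t <= a / 16 * T &
   e1 * norm1 t <= 32^-1 * T].
  have d1 : 0 < a / 16 * T / norm1 t by apply: divr_gt0 => //; apply: mulr_gt0 => //; exact: divr_gt0.
  have d2 : 0 < 32^-1 * T / norm1 t by apply: divr_gt0 => //; exact: mulr_gt0.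
  have [e1 e10 [h1 h2 h3]] := small3 d0 d1 d2.
  by exists e1 => //; split => //; rewrite -ler_pdivlMr.
have [s1 s10 [s11 s12]] : exists2 s1 : R, 0 < s1 & 2 * norm1 t * s1 <= r /\ 4 * M * s1 <= T / 512.
  have d1 : 0 < r / (2 * norm1 t) by rewrite divr_gt0// mulr_gt0.
  have M1 : 0 < 4 * M + 1 by lra.
  have d2 : 0 < T / 512 / (4 * M + 1) := divr_gt0 (divr_gt0 T0 (ltr0Sn _ 511)) M1.
  have [s1 s10 [h1 h2 _]] := small3 d1 d2 d2.
  exists s1 => //; rewrite ler_pdivlMr ?mulr_gt0// in h1; rewrite ler_pdivlMr// in h2.
  by move: h1 h2 s10; clear_local; split; lra.
have [y [gy ys ty Ny]] := hside s1 e1 s10 e10.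
have Nle := ncoord_near fn ys.
have [_] := near_frame t0 fn ty e12; have [] := near_frame t0 fn ty e13.
rewrite -/T !ler_norml => /andP[l1 _] _ /andP[b1 b2].
have gap := frame_gap fn gy; rewrite -/T in gap.
have Sy := S0 _ gy.1.
have sy : sector x0 t n r a y.
  split; first by have := Nle; lra.
  have := ler_wpM2r (ltW Ny) b2; have := mulr_gt0 a0 Ny; rewrite -/(ncoord x0 n y) => h1 h2.
  have : 31 / 32 * scoord x0 t y <= dot t (q y) / T * scoord x0 t y.
    by apply: ler_wpM2r; [exact: ltW|move: l1; clear_local; lra].
  by move: gap h1 h2; clear_local; lra.
have := cheap y gy sy; rewrite tilted_costE; apply/negP; rewrite -ltNge.
have := hd _ (nearS _ _ _ _ e11 ty); rewrite ler_norml => /andP[h1 _].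
have h2 : - (T / 512) <= u y + dot (gd u y) (vs x0 y) - u x0.
  have [g1 g2] := lipc_gd y lu.
  have := dot_abs (vs x0 y) g1 g2; have := lu' x0 y; rewrite ler_norml (norm1_vsC x0).
  have := ler_wpM2l M0 (norm1_near ys) => w1 w2 /andP[w3 _].
  by move: s12 w1 w2 w3; clear_local; lra.
have h3 : (32 * a)^-1 * dot n (q y) <= T / 512.
  rewrite (_ : T / 512 = (32 * a)^-1 * (a / 16 * T)); last by field; rewrite gt_eqF.
  by apply: ler_wpM2l; [rewrite invr_ge0 mulr_ge0// ltW|rewrite -ler_pdivrMr].
by move: T0 h1 h2 h3; clear_local; lra.
Qed.

(** An extremal jump would make some tangent planes in a small sector expensive, whereas
    [sector_cheap] makes all of them cheap. *)
Lemma cluster_slope0 tau : cluster tau -> tau = (0, 0).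
Proof.
move=> ct'; apply/eqP; apply: contraPT ct' => t0' ct'.
have [{t0' ct'}t [ct t0 hmax]] := max_cluster oD cD bD lu u0 mu_ cx0 nDx0 pM1 pM2 tgp ct' t0'.
have [n [fn hside]] := cluster_side lu nDx0 pM1 pM2 tgp ct t0.
have [M0 cu lu'] := lu; have T0 := sqnorm_gt0 t0; have n0 := norm1_gt0 t0.
have [fnn fnt fn1 fco] := fn.
set T := dot t t in T0 fnn *.
pose c := dot t (vs p x0); pose m := dot n (vs p x0).
have c0 : 0 <= c := cluster_slope_sign oD cD bD lu u0 mu_ cx0 nDx0 pM1 pM2 tgp ct t0.
have below := tangent_below lu tgp.
have S0 x : D x -> 0 < scoord x0 t x.
  by move=> Dx; rewrite oppr_gt0; exact: (cluster_polar_lt oD lu pM1 pM2 tgp ct t0 Dx).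
have [z Dz _] := (closureP D x0).1 cx0 1 ltr01.
have Sz0 := S0 z Dz; set Sz := scoord x0 t z in Sz0; pose Nz := ncoord x0 n z.
have [r1 r10 hpol] := slope_polar lu pM1 pM2 tgp Dz (divr_gt0 Sz0 (ltr0Sn _ 63)).
have [r2 r20 {}hmax] := hmax (T / 256) (divr_gt0 T0 (ltr0Sn _ 255)).
have [r3 r30 hnn] := tangent_nonneg lu u0 pM1 pM2 tgp.
have phT : phase (vs p x0) t = 2^-1 * T + c by rewrite /phase.
rewrite phT in hmax.
have [rho rho0 [rho1 rho2 rho3]] := small3 r10 r20 r30.
have nearS (a b : R) y y' : a <= b -> near_pt y a y' -> near_pt y b y'.
  by move=> ab [? ?]; split; exact: lt_le_trans ab.
have [am am0 [am1 am2 am3]] : exists2 am : R, 0 < am & [/\ am <= 1, am * (`|Nz| + 1) <= Sz / 64 &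
    am * (2^-1 * T + `|m| + 1) <= T / 128].
  have d1 : 0 < `|Nz| + 1 by exact: ltr_wpDl.
  have d2 : 0 < 2^-1 * T + `|m| + 1 by have := normr_ge0 m; lra.
  have [am am0 [h1 h2 h3]] := small3 ltr01 (divr_gt0 (divr_gt0 Sz0 (ltr0Sn _ 63)) d1)
    (divr_gt0 (divr_gt0 T0 (ltr0Sn _ 127)) d2).
  by exists am => //; split => //; rewrite -ler_pdivlMr.
have [e0 e00 [e01 e02]] : exists2 e0 : R, 0 < e0 & e0 * norm1 t <= am * T /\ e0 * norm1 t <= 32^-1 * T.
  have d1 : 0 < am * T / norm1 t by rewrite divr_gt0 ?mulr_gt0.
  have d2 : 0 < 32^-1 * T / norm1 t by apply: divr_gt0 => //; exact: mulr_gt0.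
  have [e0 e00 [h1 h2 _]] := small3 d1 d2 d2.
  by exists e0 => //; split; rewrite -ler_pdivlMr.
pose B := 15 * norm1 t / T.
have B0 : 0 < B by rewrite divr_gt0 ?mulr_gt0.
have [s0 s00 [s01 s02]] : exists2 s0 : R, 0 < s0 & B * (2 * norm1 t * s0) < rho /\ 8 * norm1 t * s0 <= Sz.
  have d1 : 0 < rho / (B * (4 * norm1 t)) by apply: divr_gt0 => //; apply: mulr_gt0 => //; exact: mulr_gt0.
  have d2 : 0 < Sz / (8 * norm1 t) by rewrite divr_gt0// mulr_gt0.
  have [s0 s00 [h1 h2 _]] := small3 d1 d2 d2.
  have b0 : 0 < B * (4 * norm1 t) by apply: mulr_gt0 => //; exact: mulr_gt0.
  exists s0 => //; rewrite ler_pdivlMr// in h1; rewrite ler_pdivlMr ?mulr_gt0// in h2.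
  by move: h1 h2 (mulr_gt0 (mulr_gt0 B0 n0) s00); clear_local; split; lra.
have [y0 [gy0 y0s ty0 N0]] := hside s0 e0 s00 e00.
(* Length and opening of the sector are read off the reference point [y0]: its coordinate along [n]
   and the component of its slope jump along [n]. The gap inequality makes [a] positive, and the
   choice of [e0] makes it at most [am]. *)
pose r := ncoord x0 n y0; pose a := dot n (q y0) / T; pose al0 := dot t (q y0) / T.
have r0 : 0 < r by [].
have rle : r <= 2 * norm1 t * s0 by exact: ncoord_near fn _.
have [_ a_am] := near_frame t0 fn ty0 e01; have [al1 _] := near_frame t0 fn ty0 e02.
rewrite -/T -/al0 in al1; rewrite -/T -/a in a_am.
have gap0 : 0 <= a * r - al0 * scoord x0 t y0 by exact: frame_gap.
have Sy0 := S0 _ gy0.1.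
have a0 : 0 < a.
  rewrite -(pmulr_lgt0 _ r0); move: al1; rewrite ler_norml => /andP[h1 _].
  have al00 : 0 < al0 by move: h1; clear_local; lra.
  by move: gap0 (mulr_gt0 al00 Sy0); clear_local; lra.
have {a_am}aam : a <= am by apply: le_trans a_am; exact: ler_norm.
have a1 : a <= 1 by exact: le_trans am1.
have hz1 : a * `|Nz| <= Sz / 64.
  by move: am0 am2 (ler_wpM2r (normr_ge0 Nz) aam); clear_local; lra.
have hm : 2^-1 * T * a ^+ 2 + a * `|m| <= T / 128.
  have k0 : 0 <= 2^-1 * T + `|m| + 1 by rewrite !addr_ge0// mulr_ge0// ltW.
  have h0 := ler_wpM2r k0 aam.
  have : T * a ^+ 2 <= T * a by apply: ler_wpM2l; [exact: ltW|rewrite expr2 -[leRHS]mulr1; apply: ler_wpM2l => //; exact: ltW].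
  by move: a0 am3 h0; clear_local; lra.
have hz2 : 4 * a * r <= Sz.
  by move: rle s02 (ler_wpM2r (ltW r0) a1); clear_local; lra.
have Brho : B * r < rho.
  by apply: le_lt_trans s01; apply: ler_wpM2l => //; exact: ltW.
have secn x : D x -> sector x0 t n r a x -> near_pt x0 rho x.
  move=> Dx sx; apply: norm1_near_pt; apply: le_lt_trans Brho.
  exact: (sector_near t0 fn a0 a1 (S0 _ Dx) sx).
(* With this strength the tilt of a slope with component [a / 2] along [n] is [T / 64], as
   [bad_slope] requires. *)
pose kk := (32 * a)^-1; pose th := 2^-1 * T + c - T / 128.
have kk0 : 0 <= kk by rewrite invr_ge0 mulr_ge0// ltW.
have costE x : tilted_cost n kk (tilt_cst u x0 p n kk) (tangent_plane u x) =
    2^-1 * T * ((dot t (q x) / T) ^+ 2 + (dot n (q x) / T) ^+ 2) + dot t (q x) / T * c + dot n (q x) / T * m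
    + (u x + dot (gd u x) (vs x0 x) - u x0) - T / (32 * a) * (dot n (q x) / T).
  rewrite tilted_costE (frame_phase (q x) (vs p x0) t0 fn) -/T -/c -/m /kk.
  by congr (_ - _); field; rewrite !gt_eqF.
have Ele x : good D u x -> u x + dot (gd u x) (vs x0 x) - u x0 <= 0.
  by move=> [_ dx]; rewrite subr_le0; exact: (dif_subgradient cu I I dx).
have hcore x : good D u x -> sector x0 t n r a x ->
    th < tilted_cost n kk (tilt_cst u x0 p n kk) (tangent_plane u x) -> core x0 t n r a x.
  move=> gx sx; rewrite costE => hbad.
  have xn := secn x gx.1 sx; have [sx1 sx2] := sx.
  have Sx := S0 x gx.1.
  have a4 : 0 < 4 * a by exact: mulr_gt0.
  have Nx : 0 < ncoord x0 n x by rewrite -(pmulr_rgt0 _ a4); exact: lt_trans sx2.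
  have gap := frame_gap fn gx.
  have pol := hpol x gx (nearS _ _ _ _ rho1 xn).
  rewrite (frame_dot (q x) (vs z x0) fn) -/(ncoord x0 n z) -/Nz in pol.
  have {}pol : dot n (q x) / T * Nz - dot t (q x) / T * Sz <= Sz / 64.
    by move: pol; rewrite -/T /Sz /scoord; clear_local; lra.
  have up := hmax x gx (nearS _ _ _ _ rho2 xn).
  rewrite (frame_phase (q x) (vs p x0) t0 fn) -/T -/c -/m in up.
  have [b0 b1 al2] := bad_slope T0 c0 a0 Sz0 hz1 hm Nx Sx sx2 gap pol up (Ele x gx) hbad.
  apply: (bad_core a0 r0 Sy0 Nx Sx al1 al2 b0 b1 gap0 gap).
  have := slope_mono_good p lu gx gy0; congr (0 <= _).
  rewrite (frame_dot _ _ fn) -/T !dotBr /a /al0 /r /ncoord /scoord !dotBr; ring.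
have core0 x : D x -> core x0 t n r a x -> 0 <= u x0 + dot p (vs x x0).
  move=> Dx cx; apply: hnn => //; apply: nearS rho3 _; apply: secn => //.
  exact: (core_sector S0 r0 a0).
have Gp : tilted_cost n kk (tilt_cst u x0 p n kk) (p, u x0 - dot p x0) <= th.
  by move: T0 c0; rewrite tilted_cost0 /th; clear_local; move: T c => T' c' ? ?; lra.
have cheap := sector_cheap oD cD bD lu u0 mu_ cx0 pM1 pM2 below T0 fco S0 r0 a0 kk0 Dz hz1 hz2
  Gp core0 hcore.
apply: (no_cheap_sector t0 fn S0 hside r0 a0) => x gx sx.
by rewrite phT; exact: cheap.
Qed.

End continuous_slope.

Lemma dot_is_linear {R : realType} (p : R * R) : linear (dot p).
Proof. by move=> k y z; rewrite /dot /= /GRing.scale /=; ring. Qed.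

HB.instance Definition _ {R : realType} (p : R * R) :=
  GRing.isLinear.Build R (R * R)%type R *:%R (dot p) (dot_is_linear p).

(** * Limits of the gradient *)

Section smoothness.
Context {R : realType}.
Implicit Types (x y z p q k v : R * R).

Lemma lip_continuous (M : R) (f : R * R -> R) : lip M f -> continuous f.
Proof.
move=> lf x; apply/cvgrPdist_le => e e0; have M1 : 0 < 2 * `|M| + 1 by have := normr_ge0 M; lra.
apply: filterS (near_pt_nbhs x (divr_gt0 e0 M1)) => y /norm1_near xy.
apply: le_trans (lip_abs x y lf) _; rewrite norm1_vsC.
apply: le_trans (ler_wpM2r (norm1_ge0 _) (ler_norm M)) _.
apply: le_trans (ler_wpM2l (normr_ge0 M) xy) _.
rewrite (_ : `|M| * _ = 2 * `|M| * e / (2 * `|M| + 1)); last by field; rewrite gt_eqF.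
by rewrite ler_pdivrMr//; lra.
Qed.

Lemma dot_continuous p : continuous (dot p).
Proof.
have [_ _ /lip_continuous] := @pl_lipc R _ (p, 0) (conj (le_max_l `|p.1| `|p.2|) (le_max_r _ _)).
by rewrite (_ : pl (p, 0) = dot p)//; apply/funext => y; exact: addr0.
Qed.

Lemma norm1_norm y : norm1 y <= 2 * `|y|.
Proof.
rewrite /norm1 prod_normE /=.
have := le_max_l `|y.1| `|y.2|; have := le_max_r `|y.1| `|y.2|; lra.
Qed.

Lemma dif_differentiable f x p : dif f x p -> differentiable f x.
Proof.
move=> dfx.
have H (e : R) : 0 < e -> \forall h \near (0 : (R * R)%type),
    `|f (h + x) - (f x + dot p h)| <= e * `|h|.
  move=> e0; have [r r0 hr] := dfx _ (divr_gt0 e0 (ltr0Sn _ 1)).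
  apply: filterS (near_pt_nbhs (0 : R * R) r0) => h [h1 h2] /=.
  have := hr (h.1 + x.1, h.2 + x.2).
  rewrite /near_pt /= !addrK; rewrite !subr0 in h1 h2 => /(_ (conj h1 h2)).
  rewrite (_ : vs (h.1 + x.1, h.2 + x.2) x = h); last first.
    by case: (h) => h3 h4; rewrite /vs /= !addrK.
  rewrite (_ : (h.1 + x.1, h.2 + x.2) = h + x)// => le.
  have -> : f (h + x) - (f x + dot p h) = f (h + x) - f x - dot p h by ring.
  apply: le_trans le _.
  by have := ler_wpM2l (ltW e0) (norm1_norm h); lra.
have dE : 'd f x = dot p :> (_ -> _).
  apply: diff_unique; first exact: dot_continuous.
  by apply/eqaddoP => e; exact: H.
apply/diff_locallyP; rewrite dE; split; first exact: dot_continuous.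
by apply/eqaddoP => e; exact: H.
Qed.

Lemma dif_grad f x p : dif f x p -> grad f x = p.
Proof.
move=> dfx; rewrite /grad !(dif_derive _ dfx) /dot /= !mulr1 !mulr0 addr0 add0r.
by rewrite -surjective_pairing.
Qed.

End smoothness.

Section gradient_limit.
Context {R : realType}.
Implicit Types (x y z p q g k v : R * R).

Lemma near_ptS (a b : R) x y : a <= b -> near_pt x a y -> near_pt x b y.
Proof. by move=> ab [? ?]; split; exact: lt_le_trans ab. Qed.

Variables (D : set (R * R)) (u : R * R -> R) (M : R).
Hypotheses (oD : open D) (cD : cset D) (bD : bounded_set D).
Hypotheses (lu : lipc M u) (u0 : forall x, 0 <= u x) (mu_ : minimizes D u).

Definition grad_cluster x q := forall r e : R, 0 < r -> 0 < e ->
  exists y, [/\ good D u y, near_pt x r y & near_pt q e (gd u y)].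

Definition grad_limit x g := forall e : R, 0 < e ->
  exists2 r : R, 0 < r & forall y, good D u y -> near_pt x r y -> near_pt g e (gd u y).

Lemma good_dense x (r : R) : closure D x -> 0 < r -> exists2 y, good D u y & near_pt x r y.
Proof.
by move=> cx r0; have [y [Dy dy xy]] := ae_in_dense oD (lipc_ae_dif D lu) cx r0; exists y.
Qed.

Lemma grad_cluster_compact x (B : (R * R) -> Prop) :
  (forall r : R, 0 < r -> exists y, [/\ good D u y, near_pt x r y & B (gd u y)]) ->
  exists q, forall r e : R, 0 < r -> 0 < e ->
    exists y, [/\ good D u y, near_pt x r y, B (gd u y) & near_pt q e (gd u y)].
Proof.
move=> hB; pose Q (r : R) q := exists y, [/\ good D u y, near_pt x r y, B (gd u y) & q = gd u y].
have mQ r s q : r <= s -> Q r q -> Q s q.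
  by move=> rs [y [gy xy By ->]]; exists y; split => //; exact: near_ptS xy.
have hQ r : 0 < r -> exists q, [/\ Q r q, `|q.1| <= M & `|q.2| <= M].
  move=> /hB[y [gy xy By]]; have [g1 g2] := lipc_gd y lu.
  by exists (gd u y); split => //; exists y.
have [q hq] := compact_cluster mQ hQ.
by exists q => r e r0 e0; have [_ [y [gy xy By ->]] qe] := hq r e r0 e0; exists y.
Qed.

Lemma grad_cluster_exists x : closure D x -> exists q, grad_cluster x q.
Proof.
move=> cx; have [r r0|q hq] := @grad_cluster_compact x (fun=> True).
  by have [y gy xy] := good_dense cx r0; exists y.
by exists q => r e r0 e0; have [y [gy xy _ qe]] := hq r e r0 e0; exists y.
Qed.

(** Gradients are bounded, so values staying away from [g] would have another cluster point. *)
Lemma grad_limit_cluster x g : (forall q, grad_cluster x q -> q = g) -> grad_limit x g.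
Proof.
move=> hg e e0; apply: contrapT => nr.
have [r r0|q hq] := @grad_cluster_compact x (fun q => ~ near_pt g e q).
  apply: contrapT => ny; apply: nr; exists r => // y gy xy.
  by apply: contrapT => nb; apply: ny; exists y.
have qg : q = g by apply: hg => r d r0 d0; have [y [gy xy _ qd]] := hq r d r0 d0; exists y.
by have [y [_ _ nb]] := hq 1 e ltr01 e0; rewrite qg.
Qed.

Lemma cluster_subgradient x q z : grad_cluster x q -> u x + dot q (vs z x) <= u z.
Proof.
move=> cq; have [M0 cu lu'] := lu; apply/ler_addgt0Pr => e e0.
have n1 : 0 < norm1 (vs z x) + 1 by rewrite ltr_wpDl ?norm1_ge0.
have M1 : 0 < 4 * M + 1 by lra.
have [y [[Dy dy] xy qy]] := cq _ _ (divr_gt0 (divr_gt0 e0 (ltr0Sn _ 1)) M1)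
  (divr_gt0 (divr_gt0 e0 (ltr0Sn _ 1)) n1).
have h1 := dif_subgradient cu (I : setT y) (I : setT z) dy.
have [g1 g2] := lipc_gd y lu.
have h2 := dot_near (vs z x) qy; rewrite ler_norml in h2; case/andP: h2 => h2 _.
have h3 := dot_le (vs y x) g1 g2.
have h4 := lu' x y; rewrite norm1_vsC in h4.
have h5 : 2 * (M * norm1 (vs y x)) <= e / 2.
  apply: le_trans (ler_wpM2l _ (ler_wpM2l M0 (norm1_near xy))) _ => //.
  rewrite (_ : 2 * (M * (2 * (e / 2 / (4 * M + 1)))) = 4 * M * (e / 2) / (4 * M + 1)); last by field; rewrite gt_eqF.
  by rewrite ler_pdivrMr//; lra.
have h6 : e / 2 / (norm1 (vs z x) + 1) * norm1 (vs z x) <= e / 2.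
  by rewrite mulrAC ler_pdivrMr//; lra.
have h7 : dot (gd u y) (vs z y) = dot (gd u y) (vs z x) - dot (gd u y) (vs y x).
  by move: (gd u y) => g; rewrite /dot /vs /=; ring.
rewrite h7 in h1; lra.
Qed.

Lemma interior_grad_limit x : D x -> exists g, grad_limit x g.
Proof.
move=> Dx; have [g cg] := grad_cluster_exists (subset_closure Dx).
exists g; apply: grad_limit_cluster => q cq.
by apply: (interior_subgradient_unique oD cD bD lu u0 mu_ Dx) => z; exact: cluster_subgradient.
Qed.

Lemma boundary_grad_limit x : closure D x -> ~ D x -> exists g, grad_limit x g.
Proof.
move=> cx nDx; have [p hp] := tg_linear oD cD bD lu u0 mu_ cx nDx.
exists p; apply: grad_limit_cluster => q cq.
(* The Lipschitz constant is enlarged to bound also the slope [p] given by [tg_linear]. *)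
pose N := Num.max M (Num.max `|p.1| `|p.2|).
have lN : lipc N u by apply: lipcS lu; exact: le_max_l.
have p1 : `|p.1| <= N by rewrite /N !le_max lexx orbT.
have p2 : `|p.2| <= N by rewrite /N !le_max lexx !orbT.
have ct : cluster_slope D u x p (vs q p).
  move=> r e r0 e0; have [y [gy xy [q1 q2]]] := cq r e r0 e0; exists y; split => //.
  move: q1 q2; rewrite /dslope /near_pt /vs; move: (gd u y) => g /= q1 q2.
  by split; rewrite opprB addrA subrK.
have [] := cluster_slope0 oD cD bD lN u0 mu_ cx nDx p1 p2 hp ct.
move=> /eqP + /eqP; rewrite !subr_eq0 => /eqP e1 /eqP e2.
by rewrite [q]surjective_pairing e1 e2 -surjective_pairing.
Qed.

Lemma grad_limit_exists : exists G, forall x, closure D x -> grad_limit x (G x).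
Proof.
suff /choice[G hG] : forall x, exists g, closure D x -> grad_limit x g by exists G.
move=> x; have [cx|ncx] := pselect (closure D x); last by exists (0, 0).
have [Dx|nDx] := pselect (D x).
  by have [g hg] := interior_grad_limit Dx; exists g.
by have [g hg] := boundary_grad_limit cx nDx; exists g.
Qed.

(** Limits along a dense set are continuous: a good point close to [y] has its gradient near both
    [G x] and [G y]. *)
Lemma grad_limit_continuous G : (forall x, closure D x -> grad_limit x (G x)) ->
  {within closure D, continuous G}.
Proof.
move=> hG; apply/subspace_continuousP => x cx B /= nB.
have [e e0 he] := nbhs_near_pt nB; have e2 : 0 < e / 2 by rewrite divr_gt0.
have [r r0 hr] := hG x cx _ e2; have r2 : 0 < r / 2 by rewrite divr_gt0.
apply: filterS (near_pt_nbhs x r2) => y [y1 y2] cy; apply: he.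
have [s s0 hs] := hG y cy _ e2.
have sr : 0 < Num.min s (r / 2) by rewrite lt_min s0.
have [z gz [z1 z2]] := good_dense cy sr.
have [t1 t2] : Num.min s (r / 2) <= s /\ Num.min s (r / 2) <= r / 2 by rewrite !ge_min !lexx orbT.
have [a1 a2] : near_pt (G x) (e / 2) (gd u z).
  apply: hr gz _; split.
    by have := ler_distD y.1 z.1 x.1; lra.
  by have := ler_distD y.2 z.2 x.2; lra.
have [b1 b2] : near_pt (G y) (e / 2) (gd u z).
  by apply: hs gz _; split; [exact: lt_le_trans z1 t1|exact: lt_le_trans z2 t1].
rewrite distrC in b1; rewrite distrC in b2.
split.
  by have := ler_distD (gd u z).1 (G y).1 (G x).1; lra.
by have := ler_distD (gd u z).2 (G y).2 (G x).2; lra.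
Qed.

(** The limit is a subgradient at [x], whence the lower bound. For the upper one, the subgradient
    inequality at a good point [z] near [y] is tested at [x], with a slope within [e] of [g]. *)
Lemma grad_limit_dif x g : D x -> grad_limit x g -> dif u x g.
Proof.
move=> Dx hg e e0; have [M0 cu lu'] := lu.

have [r r0 hr] := hg e e0; have [s s0 hs] := (openP D).1 oD _ Dx.
have cg : grad_cluster x g.
  move=> a b a0 b0; have [c c0 hc] := hg b b0.
  have ac : 0 < Num.min a c by rewrite lt_min a0.
  have [y gy xy] := good_dense (subset_closure Dx) ac.
  exists y; split => //.
    by apply: near_ptS xy; rewrite ge_min lexx.
  by apply: hc => //; apply: near_ptS xy; rewrite ge_min lexx orbT.
have rs : 0 < Num.min r s by rewrite lt_min r0.
exists (Num.min r s) => // y xy.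
have low := cluster_subgradient y cg.
rewrite ger0_norm; last by lra.
apply/ler_addgt0Pr => d d0.
have [t t0 ht] := (openP _).1 (near_pt_open (x := x) (r := Num.min r s)) _ xy.
have K0 : 0 < 2 * (M + norm1 g + e) + 1 by have := norm1_ge0 g; lra.
have td : 0 < Num.min t (d / (2 * (M + norm1 g + e) + 1)) by rewrite lt_min t0 divr_gt0.
have cy : closure D y.
  by apply: subset_closure; apply: hs; apply: near_ptS xy; rewrite ge_min lexx orbT.
have [z gz yz] := good_dense cy td.
have [yz1 yz2] : near_pt y t z /\ near_pt y (d / (2 * (M + norm1 g + e) + 1)) z.
  by split; apply: near_ptS yz; rewrite ge_min lexx ?orbT.
have gz1 : near_pt g e (gd u z).
  by apply: hr gz _; apply: near_ptS (ht _ yz1); rewrite ge_min lexx.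
have h1 := dif_subgradient cu (I : setT z) (I : setT x) gz.2.
have h2 := dot_near (vs z x) gz1; rewrite ler_norml in h2; case/andP: h2 => _ h2.
have h3 := lu' y z; rewrite norm1_vsC in h3.
have h4 := dot_norm1 g (vs z y); rewrite ler_norml in h4; case/andP: h4 => _ h4.
have h5 : norm1 (vs z x) <= norm1 (vs z y) + norm1 (vs y x).
  rewrite /norm1 /vs /=; have := ler_distD y.1 z.1 x.1; have := ler_distD y.2 z.2 x.2; lra.
have h6 : (M + norm1 g + e) * norm1 (vs z y) <= d.
  have K1 : 0 <= M + norm1 g + e by have := norm1_ge0 g; lra.
  apply: le_trans (ler_wpM2l K1 (norm1_near yz2)) _.
  rewrite (_ : (M + norm1 g + e) * (2 * (d / (2 * (M + norm1 g + e) + 1))) =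
    2 * (M + norm1 g + e) * d / (2 * (M + norm1 g + e) + 1)); last first.
    by field; rewrite gt_eqF.
  by rewrite ler_pdivrMr//; move: (M + norm1 g + e) K1 => K K1; lra.
have h7 : dot (gd u z) (vs x z) = - dot (gd u z) (vs z x).
  by move: (gd u z) => h; rewrite /dot /vs /=; ring.
have h8 : dot g (vs z x) = dot g (vs z y) + dot g (vs y x) by rewrite /dot /vs /=; ring.
have h9 := ler_wpM2l (ltW e0) h5.
rewrite h7 in h1; rewrite h8 in h2; lra.
Qed.

End gradient_limit.

Theorem theorem1p1 (R : realType) (Omega : set (R * R)) (u : R * R -> R) :
  open Omega -> bounded_set Omega -> @convex_set R (R * R)%type Omega ->
  is_minimizer Omega u ->
  C1_closure Omega u.
Proof.
move=> oD bD /convex_set_cset cD [[cu uge0] minu].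
have cuD : cvx Omega u := cvxS (@subset_closure _ Omega) (convex_function_cvx cu).
have u0 x : Omega x -> 0 <= u x by move=> Dx; apply: uge0; exact: subset_closure.
(* From here on the minimizer is studied through [w], which agrees with [u] in [Omega] and also
   serves as its continuous extension. *)
have [M [w [lw w0 wu minw]]] := lipschitz_minimizer oD cD bD cuD u0
  (fun w M lw w0 => minu w (lip_K_class lw w0)).
have [G hG] := grad_limit_exists oD cD bD lw w0 minw.
have dw x : Omega x -> dif u x (G x).
  move=> Dx; have [r r0 hr] := (openP Omega).1 oD _ Dx.
  apply: (dif_near r0 (fun y xy => wu y (hr y xy))).
  by apply: (grad_limit_dif oD lw Dx); apply: hG; exact: subset_closure.
have cG := grad_limit_continuous oD lw hG.
split.
- by move=> x /dw; exact: dif_differentiable.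
- move=> x Dx B; rewrite (dif_grad (dw x Dx)) => nB.
  have /subspace_continuousP/(_ x (subset_closure Dx) B nB) := cG.
  have := open_nbhs_nbhs (conj oD Dx : open_nbhs x Omega).
  apply: filterS2 => y Dy; rewrite /= (dif_grad (dw y Dy)); apply; exact: subset_closure.
- exists w => //; apply: continuous_subspaceT; have [_ _] := lw; exact: lip_continuous.
- by exists G => // x Dx; rewrite (dif_grad (dw x Dx)).
Qed.
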